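(* Let $\Phi \neq C_2$ be a classical, reduced, irreducible root system of rank $\geq 2$ and $R$ a finitely generated commutative (unital) ring. For $\alpha\in\Phi$, let $K_\alpha=\{x_\alpha(p):p\in R\}$ denote the root subgroup of $\mathrm{St}_\Phi(R)$. Then for every $\alpha \in \Phi$, the pair $(\mathrm{St}_{\Phi}(R), K_{\alpha})$ has relative property $(F_{\mathcal{E}_{uc}})$.
   Context: Relative fixed point property. For a topological group $\Gamma$, a subgroup $K<\Gamma$ and a Banach space $\mathbb{E}$, the pair $(\Gamma,K)$ has relative property $(F_{\mathbb{E}})$ if every continuous affine isometric action of $\Gamma$ on $\mathbb{E}$ has a $K$-fixed point; for a class $\mathcal{E}$ of Banach spaces it has relative property $(F_{\mathcal{E}})$ if it has relative property $(F_{\mathbb{E}})$ for every $\mathbb{E}\in\mathcal{E}$. The groups here are discrete. $\mathcal{E}_{uc}$ is the class of all uniformly convex Banach spaces, where $\mathbb{E}$ is uniformly convex if there is $\delta:(0,2]\to(0,1]$ such that for all unit vectors $\xi,\eta\in\mathbb{E}$, $\|\xi-\eta\|\ge\varepsilon$ implies $\|\frac{\xi+\eta}{2}\|\le 1-\delta(\varepsilon)$. Root systems. A root system in a finite dimensional real vector space $E$ is a finite non-empty set $\Phi\subset E$ that spans $E$, does not contain $0$ and satisfies $\Phi=-\Phi$; its rank is $\dim E$. It is reduced if every line in $E$ contains at most two elements of $\Phi$; irreducible if there are no disjoint non-empty $\Phi_1,\Phi_2$ with $\Phi=\Phi_1\cup\Phi_2$ and $\mathrm{span}(\Phi_1)\cap\mathrm{span}(\Phi_2)=\{0\}$;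 classical if there is an inner product on $E$ such that $\frac{2(\alpha,\beta)}{(\beta,\beta)}\in\mathbb{Z}$ and $\alpha-\frac{2(\alpha,\beta)}{(\beta,\beta)}\beta\in\Phi$ for all $\alpha,\beta\in\Phi$. The classical reduced irreducible root systems are, up to isomorphism, $A_n$, $B_n$ ($n\ge3$), $C_n$ ($n\ge2$), $D_n$ ($n\ge4$), $E_6,E_7,E_8,F_4,G_2$. Steinberg group. $\mathrm{St}_\Phi(R)$ is the group generated by symbols $x_\alpha(p)$, $\alpha\in\Phi$, $p\in R$, subject to: (1) $x_\alpha(p_1)x_\alpha(p_2)=x_\alpha(p_1+p_2)$; (2) for all $\alpha,\beta\in\Phi$ with $\beta\ne-\alpha$ and all $p_1,p_2\in R$, $[x_\alpha(p_1),x_\beta(p_2)]=\prod_{i,j\ge1,\ i\alpha+j\beta\in\Phi}x_{i\alpha+j\beta}(C_{i,j}^{\alpha,\beta}p_1^ip_2^j)$, the product taken in order of increasing $i+j$, where $[g,h]=g^{-1}h^{-1}gh$ and $C_{i,j}^{\alpha,\beta}$ are the (integer) constants of the Chevalley commutator relation for Chevalley groups over fields, that is: fix a Chevalley basis of the complex simple Lie algebra $\mathfrak{g}$ of type $\Phi$, with root vectors $e_\gamma$ ($\gamma\in\Phi$), and put $y_\gamma(s)=\exp(s\,\mathrm{ad}\,e_\gamma)\in\mathrm{Aut}(\mathfrak{g})$ for $s\in\mathbb{C}$; then, for $\alpha,\beta\in\Phi$ with $\beta\neq\pm\alpha$, the $C_{i,j}^{\alpha,\beta}$ are the unique integers such that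 $[y_\alpha(s_1),y_\beta(s_2)]=\prod_{i,j\ge1,\ i\alpha+j\beta\in\Phi}y_{i\alpha+j\beta}(C_{i,j}^{\alpha,\beta}s_1^is_2^j)$ for all $s_1,s_2\in\mathbb{C}$, the product taken in the same order. *)

(* Defs.v *)
Set Warnings "-notation-overridden,-ambiguous-paths,-notation-incompatible-prefix".
From HB Require Import structures.
From mathcomp Require Import all_boot all_order all_algebra.
From mathcomp Require Import sesquilinear finmap complex.
From mathcomp Require Import all_classical all_reals all_analysis.

Set Implicit Arguments.
Unset Strict Implicit.
Unset Printing Implicit Defensive.

Import Order.TTheory GRing.Theory Num.Theory.
Import numFieldNormedType.Exports.

Local Open Scope classical_set_scope.
Local Open Scope ring_scope.

(** * Root systems *)

Section RootSystems.
Variables (R : realType) (E : vectType R).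
Implicit Types (Phi Psi : {fset E}) (Delta : seq E) (alpha beta : E).

Definition root_system Phi : Prop :=
  [/\ Phi != fset0,
      <<enum_fset Phi>>%VS = fullv,
      0 \notin Phi
    & forall alpha, (- alpha \in Phi) = (alpha \in Phi)].

(* Lines are taken through the origin: an affine line may contain a root string
   of length 3 or 4 of a reduced system. *)
Definition reduced_root_system Phi : Prop :=
  forall L : {vspace E}, \dim L = 1%N -> (#|` [fset x in Phi | x \in L]%fset| <= 2)%N.

Definition irreducible_root_system Phi : Prop :=
  ~ exists Phi1 Phi2 : {fset E},
      [/\ Phi1 != fset0 /\ Phi2 != fset0, [disjoint Phi1 & Phi2]%fset,
          Phi = (Phi1 `|` Phi2)%fset
        & (<<enum_fset Phi1>> :&: <<enum_fset Phi2>>)%VS = 0%VS].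

Definition classical_root_system Phi : Prop :=
  exists ip : {dot E for idfun},
    {in Phi &, forall alpha beta,
      let c := 2 * ip alpha beta / ip beta beta in
      c \is a Num.int /\ alpha - c *: beta \in Phi}.

Definition root_base Phi Delta : Prop :=
  [/\ {subset Delta <= Phi},
      basis_of fullv Delta
    & {in Phi, forall gamma, exists c : E -> nat,
        gamma = \sum_(delta <- Delta) delta *+ c delta \/
        gamma = - \sum_(delta <- Delta) delta *+ c delta}].

(* The pairs (i, j) indexing the product on the right of the commutator
   formula, in an order of increasing i + j.  Ties only occur in type G_2,
   between commuting factors; every way of breaking them is admitted. *)
Definition commutator_pairs Phi alpha beta (s : seq (nat * nat)) : Prop :=
  [/\ uniq s,
      sorted [rel u v : nat * nat | (u.1 + u.2 <= v.1 + v.2)%N] s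
    & forall i j, ((i, j) \in s) =
        [&& (0 < i)%N, (0 < j)%N & alpha *+ i + beta *+ j \in Phi]].

End RootSystems.

Definition root_system_iso (R : realType) (E E' : vectType R)
    (Phi : {fset E}) (Psi : {fset E'}) : Prop :=
  exists f : 'Hom(E, E'),
    [/\ lker f = 0%VS, limg f = fullv & [fset f x | x in Phi]%fset = Psi].

Definition root_system_C2 (R : realType) : {fset 'rV[R]_2} :=
  let e1 : 'rV[R]_2 := delta_mx 0 0 in
  let e2 : 'rV[R]_2 := delta_mx 0 1 in
  let s := [:: e1 + e2; e1 - e2; - e1 + e2; - e1 - e2;
               2 *: e1; - (2 *: e1); 2 *: e2; - (2 *: e2)] in
  [fset x in s]%fset.

(** * Exponential of an endomorphism *)

Definition expmx (K : numFieldType) (n : nat) (M : 'M[K]_n) : 'M[K]_n :=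
  limn (series (fun k => (k`!%:R)^-1 *: M ^+ k)).

Definition exp_end (K : numFieldType) (V : vectType K) (f : 'End(V)) : 'End(V) :=
  let b := vbasis fullv in passmx.hommx b b (expmx (passmx.mxof b b f)).

(** * Lie algebras and Chevalley bases *)

Section LieAlgebras.
Variables (K : fieldType) (V : vectType K) (br : {bilinear V -> V -> V}).
Implicit Types (I H : {vspace V}).

Definition lie_bracket : Prop :=
  (forall x, br x x = 0) /\
  (forall x y z, br x (br y z) + br y (br z x) + br z (br x y) = 0).

Definition lie_ideal I : Prop := forall x y, y \in I -> br x y \in I.

Definition simple_lie_algebra : Prop :=
  [/\ lie_bracket,
      exists x y, br x y != 0
    & forall I, lie_ideal I -> I = 0%VS \/ I = fullv].

(* A nilpotent, self-normalizing subalgebra. *)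
Definition cartan_subalgebra H : Prop :=
  [/\ {in H &, forall x y, br x y \in H},
      exists n, forall (s : seq V) (x : V),
        size s = n -> {subset s <= H} -> x \in H -> foldr br x s = 0
    & forall x, {in H, forall h, br x h \in H} -> x \in H].

Definition lie_root_space H (lam : 'Hom(subvs_of H, K^o)) (x : V) : Prop :=
  forall h : subvs_of H, br (vsval h) x = lam h *: x.

Definition lie_root H (lam : 'Hom(subvs_of H, K^o)) : Prop :=
  lam != 0 /\ exists2 x, x != 0 & lie_root_space lam x.

End LieAlgebras.

Section Chevalley.
Variables (R : realType) (E : vectType R) (Phi : {fset E}).
Variables (V : vectType R[i]) (br : {bilinear V -> V -> V}).

(* rho identifies Phi with the roots of (V, H): it is an R-linear embedding of E
   into the complex dual of H that maps Phi onto the set of roots. *)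
Definition lie_type (H : {vspace V}) (rho : E -> 'Hom(subvs_of H, R[i]^o)) : Prop :=
  [/\ forall (a : R) u v, rho (a *: u + v) = a%:C%C *: rho u + rho v,
      injective rho
    & forall lam, lie_root br lam <-> exists2 alpha, alpha \in Phi & lam = rho alpha].

(* The basis consists of the root vectors e gamma (gamma in Phi) and of the
   coroots h_alpha = [e_alpha, e_(-alpha)], alpha in Delta; here h_alpha is the
   element of [g_alpha, g_(-alpha)] on which alpha takes the value 2. *)
Definition chevalley_basis (H : {vspace V}) (rho : E -> 'Hom(subvs_of H, R[i]^o))
    (Delta : seq E) (e : E -> V) : Prop :=
  [/\ root_base Phi Delta,
      {in Phi, forall alpha, lie_root_space br (rho alpha) (e alpha)},
      {in Phi, forall alpha,
        exists2 h : subvs_of H, vsval h = br (e alpha) (e (- alpha)) & rho alpha h = 2},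
      {in Phi &, forall alpha beta, alpha + beta \in Phi ->
        exists c : R[i], br (e alpha) (e beta) = c *: e (alpha + beta) /\
          br (e (- alpha)) (e (- beta)) = - c *: e (- alpha - beta)}
    & basis_of fullv ([seq br (e alpha) (e (- alpha)) | alpha <- Delta] ++
                      [seq e gamma | gamma <- enum_fset Phi])].

Definition root_automorphism (e : E -> V) (gamma : E) (s : R[i]) : 'End(V) :=
  exp_end (s *: linfun (br (e gamma))).

End Chevalley.

Definition commutator_end (K : fieldType) (V : vectType K) (f g : 'End(V)) : 'End(V) :=
  (f^-1 \o (g^-1 \o (f \o g)))%VF.

(* C alpha beta i j is the constant C_{i,j}^{alpha,beta} of the Chevalley
   commutator relation; its values matter only for roots alpha, beta with
   beta <> +/- alpha, positive i, j and i alpha + j beta a root. *)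
Definition chevalley_constants (R : realType) (E : vectType R) (Phi : {fset E})
    (C : E -> E -> nat -> nat -> int) : Prop :=
  exists (V : vectType R[i]) (br : {bilinear V -> V -> V}) (H : {vspace V})
      (rho : E -> 'Hom(subvs_of H, R[i]^o)) (Delta : seq E) (e : E -> V),
    let y := root_automorphism br e in
    [/\ simple_lie_algebra br,
        cartan_subalgebra br H,
        lie_type Phi br rho,
        chevalley_basis Phi br rho Delta e
      & {in Phi &, forall alpha beta, beta != alpha -> beta != - alpha ->
          forall s, commutator_pairs Phi alpha beta s ->
          forall s1 s2 : R[i],
            commutator_end (y alpha s1) (y beta s2) =
            \big[(@comp_lfun _ _ _ _) / \1%VF]_(ij <- s)
               y (alpha *+ ij.1 + beta *+ ij.2)
                 ((C alpha beta ij.1 ij.2)%:~R * s1 ^+ ij.1 * s2 ^+ ij.2)}].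

(** * Groups given by generators and relations *)

Section Presentation.
Variable X : choiceType.

(* (x, false) stands for the generator x, and (x, true) for its inverse. *)
Definition word := seq (X * bool).

Definition word_inv (u : word) : word := rev [seq (a.1, ~~ a.2) | a <- u].

Definition word_comm (u v : word) : word := word_inv u ++ word_inv v ++ u ++ v.

Variable rel : word -> word -> Prop.

Inductive word_equiv : word -> word -> Prop :=
| Word_rel u v : rel u v -> word_equiv u v
| Word_cancel x b : word_equiv [:: (x, b); (x, ~~ b)] [::]
| Word_cat u u' v v' :
    word_equiv u u' -> word_equiv v v' -> word_equiv (u ++ v) (u' ++ v')
| Word_refl u : word_equiv u u
| Word_sym u v : word_equiv u v -> word_equiv v u
| Word_trans v u w : word_equiv u v -> word_equiv v w -> word_equiv u w.

Definition word_eqv (u v : word) : bool := `[< word_equiv u v >].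

Lemma word_eqv_refl : reflexive word_eqv.
Proof. by move=> u; apply/asboolP; apply: Word_refl. Qed.

Lemma word_eqv_sym : symmetric word_eqv.
Proof. by move=> u v; apply/asboolP/asboolP; apply: Word_sym. Qed.

Lemma word_eqv_trans : transitive word_eqv.
Proof.
by move=> v u w /asboolP uv /asboolP vw; apply/asboolP; apply: Word_trans uv vw.
Qed.

Canonical word_eqv_equiv :=
  EquivRel word_eqv word_eqv_refl word_eqv_sym word_eqv_trans.

Definition presented := {eq_quot word_eqv_equiv}%qT.

HB.instance Definition _ := Choice.on presented.
HB.instance Definition _ := EqQuotient.on presented.

Definition presented_class (u : word) : presented := (\pi_presented u)%qT.

Lemma presented_classP u v : presented_class u = presented_class v <-> word_equiv u v.
Proof.
split=> [/eqP|uv]; first by rewrite eqmodE => /asboolP.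
by apply/eqP; rewrite eqmodE; apply/asboolP.
Qed.

Lemma presented_class_repr (g : presented) : presented_class (repr g) = g.
Proof. exact: reprK. Qed.

Lemma repr_presented_class u : word_equiv (repr (presented_class u)) u.
Proof. by apply/presented_classP; rewrite presented_class_repr. Qed.

Definition presented_mul (g h : presented) := presented_class (repr g ++ repr h).
Definition presented_inv (g : presented) := presented_class (word_inv (repr g)).

Lemma presented_mulE u v :
  presented_mul (presented_class u) (presented_class v) = presented_class (u ++ v).
Proof. by apply/presented_classP/Word_cat; apply: repr_presented_class. Qed.

Lemma word_inv_cat u v : word_inv (u ++ v) = word_inv v ++ word_inv u.
Proof. by rewrite /word_inv map_cat rev_cat. Qed.

Lemma word_invK : involutive word_inv.
Proof.
move=> u; rewrite /word_inv map_rev revK -map_comp -[RHS]map_id.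
by apply: eq_map => -[x b] /=; rewrite negbK.
Qed.

Lemma word_invr u : word_equiv (u ++ word_inv u) [::].
Proof.
elim: u => [|[x b] u IHu]; first exact: Word_refl.
have -> : ((x, b) :: u) ++ word_inv ((x, b) :: u) =
    [:: (x, b)] ++ (u ++ word_inv u) ++ [:: (x, ~~ b)].
  by rewrite -(cat1s _ u) word_inv_cat -!catA.
apply: (@Word_trans ([:: (x, b)] ++ [::] ++ [:: (x, ~~ b)])).
  by do 2?apply: Word_cat => //; apply: Word_refl.
exact: Word_cancel.
Qed.

Lemma word_invl u : word_equiv (word_inv u ++ u) [::].
Proof. by rewrite -{2}[u]word_invK; apply: word_invr. Qed.

Lemma word_inv_equiv u v : word_equiv u v -> word_equiv (word_inv u) (word_inv v).
Proof.
move=> uv; apply: (@Word_trans (word_inv u ++ (v ++ word_inv v))).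
  rewrite -{1}[word_inv u]cats0; apply: Word_cat; first exact: Word_refl.
  exact/Word_sym/word_invr.
rewrite catA -{2}[word_inv v]cat0s; apply: Word_cat; last exact: Word_refl.
apply: (@Word_trans (word_inv u ++ u)); last exact: word_invl.
by apply: Word_cat; [apply: Word_refl | apply: Word_sym].
Qed.

Lemma presented_invE u :
  presented_inv (presented_class u) = presented_class (word_inv u).
Proof. by apply/presented_classP/word_inv_equiv/repr_presented_class. Qed.

Lemma presented_mulA : associative presented_mul.
Proof.
move=> f g h; rewrite -[f]presented_class_repr -[g]presented_class_repr.
by rewrite -[h]presented_class_repr !presented_mulE catA.
Qed.

Lemma presented_mul1 : left_id (presented_class [::]) presented_mul.
Proof. by move=> g; rewrite -[g]presented_class_repr presented_mulE. Qed.

Lemma presented_mulr1 : right_id (presented_class [::]) presented_mul.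
Proof. by move=> g; rewrite -[g]presented_class_repr presented_mulE cats0. Qed.

Lemma presented_mulV : left_inverse (presented_class [::]) presented_inv presented_mul.
Proof.
move=> g; rewrite -[g]presented_class_repr presented_invE presented_mulE.
exact/presented_classP/word_invl.
Qed.

Lemma presented_mulrV : right_inverse (presented_class [::]) presented_inv presented_mul.
Proof.
move=> g; rewrite -[g]presented_class_repr presented_invE presented_mulE.
exact/presented_classP/word_invr.
Qed.

HB.instance Definition _ := isGroup.Build presented
  presented_mulA presented_mul1 presented_mulr1 presented_mulV presented_mulrV.

End Presentation.

(** * Steinberg groups *)

Section Steinberg.
Variables (R : realType) (E : vectType R) (Phi : {fset E}).
Variables (C : E -> E -> nat -> nat -> int) (A : comPzRingType).

Definition st_gen (alpha : Phi) (p : A) : word (Phi * A)%type := [:: ((alpha, p), false)].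

Definition st_comm_word (alpha beta : Phi) (p1 p2 : A) (s : seq (nat * nat)) :
    word (Phi * A)%type :=
  flatten [seq if insub (val alpha *+ ij.1 + val beta *+ ij.2) is Some gamma
               then st_gen gamma
                      ((p1 ^+ ij.1 * p2 ^+ ij.2) *~ C (val alpha) (val beta) ij.1 ij.2)
               else [::] | ij <- s].

Inductive steinberg_rel : word (Phi * A)%type -> word (Phi * A)%type -> Prop :=
| Steinberg_add alpha p1 p2 :
    steinberg_rel (st_gen alpha p1 ++ st_gen alpha p2) (st_gen alpha (p1 + p2))
| Steinberg_comm (alpha beta : Phi) p1 p2 s :
    val beta <> - val alpha -> commutator_pairs Phi (val alpha) (val beta) s ->
    steinberg_rel (word_comm (st_gen alpha p1) (st_gen beta p2))
                  (st_comm_word alpha beta p1 p2 s).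

Definition steinberg : groupType := presented steinberg_rel.

Definition steinberg_x (alpha : Phi) (p : A) : steinberg :=
  presented_class steinberg_rel (st_gen alpha p).

Definition root_subgroup (alpha : Phi) : set steinberg := range (steinberg_x alpha).

End Steinberg.

Arguments steinberg {R E} Phi C A.
Arguments root_subgroup {R E Phi} C A alpha _.

Definition finitely_generated_ring (A : pzRingType) : Prop :=
  exists s : seq A, forall S : {pred A},
    subring_closed S -> {subset s <= S} -> forall a, a \in S.

(** * Relative fixed point properties *)

Section FixedPoints.
Variable R : realType.

Definition affine_isometry (E : normedModType R) (f : E -> E) : Prop :=
  exists (L : {linear E -> E}) (b : E),
    (forall x, f x = L x + b) /\ (forall x, `|L x| = `|x|).

Definition affine_isometric_action (G : groupType) (E : normedModType R)
    (act : G -> E -> E) : Prop :=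
  [/\ forall x, act 1%g x = x,
      forall g h x, act (g * h)%g x = act g (act h x)
    & forall g, affine_isometry (act g)].

(* G carries the discrete topology, for which every such action is continuous. *)
Definition relative_F (G : groupType) (K : set G) (E : completeNormedModType R) : Prop :=
  forall act : G -> E -> E, affine_isometric_action act ->
    exists x : E, forall g, K g -> act g x = x.

Definition relative_F_class (G : groupType) (K : set G)
    (EE : completeNormedModType R -> Prop) : Prop :=
  forall E, EE E -> relative_F K E.

Definition uniformly_convex (E : completeNormedModType R) : Prop :=
  exists delta : R -> R, forall eps, 0 < eps <= 2 ->
    0 < delta eps <= 1 /\
    forall xi eta : E, `|xi| = 1 -> `|eta| = 1 -> eps <= `|xi - eta| ->
      `|2^-1 *: (xi + eta)| <= 1 - delta eps.

End FixedPoints.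

(* Main.v *)
(* In a uniformly convex space a group with a bounded orbit fixes the Chebyshev
   centre of that orbit, so it suffices to bound the displacement of a point xi
   by x_alpha(p) uniformly in p.

   First let alpha = beta + gamma for a subsystem A_2 spanned by beta and gamma
   that is closed in Phi.  Its six root subgroups form a hexagon in which any
   three consecutive ones X, Z, Y generate a Heisenberg group with centre Z.
   Fix ring generators, among them 2, and let the box of size n of a root
   subgroup be the composite of the averages (1 + x(m)) / 2 over the monomials
   m of degree at most n.  If [x, y] = z, then by uniform convexity averaging
   over x and y shrinks every vector v by a fixed factor, unless z moves v by
   less than |v| / 2.  Iterating this over many commuting pairs with the same z
   shows that the X-box and the Y-box annihilate v - z v up to an exponentially
   small error, even if the degree of z slightly exceeds the size of the Z-box;
   therefore the Z-box between them can be enlarged at exponentially small cost.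
   Enlarging the six boxes in turn, from sizes of order h^3 to sizes of order
   (h+1)^3, produces a sequence of points at bounded distance from xi that is
   asymptotically fixed by each element of the middle root subgroup.

   Every other root is reached from such good ones by the commutator formula.
   In a B_2 with short simple root s and long simple root l, [x_s(1), x_l(q)]
   bounds x_(s+l)(q) if l and 2s+l are good, while [x_s(p), x_l(q)] bounds
   x_(2s+l)(p^2 q) uniformly in p if s and s+l are good; as
   2p = (p+1)^2 - p^2 - 1 and the ring is generated by finitely many elements
   as a module over the subring of all p^2 + 2r, this is enough.  In a G_2 one
   bounds x_(2s+l)((p^2-p)q) uniformly in q, and the quotient of the ring by the
   ideal generated by 2 and all t^2 - t, t a generator, is finite.  These
   arguments use that the constants C_(1,1) and C_(2,1) are +1 or -1, which
   follows by comparing the coefficients of the commutator formula with the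
   structure constants of the Chevalley basis. *)

Require Import Defs.
Set Warnings "-notation-overridden,-ambiguous-paths,-notation-incompatible-prefix".
From HB Require Import structures.
From mathcomp Require Import all_boot all_order all_algebra finmap.
From mathcomp Require Import sesquilinear complex.
From mathcomp Require Import all_classical all_reals all_analysis.
From mathcomp Require Import zify ring lra.

Set Implicit Arguments.
Unset Strict Implicit.
Unset Printing Implicit Defensive.

Import Order.TTheory GRing.Theory Num.Theory.
Import numFieldNormedType.Exports.

Local Open Scope ring_scope.

(** The displacement of a point by [x (mon e)] grows only quadratically in the degree of [e],
    because a monomial is a commutator of two of half its degree, and the cardinality of a box is
    polynomial in its size; each change of a box of size about h^3 costs a factor [rho ^+ h] times a
    polynomial, which is summable. The exponent 3 is forced: h levels of h pairs each make h^2
    pairs, and their exponents must be h apart up to a constant to make the cross commutators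
    negligible. The ratio of consecutive cubes tends to 1, so the neighbours of a box leave room for
    its next size. The generator 2 supplies dyadic chains z, z^2, z^4, ...; an average over l of
    them damps the displacement by z to 2^-l times that of the next member. The contraction is
    linear but the action affine; a second dyadic telescoping connects the two. In [C_2] no root
    lies in an [A_2]; elsewhere a root outside the plane of a [B_2] puts its short or its long roots
    into a closed [A_2]. *)

(* Reflexive normalisation of linear combinations: an equation in a module is
   reduced to the equations between the coefficients of its atoms. *)
Section LinearCombinations.
Variables (K : pzRingType) (V : lmodType K).

Inductive lincomb :=
| LAtom of nat
| LZero
| LAdd of lincomb & lincomb
| LOpp of lincomb
| LScale of K & lincomb
| LMuln of lincomb & nat.

Fixpoint lincomb_eval (env : seq V) (e : lincomb) : V :=
  match e with
  | LAtom i => nth 0 env i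
  | LZero => 0
  | LAdd e1 e2 => lincomb_eval env e1 + lincomb_eval env e2
  | LOpp e1 => - lincomb_eval env e1
  | LScale c e1 => c *: lincomb_eval env e1
  | LMuln e1 n => lincomb_eval env e1 *+ n
  end.

(** The index test is [eqn], which [cbn] evaluates on numerals inside the tactic [lincomb]. *)
Fixpoint lincomb_coef (e : lincomb) (i : nat) : K :=
  match e with
  | LAtom j => if eqn i j then 1 else 0
  | LZero => 0
  | LAdd e1 e2 => lincomb_coef e1 i + lincomb_coef e2 i
  | LOpp e1 => - lincomb_coef e1 i
  | LScale c e1 => c * lincomb_coef e1 i
  | LMuln e1 n => n%:R * lincomb_coef e1 i
  end.

Lemma lincomb_evalE env e :
  lincomb_eval env e = \sum_(i < size env) lincomb_coef e i *: env`_i.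
Proof.
elim: e => [j||e1 IH1 e2 IH2|e1 IH1|c e1 IH1|e1 IH1 n] /=.
- have [ltj|gej] := ltnP j (size env); last first.
    rewrite nth_default // big1 // => i _; case: eqnP => [ij|]; last by rewrite scale0r.
    by move: (ltn_ord i); rewrite ij ltnNge gej.
  rewrite (bigD1 (Ordinal ltj)) //= big1 => [|i]; first by case: eqnP => // _; rewrite scale1r addr0.
  by rewrite -val_eqE /=; case: eqnP => [->|_ _]; rewrite ?eqxx ?scale0r.
- by rewrite big1 // => i _; rewrite scale0r.
- by rewrite IH1 IH2 -big_split; apply: eq_bigr => i _; rewrite scalerDl.
- by rewrite IH1 -sumrN; apply: eq_bigr => i _; rewrite scaleNr.
- by rewrite IH1 scaler_sumr; apply: eq_bigr => i _; rewrite scalerA.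
- by rewrite IH1 -sumrMnl; apply: eq_bigr => i _; rewrite mulr_natl scalerMnl.
Qed.

(** Computes to one conjunct per atom, which [repeat split] turns into scalar goals. *)
Fixpoint all_below (n : nat) (P : nat -> Prop) : Prop :=
  if n is n'.+1 then P n' /\ all_below n' P else True.

Lemma all_belowP n P : all_below n P -> forall i, (i < n)%N -> P i.
Proof.
elim: n => //= n IHn [Pn Pl] i; rewrite ltnS leq_eqVlt => /orP[/eqP->|] //.
exact: IHn.
Qed.

Lemma lincomb_eq env e1 e2 :
  all_below (size env) (fun i => lincomb_coef e1 i = lincomb_coef e2 i) ->
  lincomb_eval env e1 = lincomb_eval env e2.
Proof.
move=> h; rewrite !lincomb_evalE; apply: eq_bigr => i _; congr (_ *: _).
exact: (all_belowP h).
Qed.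

End LinearCombinations.

Ltac lin_find a l :=
  match l with
  | a :: _ => constr:(0%N)
  | _ :: ?t => let i := lin_find a t in constr:(i.+1)
  end.

Ltac lin_add a l :=
  match l with
  | nil => constr:(a :: l)
  | a :: _ => l
  | ?b :: ?t => let t' := lin_add a t in constr:(b :: t')
  end.

Ltac lin_atoms t l :=
  lazymatch t with
  | GRing.zero => l
  | GRing.add ?x ?y => let l := lin_atoms x l in lin_atoms y l
  | GRing.opp ?x => lin_atoms x l
  | GRing.scale _ ?x => lin_atoms x l
  | GRing.natmul ?x _ => lin_atoms x l
  | _ => lin_add t l
  end.

Ltac lin_reify K t l :=
  lazymatch t with
  | GRing.zero => constr:(LZero K)
  | GRing.add ?x ?y =>
      let a := lin_reify K x l in let b := lin_reify K y l in constr:(LAdd a b)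
  | GRing.opp ?x => let a := lin_reify K x l in constr:(LOpp a)
  | GRing.scale ?c ?x => let a := lin_reify K x l in constr:(@LScale K c a)
  | GRing.natmul ?x ?n => let a := lin_reify K x l in constr:(@LMuln K a n)
  | _ => let i := lin_find t l in constr:(LAtom K i)
  end.

(* Proves [a = b] in a module over K when [tac] proves the scalar identities. *)
Ltac lincomb K tac :=
  lazymatch goal with
  | |- @eq ?V ?a ?b =>
      let l := lin_atoms a (@nil V) in
      let l := lin_atoms b l in
      let ea := lin_reify K a l in
      let eb := lin_reify K b l in
      apply: (@lincomb_eq K _ l ea eb); cbn [all_below size lincomb_coef eqn]; 
      repeat split; tac
  end.

(** * Affine isometric actions and averages *)

Section Averages.
Variables (R : realType) (E : normedModType R) (G : groupType).
Implicit Types (act : G -> E -> E) (g z : G) (w : seq G) (u v : E).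

Definition linear_part act g v : E := act g v - act g 0.

Definition avg act g v : E := 2^-1 *: (v + act g v).

Definition avgs act w v : E := foldr (avg act) v w.

Lemma avgs_cat act w1 w2 v : avgs act (w1 ++ w2) v = avgs act w1 (avgs act w2 v).
Proof. by rewrite /avgs foldr_cat. Qed.

Section Action.
Variables (act : G -> E -> E) (hact : affine_isometric_action act).
Let lin := linear_part act.

Lemma act1 v : act 1%g v = v. Proof. by case: hact. Qed.

Lemma actM g h v : act (g * h)%g v = act g (act h v). Proof. by case: hact. Qed.

Lemma linear_partB g u v : act g u - act g v = lin g (u - v).
Proof.
case: hact => _ _ /(_ g) [L [b [hL _]]].
by rewrite /lin /linear_part !hL linearB linear0 add0r addrK opprD addrACA subrr addr0.
Qed.

Lemma linear_partZ g (c : R) v : lin g (c *: v) = c *: lin g v.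
Proof.
case: hact => _ _ /(_ g) [L [b [hL _]]].
by rewrite /lin /linear_part !hL linear0 add0r !addrK linearZ.
Qed.

Lemma linear_part0 g : lin g 0 = 0.
Proof. by rewrite /lin /linear_part subrr. Qed.

Lemma linear_part_norm g v : `|lin g v| = `|v|.
Proof.
case: hact => _ _ /(_ g) [L [b [hL iL]]].
by rewrite /lin /linear_part !hL linear0 add0r addrK iL.
Qed.

Lemma act_dist g u v : `|act g u - act g v| = `|u - v|.
Proof. by rewrite linear_partB linear_part_norm. Qed.

Lemma act_comb g (c : R) u v : act g (c *: u + (1 - c) *: v) = c *: act g u + (1 - c) *: act g v.
Proof.
case: hact => _ _ /(_ g) [L [b [hL _]]].
by rewrite !hL linearD !linearZ /=; lincomb R ltac:(lra).
Qed.

Lemma act_half g u v : act g (2^-1 *: (u + v)) = 2^-1 *: (act g u + act g v).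
Proof.
have := act_comb g 2^-1 u v.
have -> : 1 - 2^-1 = 2^-1 :> R by lra.
by rewrite -!scalerDr.
Qed.

Lemma linear_partM g h v : lin (g * h)%g v = lin g (lin h v).
Proof. by rewrite -linear_partB -!actM. Qed.

Lemma linear_part_action : affine_isometric_action lin.
Proof.
split=> [v|g h v|g]; first by rewrite /lin /linear_part !act1 subr0.
  exact: linear_partM.
case: hact => _ _ /(_ g) [L [b [hL iL]]]; exists L, 0; split=> // v.
by rewrite /lin /linear_part !hL linear0 add0r addr0 addrK.
Qed.

(** Lets the lemmas about an affine action be reused for its linear part, which is itself such an
    action. *)
Lemma linear_part_idem : linear_part lin = lin.
Proof. by apply/funext => g; apply/funext => v; rewrite /linear_part linear_part0 subr0. Qed.

Lemma avg_sub g u v : avg act g u - avg act g v = avg lin g (u - v).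
Proof. by rewrite /avg -scalerBr opprD addrACA linear_partB. Qed.

Lemma avgs_sub w u v : avgs act w u - avgs act w v = avgs lin w (u - v).
Proof. by elim: w => //= g w IHw; rewrite avg_sub IHw. Qed.

Lemma avg_dist g u v : `|avg act g u - avg act g v| <= `|u - v|.
Proof.
rewrite avg_sub /avg normrZ ger0_norm ?invr_ge0 //.
have := ler_normD (u - v) (lin g (u - v)); rewrite linear_part_norm; lra.
Qed.

Lemma avgs_dist w u v : `|avgs act w u - avgs act w v| <= `|u - v|.
Proof. by elim: w => //= g w IHw; apply: le_trans (avg_dist _ _ _) IHw. Qed.

Lemma act_avg_comm g h v : commute g h -> act g (avg act h v) = avg act h (act g v).
Proof. by move=> gh; rewrite /avg act_half -!actM gh. Qed.

Lemma act_avgs_comm g w v : {in w, forall h, commute g h} ->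
  act g (avgs act w v) = avgs act w (act g v).
Proof.
elim: w => //= h w IHw gw; rewrite act_avg_comm ?IHw //; last first.
  by apply: gw; rewrite inE eqxx.
by move=> k kw; apply: gw; rewrite inE kw orbT.
Qed.

Lemma avg_avgs_comm g w v : {in w, forall h, commute g h} ->
  avg act g (avgs act w v) = avgs act w (avg act g v).
Proof.
elim: w => //= h w IHw gw; rewrite -IHw; last first.
  by move=> k kw; apply: gw; rewrite inE kw orbT.
have gh : commute g h by apply: gw; rewrite inE eqxx.
rewrite {1}/avg (act_avg_comm _ gh) /avg act_half.
by lincomb R ltac:(lra).
Qed.

Lemma avgs_comm w1 w2 v : {in w1 & w2, forall g h, commute g h} ->
  avgs act w1 (avgs act w2 v) = avgs act w2 (avgs act w1 v).
Proof.
elim: w1 => //= g w1 IHw c; rewrite IHw; last first.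
  by move=> x y xw yw; apply: c; rewrite // inE xw orbT.
by rewrite avg_avgs_comm // => h hw; apply: c; rewrite // inE eqxx.
Qed.

(** Used to bring a chosen family of elements to one end of a box. *)
Lemma avgs_perm w1 w2 v : {in w1 &, forall g h, commute g h} -> perm_eq w1 w2 ->
  avgs act w1 v = avgs act w2 v.
Proof.
elim: w1 w2 v => [|g w1 IHw] w2 v c; first by move/perm_size/esym/size0nil->.
move=> p; have gw2 : g \in w2 by rewrite -(perm_mem p) inE eqxx.
case/splitPr: gw2 p => s1 s2 p.
have c1 : {in s1, forall h, commute g h}.
  by move=> h hs; apply: c; [rewrite inE eqxx | rewrite (perm_mem p) mem_cat hs].
have p' : perm_eq w1 (s1 ++ s2).
  by rewrite -(perm_cons g) (perm_trans p) // perm_catC /= perm_cons perm_catC.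
rewrite /= (IHw _ v _ p'); last first.
  by move=> x y xw yw; apply: c; rewrite inE ?xw ?yw orbT.
by rewrite !avgs_cat /= avg_avgs_comm.
Qed.

Definition disp g v : R := `|act g v - v|.

Lemma disp_ge0 g v : 0 <= disp g v. Proof. exact: normr_ge0. Qed.

Lemma disp1 v : disp 1%g v = 0. Proof. by rewrite /disp act1 subrr normr0. Qed.

Lemma dispM g h v : disp (g * h)%g v <= disp g v + disp h v.
Proof.
rewrite /disp actM -[X in X <= _]/(`|act g (act h v) - v|).
have -> : act g (act h v) - v = (act g v - v) + (act g (act h v) - act g v).
  by lincomb R ltac:(lra).
by apply: le_trans (ler_normD _ _) _; rewrite act_dist.
Qed.

Lemma dispV g v : disp g^-1%g v = disp g v.
Proof. by rewrite /disp -(act_dist g) -actM mulgV act1 distrC. Qed.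

Lemma disp_dist g u v : disp g v <= disp g u + 2 * `|u - v|.
Proof.
have -> : disp g v = `|(act g v - act g u) + (act g u - u) + (u - v)|.
  by rewrite /disp; congr `|_|; lincomb R ltac:(lra).
apply: le_trans (ler_normD _ _) _; have := ler_normD (act g v - act g u) (act g u - u).
rewrite act_dist (distrC v u) -/(disp g u); lra.
Qed.

Lemma disp_avgs_comm g w v : {in w, forall h, commute g h} ->
  disp g (avgs act w v) <= disp g v.
Proof. by move=> c; rewrite /disp act_avgs_comm // avgs_dist. Qed.

Lemma avgs_moves w v (c : R) : {in w, forall g, disp g v <= c} ->
  `|avgs act w v - v| <= (size w)%:R * c.
Proof.
elim: w => [|g w IHw] hw /=; first by rewrite subrr normr0 mul0r.
have hg : disp g v <= c by apply: hw; rewrite inE eqxx.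
have hw' : {in w, forall g, disp g v <= c}.
  by move=> h hh; apply: hw; rewrite inE hh orbT.
have {}IHw := IHw hw'.
have -> : avg act g (avgs act w v) - v =
   (avg act g (avgs act w v) - avg act g v) + 2^-1 *: (act g v - v).
  by rewrite /avg; lincomb R ltac:(lra).
apply: le_trans (ler_normD _ _) _; rewrite normrZ ger0_norm ?invr_ge0 //.
have := avg_dist g (avgs act w v) v; have := disp_ge0 g v.
rewrite -/(disp g v) -[(size w).+1%:R]natr1 mulrDl mul1r; lra.
Qed.

End Action.
End Averages.

(** * Uniform convexity and Heisenberg commutators *)

Section UniformConvexity.
Variables (R : realType) (E : completeNormedModType R).
Hypothesis ucE : uniformly_convex E.

(** Rescaling to the unit sphere, with [r = 1 - delta tau]. The alternative is what later arguments
    iterate: a midpoint is shorter by a fixed factor, or the two vectors are close. *)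
Lemma uniformly_convex_sphere (tau : R) : 0 < tau <= 2 ->
  exists2 r : R, 0 <= r < 1 & forall u v : E, `|u| = `|v| ->
    `|2^-1 *: (u + v)| <= r * `|u| \/ `|u - v| <= tau * `|u|.
Proof.
move=> ht; case: ucE => delta /(_ _ ht) [/andP[d0 d1] hd].
exists (1 - delta tau); first by lra.
move=> u v uv; have [u0|un0] := eqVneq `|u| 0.
  have /eqP u00 : u == 0 by rewrite -normr_eq0 u0.
  have /eqP v00 : v == 0 by rewrite -normr_eq0 -uv u0.
  by left; rewrite u00 v00 addr0 scaler0 normr0 mulr0.
have up : 0 < `|u| by rewrite lt_neqAle eq_sym un0 normr_ge0.
have Hn : forall w : E, `|(`|u|^-1) *: w| = `|u|^-1 * `|w|.
  by move=> w; rewrite normrZ ger0_norm // invr_ge0.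
have [le|gt] := leP `|u - v| (tau * `|u|); [by right|left].
have := hd (`|u|^-1 *: u) (`|u|^-1 *: v); rewrite !Hn -uv mulVf // => /(_ erefl erefl).
rewrite -scalerBr -scalerDr scalerA mulrC -scalerA !Hn.
rewrite [_ * `|u - v|]mulrC ler_pdivlMr // [_ * `|_ *: _|]mulrC ler_pdivrMr //.
by apply; apply: ltW.
Qed.

(** If neither average contracts, y moves [v], and x moves the average [w], by at most 1/16 of
    [|v|]. As [w] is that close to [v], x moves [v] by at most 3/16, and comparing [x y v] with
    [y x v] costs 1/16 + 3/16 + 1/16 + 3/16 = 1/2. The factor [r] depends on the space alone, not on
    the group or the action. *)
Lemma heisenberg_dichotomy : exists2 r : R, 0 <= r < 1 &
  forall (G : groupType) (act : G -> E -> E), affine_isometric_action act ->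
  forall x y z : G, (x * y = y * x * z)%g -> forall v,
  let lin := linear_part act in
  `|avg lin x (avg lin y v)| <= r * `|v| \/ `|lin z v - v| <= 2^-1 * `|v|.
Proof.
have [|r r01 hr] := @uniformly_convex_sphere 16^-1; first by lra.
exists r => // G act hact0 x y z xyz v; set lin := linear_part act.
have hact : affine_isometric_action lin := linear_part_action hact0.
have nl g w : `|lin g w| = `|w| by exact: linear_part_norm.
set w := avg lin y v.
have wv : `|w| <= `|v|.
  rewrite /w /avg normrZ ger0_norm ?invr_ge0 //.
  have := ler_normD v (lin y v); rewrite nl; lra.
have [le|hy] := hr v (lin y v) (esym (nl _ _)).
  left; apply: le_trans le.
  have := avg_dist hact x w 0; rewrite /avg /lin linear_part0 // addr0 scaler0 !subr0.
  exact.
have [le|hx] := hr w (lin x w) (esym (nl _ _)).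
  by left; apply: le_trans le _; rewrite ler_wpM2l //; lra.
right.
have hwv : `|w - v| <= 16^-1 * `|v|.
  have -> : w - v = 2^-1 *: - (v - lin y v) by rewrite /w /avg; lincomb R ltac:(lra).
  rewrite normrZ ger0_norm ?invr_ge0 // normrN; have := normr_ge0 (v - lin y v); lra.
have hx' : `|lin x v - v| <= 16^-1 * 3 * `|v|.
  have -> : lin x v - v = (lin x v - lin x w) + - (w - lin x w) + (w - v).
    by lincomb R ltac:(lra).
  have := ler_normD ((lin x v - lin x w) + - (w - lin x w)) (w - v).
  have := ler_normD (lin x v - lin x w) (- (w - lin x w)).
  rewrite (act_dist hact) normrN (distrC v w); lra.
have -> : `|lin z v - v| = `|lin x (lin y v) - lin y (lin x v)|.
  by rewrite -!(actM hact) xyz (actM hact (y * x)%g) (act_dist hact).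
have -> : lin x (lin y v) - lin y (lin x v) = (lin x (lin y v) - lin x v) +
   (lin x v - v) + (v - lin y v) + (lin y v - lin y (lin x v)).
  by lincomb R ltac:(lra).
have := ler_normD ((lin x (lin y v) - lin x v) + (lin x v - v) + (v - lin y v))
  (lin y v - lin y (lin x v)).
have := ler_normD ((lin x (lin y v) - lin x v) + (lin x v - v)) (v - lin y v).
have := ler_normD (lin x (lin y v) - lin x v) (lin x v - v).
rewrite !(act_dist hact) (distrC (lin y v)) (distrC v (lin x v)); have := normr_ge0 v; lra.
Qed.

End UniformConvexity.

(** * Reordering averages *)

Section Words.
Variables (R : realType) (E : normedModType R) (G : groupType).
Variables (act : G -> E -> E) (hact : affine_isometric_action act).

(** Each exchange of x with one y costs the displacement by their commutator. The commutators
    commute with all the y, so averages already applied do not increase that displacement. *)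
Lemma avgs_swap1 x ys (c : G -> G) v (e : R) :
  {in ys, forall y, (x * y = y * x * c y)%g} ->
  {in ys &, forall y y', commute (c y) y'} ->
  {in ys, forall y, disp act (c y) v <= e} ->
  `|avg act x (avgs act ys v) - avgs act ys (avg act x v)| <= (size ys)%:R * e.
Proof.
elim: ys => [|y ys IH] /= hc cc hd; first by rewrite subrr normr0 mul0r.
have my : y \in y :: ys by rewrite inE eqxx.
have mys y' : y' \in ys -> y' \in y :: ys by rewrite inE => ->; rewrite orbT.
have {}IH : `|avg act x (avgs act ys v) - avgs act ys (avg act x v)| <= (size ys)%:R * e.
  apply: IH => [y' hy'|y' y'' h1 h2|y' hy']; [exact: hc (mys _ _)|exact: cc (mys _ _) (mys _ _)|].
  exact: hd (mys _ _).
set w := avgs act ys v.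
have d : disp act (c y) w <= e.
  apply: le_trans (hd _ my); apply: disp_avgs_comm => // y' hy'.
  by apply: cc => //; exact: mys.
have -> : avg act x (avg act y w) - avg act y (avgs act ys (avg act x v)) =
   (avg act x (avg act y w) - avg act y (avg act x w)) +
   (avg act y (avg act x w) - avg act y (avgs act ys (avg act x v))).
  by lincomb R ltac:(lra).
apply: le_trans (ler_normD _ _) _.
have h1 := avg_dist hact y (avg act x w) (avgs act ys (avg act x v)).
have h2 : `|avg act x (avg act y w) - avg act y (avg act x w)| <= e.
  have -> : avg act x (avg act y w) - avg act y (avg act x w) =
     (2^-1 * 2^-1) *: (act (y * x)%g (act (c y) w) - act (y * x)%g w).
    rewrite /avg !(act_half hact) -(actM hact x) hc // !(actM hact).
    by lincomb R ltac:(lra).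
  rewrite normrZ (act_dist hact) ger0_norm; last by lra.
  have := normr_ge0 (act (c y) w - w); move: d; rewrite /disp; lra.
rewrite -[(size ys).+1%:R]natr1 mulrDl mul1r; move: IH h1 h2; rewrite -/w; lra.
Qed.

Lemma avgs_swap xs ys (c : G -> G -> G) v (e : R) :
  {in xs & ys, forall x y, (x * y = y * x * c x y)%g} ->
  {in xs & ys, forall x y, {in xs, forall x', commute (c x y) x'}} ->
  {in xs & ys, forall x y, {in ys, forall y', commute (c x y) y'}} ->
  {in xs & ys, forall x y, disp act (c x y) v <= e} ->
  `|avgs act xs (avgs act ys v) - avgs act ys (avgs act xs v)| <=
    (size xs)%:R * (size ys)%:R * e.
Proof.
elim: xs => [|x xs IH] /= hc cx cy hd; first by rewrite subrr normr0 !mul0r.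
have mx : x \in x :: xs by rewrite inE eqxx.
have mxs x' : x' \in xs -> x' \in x :: xs by rewrite inE => ->; rewrite orbT.
have {}IH := IH (fun x' y' hx' => hc x' y' (mxs _ hx'))
  (fun x' y' hx' hy' x'' hx'' => cx _ _ (mxs _ hx') hy' _ (mxs _ hx''))
  (fun x' y' hx' => cy x' y' (mxs _ hx')) (fun x' y' hx' => hd x' y' (mxs _ hx')).
have h1 := avg_dist hact x (avgs act xs (avgs act ys v)) (avgs act ys (avgs act xs v)).
have h2 : `|avg act x (avgs act ys (avgs act xs v)) - avgs act ys (avg act x (avgs act xs v))|
   <= (size ys)%:R * e.
  apply: (@avgs_swap1 _ _ (c x)) => [y hy|y y' hy hy'|y hy]; [exact: hc|exact: cy|].
  apply: le_trans (hd _ _ mx hy); apply: disp_avgs_comm => // x' hx'.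
  by apply: cx => //; exact: mxs.
have -> : avg act x (avgs act xs (avgs act ys v)) - avgs act ys (avg act x (avgs act xs v)) =
  (avg act x (avgs act xs (avgs act ys v)) - avg act x (avgs act ys (avgs act xs v))) +
  (avg act x (avgs act ys (avgs act xs v)) - avgs act ys (avg act x (avgs act xs v))).
  by lincomb R ltac:(lra).
apply: le_trans (ler_normD _ _) _; rewrite -[(size xs).+1%:R]natr1 2!mulrDl !mul1r.
by move: IH h1 h2; lra.
Qed.

(* The average over the dyadic chain of z is the average over z^0 ... z^(2^l - 1). *)
Lemma avgs_dyadic (z : nat -> G) l v : (forall j, z j.+1 = (z j * z j)%g) ->
  act (z 0) (avgs act [seq z j | j <- iota 0 l] v) - avgs act [seq z j | j <- iota 0 l] v =
  2^-1 ^+ l *: (act (z l) v - v).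
Proof.
move=> hz; elim: l v => [|l IHl] v; first by rewrite expr0 scale1r.
rewrite -addn1 iotaD map_cat avgs_cat /= IHl /avg add0n addn1 hz.
rewrite (act_half hact) (actM hact) exprSr.
by lincomb R ltac:(lra).
Qed.

(** The chain telescopes to a multiple of [z l] applied to the remaining average, and the remaining
    elements commute with [z l]. *)
Lemma disp_dyadic (z : nat -> G) l w rest v :
  (forall j, z j.+1 = (z j * z j)%g) -> {in w &, forall g h, commute g h} ->
  perm_eq w ([seq z j | j <- iota 0 l] ++ rest) -> {in rest, forall g, commute (z l) g} ->
  disp act (z 0) (avgs act w v) <= 2^-1 ^+ l * disp act (z l) v.
Proof.
move=> hz cw p cr; rewrite /disp (avgs_perm _ _ cw p) // avgs_cat avgs_dyadic //.
rewrite normrZ ger0_norm; last by rewrite exprn_ge0 // invr_ge0.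
rewrite ler_wpM2l ?exprn_ge0 ?invr_ge0 //; exact: disp_avgs_comm.
Qed.

End Words.

(** * Contraction along a dyadic chain *)

Section Levels.
Variables (R : realType) (E : normedModType R) (G : groupType).
Variables (act : G -> E -> E) (hact : affine_isometric_action act).
Let lin := linear_part act.
Let hlin : affine_isometric_action lin := linear_part_action hact.

Lemma avgs_lin_norm w v : `|avgs lin w v| <= `|v|.
Proof.
have := avgs_dist hlin w v 0.
have -> : avgs lin w 0 = 0; last by rewrite !subr0.
by elim: w => //= g w ->; rewrite /avg /lin linear_part0 addr0 scaler0.
Qed.

Lemma lin_sub g u v : lin g u - lin g v = lin g (u - v).
Proof. by rewrite (linear_partB hlin) linear_part_idem. Qed.

Lemma avgs_lin_sub w u v : avgs lin w u - avgs lin w v = avgs lin w (u - v).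
Proof. by rewrite (avgs_sub hlin) linear_part_idem. Qed.

Lemma avgs_linD w u v : avgs lin w (u + v) = avgs lin w u + avgs lin w v.
Proof. by have := avgs_lin_sub w (u + v) v; rewrite addrK => <-; rewrite subrK. Qed.

Lemma avgs_linZ w (c : R) v : avgs lin w (c *: v) = c *: avgs lin w v.
Proof.
elim: w => //= g w ->; rewrite /avg /lin linear_partZ // -scalerDr.
by rewrite !scalerA mulrC.
Qed.

(* If P v is at most gamma |v| + P e / 2 for some e of at most half the norm of
   v, then iterating gives the bound 4/3 gamma of a geometric series. *)
Lemma absorb_bound (P : E -> R) (beta gamma : R) : 0 <= gamma ->
  (forall v, P v <= 2 * `|v|) ->
  (forall v, P v <= beta * `|v| \/
     exists2 e, `|e| <= 2^-1 * `|v| & P v <= gamma * `|v| + 2^-1 * P e) ->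
  forall v, P v <= Num.max beta (4 / 3 * gamma) * `|v|.
Proof.
move=> g0 h2 hP; set M := Num.max _ _.
have M0 : 4/3 * gamma <= M by rewrite le_max lexx orbT.
have Mb : beta <= M by rewrite le_max lexx.
(* The two factors 1/2 reduce the previous bound to a quarter, and [gamma] is at most 3/4 of [M];
   the excess over [M] thus shrinks like 4^-n. *)
have H n v : P v <= (M + 2 * 4^-1 ^+ n) * `|v|.
  elim: n v => [|n IHn] v.
    by apply: le_trans (h2 v) _; rewrite expr0 ler_wpM2r //; lra.
  have q0 : 0 <= (4^-1 : R) ^+ n by rewrite exprn_ge0.
  have v0 := normr_ge0 v.
  case: (hP v) => [le|[e he le]].
    by apply: le_trans le _; rewrite ler_wpM2r // exprS; lra.
  apply: le_trans le _; have := IHn e.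
  have : (M + 2 * 4^-1 ^+ n) * `|e| <= (M + 2 * 4^-1 ^+ n) * (2^-1 * `|v|).
    by rewrite ler_wpM2l //; lra.
  rewrite exprS => h3 h4.
  have : gamma * `|v| <= (3 / 4 * M) * `|v| by rewrite ler_wpM2r //; lra.
  lra.
move=> v; have [v0|vn0] := eqVneq `|v| 0.
  by have := h2 v; rewrite v0 !mulr0.
have vp : 0 < `|v| by rewrite lt_neqAle eq_sym vn0 normr_ge0.
rewrite leNgt; apply/negP => lt.
pose d := P v / `|v| - M.
have d0 : 0 < d by rewrite /d subr_gt0 ltr_pdivlMr.
have [n hn] : exists n, 2 * (4^-1 : R) ^+ n < d.
  have /cvgrPdist_lt cv : ((fun n => (4^-1 : R) ^+ n) @ \oo --> (0 : R))%classic.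
    by apply: cvg_expr; rewrite ger0_norm; lra.
  have [|N _ /(_ N (leqnn N))] := cv (d / 2); first by lra.
  rewrite /= sub0r normrN ger0_norm ?exprn_ge0 // => h.
  by exists N; lra.
have := H n v; apply/negP; rewrite -ltNge -ltr_pdivlMr //.
by move: hn; rewrite /d; lra.
Qed.

Definition interleave (x y : nat -> G) n : seq G :=
  flatten [seq [:: x s; y s] | s <- iota 0 n].

Lemma interleaveS x y n : interleave x y n.+1 = interleave x y n ++ [:: x n; y n].
Proof. by rewrite /interleave -addn1 iotaD map_cat flatten_cat. Qed.

(** Level t consists of the h pairs with commutator [z (h-1-t)], a square root of [z (h-t)]. It
    turns an estimate for [v - z (h-t) v] into one for [v - z (h-1-t) v] and gains one factor [rho].
    A single pair may fail to contract, but then its commutator moves the vector little, and the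
    estimate for the square takes over. *)
Lemma interleave_contract (x y z : nat -> G) (h : nat) (r rho : R) :
  0 <= r <= rho -> 2 / 3 <= rho < 1 ->
  (forall j, z j.+1 = (z j * z j)%g) ->
  (forall j s, commute (z j) (x s)) -> (forall j s, commute (z j) (y s)) ->
  (forall s, (s < h * h)%N -> forall v,
     `|avg lin (x s) (avg lin (y s) v)| <= r * `|v| \/
     `|lin (z (h.-1 - s %/ h)%N) v - v| <= 2^-1 * `|v|) ->
  forall v, `|avgs lin (interleave x y (h * h)) (v - lin (z 0) v)| <= 2 * rho ^+ h * `|v|.
Proof.
move=> /andP[r0 rr] /andP[rho23 rho1] hz cx cy hd.
have rho0 : 0 <= rho by lra.
pose P n j v := `|avgs lin (interleave x y n) (v - lin (z j) v)|.
have P2 n j v : P n j v <= 2 * `|v|.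
  apply: le_trans (avgs_lin_norm _ _) _.
  by have := ler_normB v (lin (z j) v); rewrite /lin linear_part_norm //; lra.
have cw j w v : {in w, forall g, exists s, g = x s \/ g = y s} ->
   avgs lin w (v - lin (z j) v) = avgs lin w v - lin (z j) (avgs lin w v).
  move=> hw; rewrite -avgs_lin_sub (act_avgs_comm hlin) // => g /hw[s [] ->].
    exact: cx.
  exact: cy.
suff H t : (t <= h)%N -> forall v, P (t * h)%N (h - t)%N v <= 2 * rho ^+ t * `|v|.
  by move=> v; have := H h (leqnn h) v; rewrite /P subnn.
elim: t => [|t IHt] th v; first by rewrite expr0 mulr1; exact: P2.
pose j := (h - t.+1)%N.
have jt : (h - t = j.+1)%N by rewrite /j; lia.
have {}IHt := IHt (ltnW th); rewrite jt in IHt.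
(* Induction inside a level: after i pairs the bound is [2 * rho ^+ i] until it reaches the target
   of the level, which happens within the h available pairs. *)
suff I i : (i <= h)%N -> forall v, P (t * h + i)%N j v <= Num.max (2 * rho ^+ i) (2 * rho ^+ t.+1) * `|v|.
  have := I h (leqnn h) v; rewrite mulSnr -/j.
  have -> // : Num.max (2 * rho ^+ h) (2 * rho ^+ t.+1) = 2 * rho ^+ t.+1.
  by apply/max_idPr; rewrite ler_pM2l // ler_wiXn2l //; lra.
elim: i {v} => [|i IHi] ih v.
  rewrite expr0 mulr1; apply: le_trans (P2 _ _ _) _.
  by rewrite ler_wpM2r // le_max lexx.
have hs : (t * h + i < h * h)%N.
  by apply: (@leq_trans (t.+1 * h)%N); [rewrite mulSn; lia | rewrite leq_mul2r th orbT].
have hl : (h.-1 - (t * h + i) %/ h = j)%N.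
  by rewrite divnMDl ?divn_small ?addn0 /j //; lia.
have {}IHi := IHi (ltnW ih).

suff K u : P (t * h + i.+1)%N j u <= Num.max (2 * rho ^+ i.+1) (2 * rho ^+ t.+1) * `|u| \/
     exists2 e, `|e| <= 2^-1 * `|u| & P (t * h + i.+1)%N j u <= rho ^+ t * `|u| + 2^-1 * P (t * h + i.+1)%N j e.
  apply: le_trans (absorb_bound (exprn_ge0 _ rho0) (P2 _ _) K v) _.
  (* The origin of 2/3: with [rho >= 2/3] the term 4/3 [rho ^+ t] left by [absorb_bound] is at most
     [2 * rho ^+ t.+1]. *)
  have -> // : Num.max (Num.max (2 * rho ^+ i.+1) (2 * rho ^+ t.+1)) (4 / 3 * rho ^+ t) =
    Num.max (2 * rho ^+ i.+1) (2 * rho ^+ t.+1).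
  apply/max_idPl; rewrite le_max; apply/orP; right; rewrite exprS.
  have : 2 / 3 * rho ^+ t <= rho * rho ^+ t by rewrite ler_wpM2r // exprn_ge0.
  by lra.
set n := (t * h + i)%N in hs hl IHi *; rewrite addnS -/n.
set S := avg lin (x n) (avg lin (y n) u).
have PS k w : P n.+1 k w = P n k (avg lin (x n) (avg lin (y n) w)).
  rewrite /P interleaveS avgs_cat (cw k [:: x n; y n]) // => g.
  by rewrite !inE => /orP[] /eqP ->; exists n; [left|right].
case: (hd n hs u); rewrite ?hl => le.
  left; rewrite PS -/S; apply: le_trans (IHi _) _.
  set M := Num.max _ _; set M' := Num.max _ _.
  apply: (@le_trans _ _ (M * (rho * `|u|))).
    rewrite ler_wpM2l //; last by apply: le_trans le _; rewrite ler_wpM2r.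
    by rewrite le_max mulr_ge0 ?exprn_ge0.
  rewrite mulrA ler_wpM2r // /M maxr_pMl // ge_max /M' !le_max -mulrA -exprSr lexx /=.
  apply/orP; right; rewrite ler_piMr ?mulr_ge0 ?exprn_ge0 //; lra.
right; exists (u - lin (z j) u); first by rewrite distrC.
have nlin w1 (a b : E) : avgs lin w1 (2^-1 *: a + 2^-1 *: b) = 2^-1 *: avgs lin w1 a + 2^-1 *: avgs lin w1 b.
  by rewrite avgs_linD !avgs_linZ.
(* With z = [z j], the identity 2 (1 - z) = (1 - z^2) + (1 - z)^2. The first term belongs to the
   previous level, the second is 1 - z applied to [u - z u], of at most half the norm. *)
have -> : P n.+1 j u = `|avgs lin (interleave x y n.+1) (2^-1 *: (u - lin (z j.+1) u) +
    2^-1 *: ((u - lin (z j) u) - lin (z j) (u - lin (z j) u)))|.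
  congr `|avgs _ _ _|; rewrite hz (actM hlin) -lin_sub.
  by lincomb R ltac:(lra).
have hn (a : E) : `|2^-1 *: a| = 2^-1 * `|a| by rewrite normrZ ger0_norm ?invr_ge0.
rewrite nlin; apply: le_trans (ler_normD _ _) _.
rewrite (hn (avgs _ _ (u - lin (z j.+1) u))) (hn (avgs _ _ (_ - lin _ (_ - _)))).
apply: lerD; last exact: lexx.
rewrite -[X in 2^-1 * X]/(P n.+1 j.+1 u) PS -/S.
(* The pairs of the unfinished level act first and commute with the chain; they can be absorbed into
   the vector without increasing its norm. *)
pose W := flatten [seq [:: x s; y s] | s <- iota (t * h)%N i].
have -> : P n j.+1 S = P (t * h)%N j.+1 (avgs lin W S).
  rewrite /P /n /interleave iotaD map_cat flatten_cat avgs_cat add0n (cw _ W) //.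
  by move=> g /flattenP[w /mapP[s _ ->]]; rewrite !inE => /orP[]/eqP->; exists s; [left|right].
have := IHt (avgs lin W S); have := avgs_lin_norm W S => h2 h1.
have SU : `|S| <= `|u| := avgs_lin_norm [:: x n; y n] u.
have : 2 * rho ^+ t * `|avgs lin W S| <= 2 * rho ^+ t * `|u|.
  by rewrite ler_wpM2l ?mulr_ge0 ?exprn_ge0 // (le_trans h2).
lra.
Qed.

End Levels.

(** * Boxes of root elements *)

Section Monomials.
Variables (A : comPzRingType) (m : nat) (gen : 'I_m.+1 -> A).

Definition expo := {ffun 'I_m.+1 -> nat}.
Implicit Types (e f : expo) (i : 'I_m.+1).

Definition degree e : nat := (\sum_i e i)%N.
Definition eadd e f : expo := [ffun i => (e i + f i)%N].
Definition epow i n : expo := [ffun k => if k == i then n else 0%N].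
Definition mon e : A := \prod_i gen i ^+ e i.

Lemma degree_add e f : degree (eadd e f) = (degree e + degree f)%N.
Proof. by rewrite /degree -big_split; apply: eq_bigr => i _; rewrite ffunE. Qed.

Lemma degree_pow i n : degree (epow i n) = n.
Proof.
rewrite /degree (bigD1 i) //= ffunE eqxx big1 ?addn0 // => k /negPf ki.
by rewrite ffunE ki.
Qed.

Lemma mon_add e f : mon (eadd e f) = mon e * mon f.
Proof. by rewrite /mon -big_split; apply: eq_bigr => i _; rewrite ffunE exprD. Qed.

Lemma mon_pow i n : mon (epow i n) = gen i ^+ n.
Proof.
rewrite /mon (bigD1 i) //= ffunE eqxx big1 ?mulr1 // => k /negPf ki.
by rewrite ffunE ki expr0.
Qed.

(** Starting from [e1] = 0, variables are transferred one at a time from [e2] to [e1], so every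
    intermediate degree occurs. *)
Lemma expo_split e i k a : (k <= e i)%N -> (k <= a <= degree e)%N ->
  exists e1 e2, e = eadd (eadd e1 (epow i k)) e2 /\ (degree e1 + k)%N = a.
Proof.
move=> ki /andP[ka ad].
suff H n : (k + n <= degree e)%N ->
    exists e1 e2, e = eadd (eadd e1 (epow i k)) e2 /\ degree e1 = n.
  have [|e1 [e2 [? d]]] := H (a - k)%N; first by lia.
  by exists e1, e2; split => //; rewrite d; lia.
elim: n => [|n IHn] le.
  exists [ffun=> 0%N], [ffun l => (e l - epow i k l)%N]; split.
    by apply/ffunP => l; rewrite !ffunE; case: (eqVneq l i) => [->|_]; rewrite ?add0n ?subn0 ?subnKC.
  by rewrite /degree big1 // => l _; rewrite ffunE.
have [|e1 [e2 [ee d]]] := IHn; first by lia.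
have [j j0] : exists j, (0 < e2 j)%N.
  case: (pickP (fun j => 0 < e2 j)%N) => [j|h0]; first by exists j.
  have : degree e2 = 0%N.
    by rewrite /degree big1 // => l _; apply/eqP; rewrite -leqn0 leqNgt h0.
  by move: le; rewrite ee !degree_add degree_pow d; lia.
exists (eadd e1 (epow j 1)), [ffun l => (e2 l - epow j 1%N l)%N]; split.
  rewrite {1}ee; apply/ffunP => l; rewrite !ffunE.
  by case: (eqVneq l j) => [->|_]; lia.
by rewrite degree_add degree_pow d; lia.
Qed.

Lemma expo_large e k : (m.+1 * k <= degree e)%N -> exists i, (k <= e i)%N.
Proof.
case: k => [|k] le; first by exists ord0.
case: (pickP (fun i => k < e i)%N) => [i ki|h0]; first by exists i.
suff : (degree e <= \sum_(i < m.+1) k)%N.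
  by rewrite sum_nat_const card_ord; move: le; rewrite mulnS; lia.
by apply: leq_sum => i _; rewrite leqNgt h0.
Qed.

Definition expos c : seq expo :=
  [seq e <- [seq ([ffun i => val (u i)] : expo) | u : {ffun 'I_m.+1 -> 'I_c.+1} <- enum {: {ffun 'I_m.+1 -> 'I_c.+1}}]
     | (degree e <= c)%N].

Lemma mem_expos e c : (e \in expos c) = (degree e <= c)%N.
Proof.
rewrite mem_filter; case: leqP => //= le.
have lei i : (e i < c.+1)%N.
  by rewrite ltnS; apply: leq_trans le; rewrite /degree (bigD1 i) //= leq_addr.
apply/mapP; exists [ffun i => Ordinal (lei i)]; first by rewrite mem_enum.
by apply/ffunP => i; rewrite !ffunE.
Qed.

Lemma uniq_expos c : uniq (expos c).
Proof.
apply/filter_uniq; rewrite map_inj_uniq ?enum_uniq // => f1 f2 /ffunP f12.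
by apply/ffunP => i; apply/val_inj; have := f12 i; rewrite !ffunE.
Qed.

(** A crude count; polynomial growth in c for fixed m is all that the exponential gains have to
    beat. *)
Lemma size_expos c : (size (expos c) <= c.+1 ^ m.+1)%N.
Proof.
rewrite size_filter (leq_trans (count_size _ _)) // size_map -cardT.
by rewrite card_ffun !card_ord.
Qed.

Lemma perm_eq_cat_sub (T : eqType) (s1 s2 : seq T) : uniq s1 -> uniq s2 ->
  {subset s1 <= s2} -> perm_eq s2 (s1 ++ [seq x <- s2 | x \notin s1]).
Proof.
move=> u1 u2 sub; rewrite -(perm_filterC (mem s1)) perm_cat2r.
apply: uniq_perm => //; first exact: filter_uniq.
by move=> x; rewrite mem_filter /=; apply: andb_idr; apply: sub.
Qed.

End Monomials.

Arguments epow {m} i n.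

(** The central factor stands in the middle, as in three consecutive root subgroups of a hexagon.
    The common sign [s] records the structure constant. *)
Record heisenberg (A : comPzRingType) (G : groupType) (X Z Y : A -> G) : Prop := Heisenberg {
  heisX : forall p q, X (p + q) = (X p * X q)%g;
  heisY : forall p q, Y (p + q) = (Y p * Y q)%g;
  heisZ : forall p q, Z (p + q) = (Z p * Z q)%g;
  heisZX : forall p q, commute (Z p) (X q);
  heisZY : forall p q, commute (Z p) (Y q);
  heisXY : exists2 s : A, s = 1 \/ s = -1 &
    forall p q, (X p * Y q = Y q * X p * Z (s * (p * q))%R)%g }.

Section Boxes.
Variables (A : comPzRingType) (m : nat) (gen : 'I_m.+1 -> A).
Hypothesis gen0 : gen ord0 = 2.
Variables (G : groupType).
Local Notation mon := (mon gen).

Definition box (X : A -> G) c : seq G := [seq X (mon e) | e <- expos m c].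

Section Additive.
Variables (X : A -> G) (hX : forall p q, X (p + q) = (X p * X q)%g).

Lemma additive0 : X 0 = 1%g.
Proof. by apply: (mulgI (X 0)); rewrite -hX addr0 mulg1. Qed.

Lemma additiveN p : X (- p) = (X p)^-1%g.
Proof. by apply: (mulgI (X p)); rewrite -hX subrr mulgV additive0. Qed.

Lemma additive_commute p q : commute (X p) (X q).
Proof. by rewrite /commute -!hX addrC. Qed.

Lemma box_commute c d : {in box X c & box X d, forall g h, commute g h}.
Proof. by move=> _ _ /mapP[e _ ->] /mapP[f _ ->]; exact: additive_commute. Qed.

(** Since [gen ord0] is 2, raising that exponent squares the group element: these are the dyadic
    chains. *)
Lemma double_mon e n :
  X (mon (eadd e (epow ord0 n.+1))) = (X (mon (eadd e (epow ord0 n))) * X (mon (eadd e (epow ord0 n))))%g.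
Proof.
rewrite !mon_add !mon_pow gen0 exprS -hX; congr X.
by rewrite -mulrDr -[in RHS](mulr1 (2 ^+ n)) -mulrDr mulrC [RHS]mulrC; congr (_ * _); rewrite mulrC.
Qed.

End Additive.

Lemma heisenberg_sym (X Z Y : A -> G) : heisenberg X Z Y -> heisenberg Y Z X.
Proof.
case=> hX hY hZ cX cY [s hs hXY]; split => //.
exists (- s); first by case: hs => ->; [right|left; rewrite opprK].
move=> q p; rewrite hXY -mulgA -hZ mulNr [q * p]mulrC subrr.
by rewrite additive0 // mulg1.
Qed.

Lemma heisenberg_commutator (X Z Y : A -> G) p q : heisenberg X Z Y ->
  exists2 b : bool, True & (X p * Y q = Y q * X p * (if b then Z (p * q)%R else (Z (p * q)%R)^-1))%g.
Proof.
case=> hX hY hZ cX cY [s [->|->] hXY]; [exists true|exists false] => //; rewrite hXY.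
  by rewrite mul1r.
by rewrite mulN1r additiveN.
Qed.

Section Action.
Variables (R : realType) (E : normedModType R).
Variables (act : G -> E -> E) (hact : affine_isometric_action act).

Lemma disp_heisenberg (X Z Y : A -> G) p q v : heisenberg X Z Y ->
  disp act (Z (p * q)) v <= 2 * disp act (X p) v + 2 * disp act (Y q) v.
Proof.
move=> hs; have [b _ e] := heisenberg_commutator p q hs.
have -> : disp act (Z (p * q)) v = disp act ((Y q * X p)^-1 * (X p * Y q))%g v.
  by rewrite e mulKg; case: b {e} => //; rewrite dispV.
rewrite invgM; have := dispM hact ((X p)^-1 * (Y q)^-1)%g (X p * Y q)%g v.
have := dispM hact (X p)^-1%g (Y q)^-1%g v; have := dispM hact (X p) (Y q) v.
by rewrite !dispV //; lra.
Qed.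

(** The monomials f 2^j with j < l form a dyadic chain. Its last member has degree
    [degree f + l - 1], whence the bound [c.+1]. *)
Lemma disp_box (Z : A -> G) c f l v : (forall p q, Z (p + q) = (Z p * Z q)%g) ->
  (degree f + l <= c.+1)%N ->
  disp act (Z (mon f)) (avgs act (box Z c) v) <=
    2^-1 ^+ l * disp act (Z (mon (eadd f (epow ord0 l)))) v.
Proof.
move=> hZ le; pose z j := Z (mon (eadd f (epow ord0 j))).
have z0 : z 0%N = Z (mon f).
  by rewrite /z; congr (Z (mon _)); apply/ffunP => i; rewrite !ffunE; case: eqP; rewrite addn0.
pose S := [seq eadd f (epow ord0 j) | j <- iota 0 l].
have uS : uniq S.
  rewrite map_inj_uniq ?iota_uniq // => j1 j2 /ffunP /(_ ord0).
  by rewrite !ffunE eqxx => /addnI.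
have sS : {subset S <= expos m c}.
  move=> x /mapP[j]; rewrite mem_iota mem_expos => /andP[_ jl] ->.
  by rewrite degree_add degree_pow; lia.
have p := perm_eq_cat_sub uS (uniq_expos m c) sS.
have := @disp_dyadic _ _ _ _ hact z l (box Z c)
   [seq Z (mon e) | e <- [seq x <- expos m c | x \notin S]] v.
rewrite z0; apply.
- by move=> j; exact: double_mon.
- exact: box_commute.
- apply: perm_trans (perm_map _ p) _; rewrite map_cat /S -map_comp.
  exact: perm_refl.
- by move=> _ /mapP[e _ ->]; exact: additive_commute.
Qed.

(** Only the x_s and y_t with t < s have to pass each other. The diagonal commutators, which are the
    ones that contract, are never exchanged. *)
Lemma avgs_regroup (x y : nat -> G) (c : nat -> nat -> G) n v (e : R) :
  (forall s t, (s < n)%N -> (t < s)%N -> x s * y t = y t * x s * c s t)%g ->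
  (forall s t k, commute (c s t) (x k)) -> (forall s t k, commute (c s t) (y k)) ->
  (forall s t, (s < n)%N -> (t < s)%N -> disp act (c s t) v <= e) -> 0 <= e ->
  `|avgs act [seq x s | s <- iota 0 n] (avgs act [seq y s | s <- iota 0 n] v) -
    avgs act (interleave x y n) v| <= n%:R * n%:R * e.
Proof.
move=> hc cx cy hd e0; elim: n v hc hd => [|n IHn] v hc hd.
  by rewrite subrr normr0 !mul0r.
rewrite interleaveS -addn1 iotaD !map_cat !avgs_cat /= add0n addn1.
set X := [seq x s | s <- iota 0 n]; set Y := [seq y s | s <- iota 0 n].
set v' := avg act (y n) v.
have dcomm s t g : {in g, forall h, exists k, h = x k \/ h = y k} ->
  (s < n.+1)%N -> (t < s)%N -> disp act (c s t) (avgs act g v) <= e.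
  move=> hg sn ts; apply: le_trans (hd _ _ sn ts); apply: disp_avgs_comm => //.
  by move=> h /hg[k [] ->]; [exact: cx|exact: cy].
have h1 : `|avg act (x n) (avgs act Y v') - avgs act Y (avg act (x n) v')| <= n%:R * e.
  have sY : size Y = n by rewrite size_map size_iota.
  rewrite -[X in _ <= X%:R * _]sY.
  (* [avgs_swap1] labels commutators by group elements, so a y is given the first index at which it
     occurs in [Y]. *)
  apply: (avgs_swap1 hact (c := fun g => c n (index g Y))).
  - move=> g gY; have /mapP[t] := gY; rewrite mem_iota => /andP[_ tn] gt.
    have lt : (index g Y < n)%N by rewrite -[X in (_ < X)%N](size_iota 0) -(size_map y) index_mem.
    have e1 : g = y (index g Y).
      by rewrite -[LHS](nth_index 1%g gY) (nth_map 0%N) ?size_iota // nth_iota.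
    by rewrite {1 2}e1 hc.
  - by move=> g g' _ /mapP[k _ ->]; exact: cy.
  - move=> g gY; apply: (dcomm n (index g Y) [:: y n]) => //.
      by move=> h; rewrite inE => /eqP ->; exists n; right.
    by rewrite -[X in (_ < X)%N](size_iota 0) -(size_map y) index_mem.
have h2 := IHn (avg act (x n) v').
have {}h2 : `|avgs act X (avgs act Y (avg act (x n) v')) -
       avgs act (interleave x y n) (avg act (x n) v')| <= n%:R * n%:R * e.
  apply: h2 => s t sn ts; first by apply: hc => //; exact: ltnW.
  apply: (dcomm s t [:: x n; y n]) => //; last exact: ltnW.
  by move=> h; rewrite !inE => /orP[]/eqP->; exists n; [left|right].
have h3 := avgs_dist hact X (avg act (x n) (avgs act Y v')) (avgs act Y (avg act (x n) v')).
have -> : avgs act X (avg act (x n) (avgs act Y v')) - avgs act (interleave x y n) (avg act (x n) v') =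
  (avgs act X (avg act (x n) (avgs act Y v')) - avgs act X (avgs act Y (avg act (x n) v'))) +
  (avgs act X (avgs act Y (avg act (x n) v')) - avgs act (interleave x y n) (avg act (x n) v')).
  by lincomb R ltac:(lra).
apply: le_trans (ler_normD _ _) _.
have : (n%:R * n%:R + n%:R : R) * e <= n.+1%:R * n.+1%:R * e.
  by rewrite ler_wpM2r // -!natrM -natrD ler_nat mulSn mulnS; lia.
by move: h1 h2 h3; lra.
Qed.

End Action.
End Boxes.

(** * Contraction by two boxes *)

Section BoxContraction.
Variables (A : comPzRingType) (m : nat) (gen : 'I_m.+1 -> A).
Hypothesis gen0 : gen ord0 = 2.
Variables (R : realType) (E : normedModType R) (G : groupType).
Variables (act : G -> E -> E) (hact : affine_isometric_action act).
Variables (r rho : R).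
Hypothesis r_rho : 0 <= r <= rho.
Hypothesis rho_lt1 : 2 / 3 <= rho < 1.
Let lin := linear_part act.
Let hlin : affine_isometric_action lin := linear_part_action hact.
Hypothesis contract : forall x y z : G, (x * y = y * x * z)%g -> forall v,
  `|avg lin x (avg lin y v)| <= r * `|v| \/ `|lin z v - v| <= 2^-1 * `|v|.
Variables (X Z Y : A -> G).
Hypothesis hs : heisenberg X Z Y.
Local Notation mon := (mon gen).
Local Notation box := (box gen).

(** The first term is the bound of [interleave_contract]; the second allows for (h^2)^2 cross
    commutators, each displacing by at most 2^-h times [4 * |v|]. *)
Definition contraction_rate (h : nat) : R := 2 * rho ^+ h + (h * h * (h * h))%N%:R * 4 * 2^-1 ^+ h.

(* For some generator g the monomial e is divisible by g^(4h^3).  Moving powers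
   of g^(4h) from one factor of e to the other gives h^2 pairs (p_s, p'_s) of
   monomials with p_s p'_s = 2^(j+n) e, n < h, to which heisenberg_dichotomy
   applies.  For t < s the product p_s p'_t has degree at most c, hence its
   image under Z hardly moves the Z-box, and the pairs may be interleaved. *)
Lemma box_linear_bound (h j a b c : nat) (e : expo m) :
  (0 < h)%N -> (j <= h)%N -> degree e = c.+1 ->
  (8 * h ^ 3 <= a)%N -> (8 * h ^ 3 <= b)%N -> (m.+1 * (4 * h ^ 3) <= c.+1)%N ->
  (c + 8 * h ^ 3 <= a + b)%N -> forall v,
  `|avgs lin (box X a) (avgs lin (box Y b) (avgs lin (box Z c)
      (v - lin (Z (mon (eadd e (epow ord0 j)))) v)))| <= contraction_rate h * `|v|.
Proof.
move=> h0 jh de ha hb hc hab v.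
have [hX hY hZ cX cY _] := hs.
have [k kE] : exists k, k = ((4 * h) * (h * h))%N by exists ((4 * h) * (h * h))%N.
have k3 : (4 * h ^ 3 = k)%N by rewrite kE !expnS expn0; lia.
have k8 : (8 * h ^ 3 = 2 * k)%N by rewrite -k3; lia.
have hk : (4 * h <= k)%N by rewrite kE leq_pmulr // muln_gt0 h0.
rewrite k8 in ha hb hab; rewrite k3 in hc.
have [i ki] : exists i, (k <= e i)%N by apply: expo_large; rewrite de.
(* [a1] is the degree of the first factor of [e]. It leaves 2h in the X-box for the power of 2, and
   k in the Y-box for the powers of g moved to the second factor. *)
have [a1 [ka1 a1c a1a a1b]] : exists a1,
    [/\ k <= a1, a1 <= c.+1, a1 + 2 * h <= a & c.+1 + k <= a1 + b]%N.
  have kc : (k <= c.+1)%N by apply: leq_trans hc; rewrite leq_pmull.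
  by exists (maxn k (c.+1 + k - b)%N); split; lia.
have [|e1 [e2 [ee d1]]] := expo_split (a := a1) ki; first by rewrite de ka1.
have d2 : (degree e2 = c.+1 - a1)%N.
  by move: de; rewrite ee !degree_add degree_pow; lia.
pose lev s := (h.-1 - s %/ h)%N.
have levh s : (lev s < h)%N by rewrite (leq_ltn_trans (leq_subr _ _)) // ltn_predL.
have sk s : (s < h * h)%N -> ((4 * h) * s <= k)%N.
  by move=> lt; rewrite kE leq_mul2l ltnW ?orbT.
(* The spacing 4h makes the product of [P1 s] and [P2 t], t < s, lose at least 4h in degree: fewer
   than 2h are spent on the power of 2 and h remain for the damping by [disp_box]. *)
pose P1 s := eadd (eadd e1 (epow i (k - (4 * h) * s)%N)) (epow ord0 (j + lev s)%N).
pose P2 s := eadd e2 (epow i ((4 * h) * s)%N).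
pose F d n := eadd (eadd (eadd e1 e2) (epow i (k - (4 * h) * d)%N)) (epow ord0 n).
have P12 s t : (s < h * h)%N -> (t <= s)%N ->
    mon (P1 s) * mon (P2 t) = mon (F (s - t)%N (j + lev s)%N).
  move=> sN ts; rewrite /P1 /P2 /F !mon_add !mon_pow.
  have -> : (k - 4 * h * (s - t) = (k - 4 * h * s) + 4 * h * t)%N.
    by have := sk s sN; have := leq_mul (leqnn (4 * h)) ts; rewrite mulnBr; lia.
  move: (k - 4 * h * s)%N (4 * h * t)%N (j + lev s)%N => n1 n2 n3.
  by rewrite [gen i ^+ (_ + _)]exprD; ring.
have F0 n : mon (F 0%N n) = mon (eadd e (epow ord0 n)).
  rewrite ee /F !mon_add !mon_pow muln0 subn0; ring.
pose x s := X (mon (P1 s)); pose y s := Y (mon (P2 s)).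
pose z l := Z (mon (eadd e (epow ord0 (j + l)%N))).
have zS l : z l.+1 = (z l * z l)%g by rewrite /z addnS; exact: double_mon.
set S1 := [seq P1 s | s <- iota 0 (h * h)]; set S2 := [seq P2 s | s <- iota 0 (h * h)].
have P1lt s t : (s < t)%N -> (t < h * h)%N -> P1 s != P1 t.
  move=> st tN; apply/eqP => /ffunP /(_ i); rewrite !ffunE eqxx.
  have := sk t tN; have : (4 * h * s < 4 * h * t)%N by rewrite ltn_mul2l st; lia.
  have : (s %/ h <= t %/ h)%N by rewrite leq_div2r // ltnW.
  by rewrite /lev; case: ifP => _; lia.
have u1 : uniq S1.
  rewrite map_inj_in_uniq ?iota_uniq // => s t; rewrite !mem_iota !add0n /= => sN tN st.
  by case: (ltngtP s t) => // lt; [have := P1lt _ _ lt tN | have := P1lt _ _ lt sN]; rewrite st eqxx.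
have u2 : uniq S2.
  rewrite map_inj_in_uniq ?iota_uniq // => s t _ _ /ffunP /(_ i).
  by rewrite !ffunE eqxx => /addnI /eqP; rewrite eqn_pmul2l ?muln_gt0 // => /eqP.
have s1 : {subset S1 <= expos m a}.
  move=> f /mapP[s]; rewrite mem_iota => /andP[_ sN] ->.
  rewrite mem_expos !degree_add !degree_pow; have := levh s; have := sk s sN.
  by lia.
have s2 : {subset S2 <= expos m b}.
  move=> f /mapP[s]; rewrite mem_iota => /andP[_ sN] ->.
  rewrite mem_expos !degree_add !degree_pow; have := sk s sN.
  by rewrite d2; lia.
have p1 := perm_eq_cat_sub u1 (uniq_expos m a) s1.
have p2 := perm_eq_cat_sub u2 (uniq_expos m b) s2.
set rX := [seq f <- _ | _] in p1; set rY := [seq f <- _ | _] in p2.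
(* The chosen elements of the X-box act first and those of the Y-box last, so that the two families
   become adjacent. The rest of the X-box stays outside; the rest of the Y-box is absorbed into
   [v]. *)
have eX w : avgs lin (box X a) w = avgs lin [seq X (mon f) | f <- rX] (avgs lin [seq x s | s <- iota 0 (h * h)] w).
  rewrite -avgs_cat; apply: (avgs_perm hlin); first exact: (box_commute hX).
  by rewrite perm_sym perm_catC /x (map_comp (X \o mon) P1) -map_cat perm_map // perm_sym.
have eY w : avgs lin (box Y b) w = avgs lin [seq y s | s <- iota 0 (h * h)] (avgs lin [seq Y (mon f) | f <- rY] w).
  rewrite -avgs_cat; apply: (avgs_perm hlin); first exact: (box_commute hY).
  by rewrite perm_sym /y (map_comp (Y \o mon) P2) -map_cat perm_map // perm_sym.
have z0 : Z (mon (eadd e (epow ord0 j))) = z 0%N by rewrite /z addn0.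
rewrite z0 eX eY.
apply: le_trans (avgs_lin_norm hact _ _) _.
set wY := [seq Y _ | f <- rY].
set v' := avgs lin wY v.
have cZY : {in box Z c & wY, forall g k, commute g k}.
  by move=> _ _ /mapP[f _ ->] /mapP[f' _ ->]; exact: cY.
have -> : avgs lin wY (avgs lin (box Z c) (v - lin (z 0) v)) = avgs lin (box Z c) (v' - lin (z 0) v').
  rewrite -(avgs_comm hlin _ cZY); congr (avgs _ _ _).
  rewrite -(avgs_lin_sub hact); congr (_ - _); rewrite -(act_avgs_comm hlin) //.
  by move=> _ /mapP[f _ ->]; exact: cY.
have v'v : `|v'| <= `|v| by exact: avgs_lin_norm.
set u := v' - lin (z 0) v'.
have uv : `|u| <= 2 * `|v|.
  by rewrite /u; have := ler_normB v' (lin (z 0) v'); rewrite (linear_part_norm hact); lra.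
set w := avgs lin (box Z c) u.
have cross s t : (s < h * h)%N -> (t < s)%N ->
    disp lin (Z (mon (F (s - t)%N (j + lev s)%N))) w <= 2^-1 ^+ h * (4 * `|v|).
  move=> sN ts; apply: le_trans (disp_box gen0 hlin (l := h) u hZ _) _.
    rewrite /F !degree_add !degree_pow d2; have := levh s; have := sk s sN.
    have : (4 * h <= 4 * h * (s - t))%N by rewrite leq_pmulr ?subn_gt0.
    have : (4 * h * (s - t) <= 4 * h * s)%N by rewrite leq_mul2l leq_subr orbT.
    by move: d1 ka1 a1c jh hk; clear; lia.
  rewrite ler_wpM2l ?exprn_ge0 ?invr_ge0 // /disp.
  set g := Z _; have := ler_normB (lin g u) u; rewrite (linear_part_norm hact); lra.
(* A test chooses the commutator among [Z] and its inverse for each pair, which makes it a function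
   of s and t; displacements do not see the choice. *)
pose b0 := fun s t => (x s * y t == y t * x s * Z (mon (P1 s) * mon (P2 t))%R)%g.
pose cc s t := if b0 s t then Z (mon (P1 s) * mon (P2 t)) else ((Z (mon (P1 s) * mon (P2 t)))^-1)%g.
have hcc s t : (x s * y t = y t * x s * cc s t)%g.
  rewrite /cc; case: ifP => [/eqP //|]; rewrite /b0.
  have [[] _ e0] := heisenberg_commutator (mon (P1 s)) (mon (P2 t)) hs; rewrite -/(x s) -/(y t) in e0.
    by rewrite e0 eqxx.
  by [].
have ccd s t w' : disp lin (cc s t) w' = disp lin (Z (mon (P1 s) * mon (P2 t))) w'.
  by rewrite /cc; case: ifP => _ //; rewrite dispV.
have cV (g g1 : G) : commute g g1 -> commute (g^-1)%g g1.
  by move=> gk; apply: commute_sym; apply: commuteV; exact: commute_sym.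
have regroup := @avgs_regroup _ _ _ _ hlin x y cc (h * h) w (2^-1 ^+ h * (4 * `|v|)).
have {}regroup : `|avgs lin [seq x s | s <- iota 0 (h * h)] (avgs lin [seq y s | s <- iota 0 (h * h)] w) -
    avgs lin (interleave x y (h * h)) w| <= (h * h)%N%:R * (h * h)%N%:R * (2^-1 ^+ h * (4 * `|v|)).
  apply: regroup => [s t _ _|s t n|s t n|s t sN ts|]; first exact: hcc.
  - by rewrite /cc; case: ifP => _; [exact: cX|apply: cV; exact: cX].
  - by rewrite /cc; case: ifP => _; [exact: cY|apply: cV; exact: cY].
  - by rewrite ccd P12 ?(ltnW ts) //; exact: cross.
  - by rewrite mulr_ge0 ?mulr_ge0 ?exprn_ge0 ?invr_ge0.
have inter : `|avgs lin (interleave x y (h * h)) w| <= 2 * rho ^+ h * `|v|.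
  have -> : avgs lin (interleave x y (h * h)) w = avgs lin (interleave x y (h * h))
     (avgs lin (box Z c) v' - lin (z 0%N) (avgs lin (box Z c) v')).
    congr (avgs _ _ _); rewrite /w /u -(avgs_lin_sub hact); congr (_ - _).
    by rewrite -(act_avgs_comm hlin) // => _ /mapP[f _ ->]; exact: additive_commute.
  apply: le_trans (interleave_contract hact (r := r) (rho := rho) r_rho rho_lt1 zS _ _ _ _) _.
  - by move=> l s; exact: cX.
  - by move=> l s; exact: cY.
  - move=> s sN u'; have := contract (hcc s s) u'.
    have -> // : `|lin (cc s s) u' - u'| = `|lin (z (h.-1 - s %/ h)%N) u' - u'|.
    by rewrite -/(disp lin _ _) ccd P12 // subnn F0.
  rewrite ler_wpM2l ?mulr_ge0 ?exprn_ge0 //; first by case/andP: rho_lt1 => *; lra.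
  by apply: le_trans (avgs_lin_norm hact _ _) v'v.
have := ler_normD (avgs lin [seq x s | s <- iota 0 (h * h)] (avgs lin [seq y s | s <- iota 0 (h * h)] w) -
    avgs lin (interleave x y (h * h)) w) (avgs lin (interleave x y (h * h)) w).
rewrite subrK /contraction_rate (natrM _ (h * h)%N (h * h)%N).
move: regroup inter; set N := (h * h)%N%:R; set q := 2^-1 ^+ h.
have -> : N * N * (q * (4 * `|v|)) = N * N * 4 * q * `|v| by ring.
rewrite mulrDl; lra.
Qed.

End BoxContraction.

Section BoxSwap.
Variables (A : comPzRingType) (m : nat) (gen : 'I_m.+1 -> A).
Hypothesis gen0 : gen ord0 = 2.
Variables (R : realType) (E : normedModType R) (G : groupType).
Variables (act : G -> E -> E) (hact : affine_isometric_action act).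
Local Notation mon := (mon gen).
Local Notation box := (box gen).

(** All cross commutators lie in Z at degree at most a + b, which is l below c; the Z-box damps each
    of them by 2^-l. *)
Lemma box_swap (X Z Y : A -> G) (hs : heisenberg X Z Y) (a b c l : nat) (v : E) (L : R) :
  (a + b + l <= c)%N ->
  (forall f, (degree f <= c)%N -> disp act (Z (mon f)) v <= L) ->
  `|avgs act (box X a) (avgs act (box Y b) (avgs act (box Z c) v)) -
    avgs act (box Y b) (avgs act (box X a) (avgs act (box Z c) v))| <=
  (a.+1 ^ m.+1 * b.+1 ^ m.+1)%N%:R * (2^-1 ^+ l * L).
Proof.
move=> le hL; have [hX hY hZ cX cY [s hs1 hXY]] := hs.
have L0 : 0 <= L.
  by apply: le_trans (hL (epow ord0 0%N) _); rewrite ?disp_ge0 // degree_pow.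
have q0 : 0 <= 2^-1 ^+ l * L by rewrite mulr_ge0 ?exprn_ge0 ?invr_ge0.
apply: (@le_trans _ _ ((size (box X a))%:R * (size (box Y b))%:R * (2^-1 ^+ l * L))); last first.
  by rewrite -natrM ler_wpM2r // ler_nat !size_map leq_mul // size_expos.
pose c' (x y : G) : G := ((y * x)^-1 * (x * y))%g.
have c'E e f : c' (X (mon e)) (Y (mon f)) = Z (s * (mon e * mon f)).
  by rewrite /c' hXY mulKg.
apply: (avgs_swap hact (c := c')).
- by move=> x y _ _; rewrite /c' mulVKg.
- by move=> _ _ /mapP[e _ ->] /mapP[f _ ->] _ /mapP[e' _ ->]; rewrite c'E; exact: cX.
- by move=> _ _ /mapP[e _ ->] /mapP[f _ ->] _ /mapP[e' _ ->]; rewrite c'E; exact: cY.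
move=> _ _ /mapP[e he ->] /mapP[f hf ->]; rewrite c'E.
have -> w : disp act (Z (s * (mon e * mon f))) w = disp act (Z (mon (eadd e f))) w.
  by rewrite mon_add; case: hs1 => ->; rewrite ?mul1r // mulN1r additiveN // dispV.
move: he hf; rewrite !mem_expos => he hf.
apply: le_trans (disp_box gen0 hact (l := l) v hZ _) _.
  by rewrite degree_add; lia.
rewrite ler_wpM2l ?exprn_ge0 ?invr_ge0 //; apply: hL.
by rewrite !degree_add degree_pow; lia.
Qed.

End BoxSwap.

(** * Enlarging the middle box *)

Section BoxGrowth.
Variables (A : comPzRingType) (m : nat) (gen : 'I_m.+1 -> A).
Hypothesis gen0 : gen ord0 = 2.
Variables (R : realType) (E : normedModType R) (G : groupType).
Variables (act : G -> E -> E) (hact : affine_isometric_action act).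
Variables (r rho : R).
Hypothesis r_rho : 0 <= r <= rho.
Hypothesis rho_lt1 : 2 / 3 <= rho < 1.
Let lin := linear_part act.
Let hlin : affine_isometric_action lin := linear_part_action hact.
Hypothesis contract : forall x y z : G, (x * y = y * x * z)%g -> forall v,
  `|avg lin x (avg lin y v)| <= r * `|v| \/ `|lin z v - v| <= 2^-1 * `|v|.
Local Notation mon := (mon gen).
Local Notation box := (box gen).

Lemma avgs_half w u v : avgs act w (2^-1 *: (u + v)) = 2^-1 *: (avgs act w u + avgs act w v).
Proof.
elim: w => //= g w ->; rewrite /avg (act_half hact).
by lincomb R ltac:(lra).
Qed.

(** One [contraction_rate] for each of the h steps of a dyadic telescoping, and 2^-h for what is
    left at its end. *)
Definition growth_rate (h : nat) : R := h%:R * contraction_rate rho h + 2^-1 ^+ h.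

Lemma contraction_rate_ge0 h : 0 <= contraction_rate rho h.
Proof.
case/andP: rho_lt1 => h1 h2; have r0 : 0 <= rho by lra.
by rewrite addr_ge0 // !mulr_ge0 ?exprn_ge0 ?invr_ge0.
Qed.

Lemma growth_rate_ge0 h : 0 <= growth_rate h.
Proof. by rewrite addr_ge0 ?mulr_ge0 ?exprn_ge0 ?invr_ge0 ?contraction_rate_ge0. Qed.

Section Triple.
Variables (X Z Y : A -> G).
Hypothesis hs : heisenberg X Z Y.

(** [box_linear_bound] needs a vector u - z u with u under control, but [v] itself is not: only its
    displacement [b0] is. Averaging [b0] along z_0, ..., z_(h-1) changes it at step j by half of B_j
    - z_j B_j, with [|B j| <= L], and ends at 2^-h times a displacement. The h doublings explain the
    degrees up to [c.+1 + h] in the hypothesis. *)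
Lemma box_affine_bound (h a b c : nat) (e : expo m) (v : E) (L : R) :
  (0 < h)%N -> degree e = c.+1 ->
  (8 * h ^ 3 <= a)%N -> (8 * h ^ 3 <= b)%N -> (m.+1 * (4 * h ^ 3) <= c.+1)%N ->
  (c + 8 * h ^ 3 <= a + b)%N ->
  (forall f, (degree f <= c.+1 + h)%N -> disp act (Z (mon f)) v <= L) ->
  let T u := avgs act (box X a) (avgs act (box Y b) (avgs act (box Z c) u)) in
  is_true (`|T v - T (act (Z (mon e)) v)| <= growth_rate h * L).
Proof.
move=> h0 de ha hb hc hab hL T.
pose TL u := avgs lin (box X a) (avgs lin (box Y b) (avgs lin (box Z c) u)).
have -> : T v - T (act (Z (mon e)) v) = TL (v - act (Z (mon e)) v).
  by rewrite /T /TL !avgs_sub.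
pose z j := Z (mon (eadd e (epow ord0 j))).
have zS l : z l.+1 = (z l * z l)%g by apply: double_mon => //; exact: heisZ hs.
have z0 : Z (mon e) = z 0%N.
  by rewrite /z; congr (Z (mon _)); apply/ffunP => i; rewrite !ffunE; case: eqP; rewrite addn0.
rewrite z0; set b0 := v - act (z 0%N) v.
have L0 : 0 <= L.
  by apply: le_trans (hL e _); rewrite ?disp_ge0 // de leq_addr.
have b0L : `|b0| <= L by rewrite /b0 distrC -z0; apply: hL; rewrite de leq_addr.
pose B j := avgs lin [seq z i | i <- iota 0 j] b0.
have BL j : `|B j| <= L by apply: le_trans (avgs_lin_norm hact _ _) b0L.
have BS j : B j.+1 = 2^-1 *: (B j + lin (z j) (B j)).
  rewrite /B -[in LHS]addn1 iotaD map_cat avgs_cat /= add0n -(avg_avgs_comm hlin) //.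
  by move=> _ /mapP[i _ ->]; apply: additive_commute; exact: heisZ hs.
have Bh : TL (B h) = - (2^-1 ^+ h *: TL (act (z h) v - v)).
  have -> : B h = - (2^-1 ^+ h *: (act (z h) v - v)).
    rewrite /B /b0 -(avgs_dyadic hact h v zS) -avgs_sub // opprB; congr (_ - _).
    rewrite (act_avgs_comm hact) // => _ /mapP[i _ ->].
    by apply: additive_commute; exact: heisZ hs.
  by rewrite -scaleNr /TL !avgs_linZ // scaleNr.
have TLn u : `|TL u| <= `|u|.
  apply: le_trans (avgs_lin_norm hact _ _) _; apply: le_trans (avgs_lin_norm hact _ _) _.
  exact: avgs_lin_norm.
have TLD u w : TL (u + w) = TL u + TL w by rewrite /TL !avgs_linD.
have TLZ k u : TL (k *: u) = k *: TL u by rewrite /TL !avgs_linZ.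
suff H j : (j <= h)%N -> `|TL b0| <= `|TL (B j)| + j%:R * contraction_rate rho h * L.
  apply: le_trans (H h (leqnn h)) _; rewrite Bh normrN normrZ ger0_norm ?exprn_ge0 ?invr_ge0 //.
  rewrite /growth_rate mulrDl addrC lerD2l ler_wpM2l ?exprn_ge0 ?invr_ge0 //.
  by apply: le_trans (TLn _) (hL _ _); rewrite degree_add degree_pow de.
elim: j => [|j IHj] jh; first by rewrite mul0r mul0r addr0.
apply: le_trans (IHj (ltnW jh)) _.
have kl : `|TL (B j - lin (z j) (B j))| <= contraction_rate rho h * `|B j|.
  have := box_linear_bound gen0 hact r_rho rho_lt1 contract hs h0 (ltnW jh) de ha hb hc hab (B j).
  exact.
have e1 : B j = B j.+1 + 2^-1 *: (B j - lin (z j) (B j)) by rewrite BS; lincomb R ltac:(lra).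
have e2 : TL (B j) = TL (B j.+1) + 2^-1 *: TL (B j - lin (z j) (B j)) by rewrite -TLZ -TLD -e1.
have n2 := ler_normD (TL (B j.+1)) (2^-1 *: TL (B j - lin (z j) (B j))).
rewrite -e2 [X in _ <= _ + X]normrZ ger0_norm ?invr_ge0 // in n2.
have c0 := contraction_rate_ge0 h.
have n3 : contraction_rate rho h * `|B j| <= contraction_rate rho h * L by rewrite ler_wpM2l.
have n4 := mulr_ge0 c0 L0.
have -> : j.+1%:R * contraction_rate rho h * L = j%:R * contraction_rate rho h * L + contraction_rate rho h * L.
  by rewrite -natr1; ring.
lra.
Qed.

(** The monomials of degree exactly [c.+1] are added one by one; those already added commute with
    the rest of Z and preserve the bound [L]. *)
Lemma box_grow1 (h a b c : nat) (v : E) (L : R) :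
  (0 < h)%N ->
  (8 * h ^ 3 <= a)%N -> (8 * h ^ 3 <= b)%N -> (m.+1 * (4 * h ^ 3) <= c.+1)%N ->
  (c + 8 * h ^ 3 <= a + b)%N ->
  (forall f, (degree f <= c.+1 + h)%N -> disp act (Z (mon f)) v <= L) ->
  let T c' := avgs act (box X a) (avgs act (box Y b) (avgs act (box Z c') v)) in
  is_true (`|T c - T c.+1| <= (c.+2 ^ m.+1)%N%:R * (growth_rate h * L)).
Proof.
move=> h0 ha hb hc hab hL T.
have hZ := heisZ hs.
have sub : {subset expos m c <= expos m c.+1} by move=> f; rewrite !mem_expos => /leqW.
have p := perm_eq_cat_sub (uniq_expos m c) (uniq_expos m c.+1) sub.
set news := [seq f <- _ | _] in p.
pose TC u := avgs act (box X a) (avgs act (box Y b) (avgs act (box Z c) u)).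
have -> : T c.+1 = TC (avgs act [seq Z (mon f) | f <- news] v).
  rewrite /T /TC; do 2 congr (avgs _ _ _); rewrite -avgs_cat -[box Z c]/[seq Z (mon f) | f <- expos m c] -map_cat.
  by apply: (avgs_perm hact); [exact: (box_commute hZ) | exact: perm_map].
have L0 : 0 <= L.
  apply: le_trans (hL (epow ord0 0%N) _); rewrite ?disp_ge0 //.
  by rewrite degree_pow.
have sn : (size news <= c.+2 ^ m.+1)%N.
  by apply: leq_trans (size_expos m c.+1); rewrite size_filter count_size.
have kl0 : 0 <= growth_rate h * L by rewrite mulr_ge0 ?growth_rate_ge0.
apply: (@le_trans _ _ ((size news)%:R * (growth_rate h * L))); last first.
  by rewrite ler_wpM2r // ler_nat.
have hn : {in news, forall f, degree f = c.+1}.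
  by move=> f; rewrite mem_filter !mem_expos -ltnNge => /andP[l1 l2]; apply/eqP; rewrite eqn_leq l2.
rewrite -[T c]/(TC v).
elim: news hn {p sn} => [|f fs IHf] hn /=; first by rewrite subrr normr0 mul0r.
have {}IHf : `|TC v - TC (avgs act [seq Z (mon f) | f <- fs] v)| <= (size fs)%:R * (growth_rate h * L).
  by apply: IHf => f' hf; apply: hn; rewrite inE hf orbT.
set w := avgs act _ v in IHf *.
have TCh : TC (avg act (Z (mon f)) w) = 2^-1 *: (TC w + TC (act (Z (mon f)) w)).
  by rewrite /TC /avg !avgs_half.
have df : degree f = c.+1 by apply: hn; rewrite inE eqxx.
have kf : `|TC w - TC (act (Z (mon f)) w)| <= growth_rate h * L.
  apply: (box_affine_bound h0 df ha hb hc hab) => f' hf'.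
  apply: le_trans (hL _ hf'); apply: disp_avgs_comm => // _ /mapP[f'' _ ->].
  exact: additive_commute.
have -> : TC v - TC (avg act (Z (mon f)) w) = (TC v - TC w) + 2^-1 *: (TC w - TC (act (Z (mon f)) w)).
  by rewrite TCh; lincomb R ltac:(lra).
apply: le_trans (ler_normD _ _) _; rewrite normrZ ger0_norm ?invr_ge0 //.
rewrite -[(size fs).+1%:R]natr1 mulrDl mul1r; lra.
Qed.

Lemma box_grow (h a b c d : nat) (v : E) (L : R) :
  (0 < h)%N -> (c <= d)%N ->
  (8 * h ^ 3 <= a)%N -> (8 * h ^ 3 <= b)%N -> (m.+1 * (4 * h ^ 3) <= c.+1)%N ->
  (d + 8 * h ^ 3 <= a + b)%N ->
  (forall f, (degree f <= d + h)%N -> disp act (Z (mon f)) v <= L) ->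
  let T c' := avgs act (box X a) (avgs act (box Z c') (avgs act (box Y b) v)) in
  is_true (`|T c - T d| <= (d * d.+1 ^ m.+1)%N%:R * (growth_rate h * L)).
Proof.
move=> h0 cd ha hb hc hab hL T.
have TE c' : T c' = avgs act (box X a) (avgs act (box Y b) (avgs act (box Z c') v)).
  rewrite /T; congr (avgs _ _ _); apply: (avgs_comm hact) => _ _ /mapP[f _ ->] /mapP[f' _ ->].
  exact: heisZY hs _ _.
have L0 : 0 <= L.
  by apply: le_trans (hL (epow ord0 0%N) _); rewrite ?disp_ge0 // degree_pow.
have kl0 : 0 <= growth_rate h * L by rewrite mulr_ge0 ?growth_rate_ge0.
apply: (@le_trans _ _ (((d - c) * d.+1 ^ m.+1)%N%:R * (growth_rate h * L))); last first.
  by rewrite ler_wpM2r // ler_nat leq_mul2r leq_subr orbT.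
suff H n : (c + n <= d)%N -> `|T c - T (c + n)%N| <= (n * d.+1 ^ m.+1)%N%:R * (growth_rate h * L).
  by have := H (d - c)%N; rewrite subnKC // => /(_ (leqnn d)).
elim: n => [|n IHn] le; first by rewrite addn0 subrr normr0 mul0n mul0r.
have {}IHn : `|T c - T (c + n)%N| <= (n * d.+1 ^ m.+1)%N%:R * (growth_rate h * L) by apply: IHn; lia.
have h1 : `|T (c + n)%N - T (c + n.+1)%N| <= (d.+1 ^ m.+1)%N%:R * (growth_rate h * L).
  rewrite !TE addnS; apply: le_trans (box_grow1 (L := L) h0 ha hb _ _ _) _; [lia|lia| |].
    by move=> f hf; apply: hL; lia.
  by rewrite ler_wpM2r // ler_nat leq_exp2r //; lia.
have -> : T c - T (c + n.+1)%N = (T c - T (c + n)%N) + (T (c + n)%N - T (c + n.+1)%N).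
  by lincomb R ltac:(lra).
apply: le_trans (ler_normD _ _) _; rewrite mulSn natrD mulrDl addrC.
exact: lerD.
Qed.

End Triple.
End BoxGrowth.

(** * The hexagon of root subgroups *)

Section PolynomialDecay.
Variable R : realType.

Lemma geometric_sum_le (q : R) n : 0 <= q < 1 -> \sum_(i < n) q ^+ i <= (1 - q)^-1.
Proof.
move=> /andP[q0 q1]; rewrite -[X in _ <= X]mul1r ler_pdivlMr; last by lra.
have -> : (\sum_(i < n) q ^+ i) * (1 - q) = 1 - q ^+ n.
  by rewrite mulrC -opprB mulNr -subrX1 opprB.
by have := exprn_ge0 n q0; lra.
Qed.

(** With q = s^2, one factor n+1 is paid by s^n: (n+1) s^n is at most the sum of the s^i with i <=
    n. *)
Lemma poly_decay_bounded (k : nat) (q : R) : 0 <= q < 1 ->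
  exists2 B : R, 0 <= B & forall n, n.+1%:R ^+ k * q ^+ n <= B.
Proof.
elim: k q => [|k IHk] q /andP[q0 q1].
  by exists 1 => // n; rewrite expr0 mul1r exprn_ile1 // ltW.
pose s := Num.sqrt q.
have s0 : 0 <= s by exact: sqrtr_ge0.
have s2 : s ^+ 2 = q by rewrite sqr_sqrtr.
have s1 : s < 1 by rewrite -sqrtr1 ltr_sqrt.
have [|B B0 hB] := IHk s; first by rewrite s0 s1.
have i0 : 0 <= (1 - s)^-1 by rewrite invr_ge0; lra.
exists (B * (1 - s)^-1) => [|n]; first by rewrite mulr_ge0.
have -> : n.+1%:R ^+ k.+1 * q ^+ n = (n.+1%:R ^+ k * s ^+ n) * (n.+1%:R * s ^+ n).
  by rewrite -s2 -exprM mulnC exprM expr2 exprS; ring.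
apply: ler_pM => //; [by rewrite mulr_ge0 ?exprn_ge0|by rewrite mulr_ge0 ?exprn_ge0|].
apply: le_trans (geometric_sum_le n.+1 _); last by rewrite s0 s1.
rewrite mulr_natl -[X in _ *+ X]card_ord -sumr_const; apply: ler_sum => i _.
by apply: ler_wiXn2l => //; [exact: ltW | rewrite -ltnS].
Qed.

Lemma poly_decay_sum (k : nat) (q : R) : 0 <= q < 1 ->
  exists2 B : R, 0 <= B & forall n, \sum_(i < n) i.+1%:R ^+ k * q ^+ i <= B.
Proof.
move=> /andP[q0 q1]; pose s := Num.sqrt q.
have s0 : 0 <= s by exact: sqrtr_ge0.
have s2 : s ^+ 2 = q by rewrite sqr_sqrtr.
have s1 : s < 1 by rewrite -sqrtr1 ltr_sqrt.
have [|B B0 hB] := @poly_decay_bounded k s; first by rewrite s0 s1.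
have i0 : 0 <= (1 - s)^-1 by rewrite invr_ge0; lra.
exists (B * (1 - s)^-1) => [|n]; first by rewrite mulr_ge0.
apply: (@le_trans _ _ (B * \sum_(i < n) s ^+ i)); last first.
  by rewrite ler_wpM2l // geometric_sum_le // s0.
rewrite mulr_sumr; apply: ler_sum => i _.
rewrite -s2 -exprM mulnC exprM expr2 mulrA ler_wpM2r ?exprn_ge0 //.
Qed.

Lemma poly_decay_small (k : nat) (q e : R) : 0 <= q < 1 -> 0 < e ->
  exists N, forall n, (N <= n)%N -> n.+1%:R ^+ k * q ^+ n <= e.
Proof.
move=> hq e0; have [B B0 hB] := @poly_decay_bounded k.+1 q hq.
exists (Num.truncn (B / e)).+1 => n hn.
have le : B / e <= n.+1%:R.
  apply: ltW; apply: lt_le_trans (truncnS_gt _) _; by rewrite ler_nat leqW.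
have n0 : 0 < n.+1%:R :> R by rewrite ltr0n.
rewrite -(ler_pM2l n0) mulrA -exprS; apply: le_trans (hB n) _.
by rewrite ler_pdivrMr in le.
Qed.

End PolynomialDecay.

(** * Moves between products of six boxes *)

Section Hexagon.
Variables (A : comPzRingType) (m : nat) (gen : 'I_m.+1 -> A).
Hypothesis gen0 : gen ord0 = 2.
Variables (R : realType) (E : normedModType R) (G : groupType).
Variables (act : G -> E -> E) (hact : affine_isometric_action act).
Variables (r rho : R).
Hypothesis r_rho : 0 <= r <= rho.
Hypothesis rho_lt1 : 2 / 3 <= rho < 1.
Let lin := linear_part act.
Hypothesis contract : forall x y z : G, (x * y = y * x * z)%g -> forall v,
  `|avg lin x (avg lin y v)| <= r * `|v| \/ `|lin z v - v| <= 2^-1 * `|v|.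
Variable x : nat -> A -> G.
Hypothesis x_periodic : forall i, x (i + 6)%N = x i.
Hypothesis x_heis : forall i, heisenberg (x i) (x i.+1) (x i.+2).
Variable xi : E.
Local Notation mon := (mon gen).
Let B i a := avgs act (box gen (x i) a).

Section Moves.
Variables (S : nat) (L0 : R).
Hypothesis L0P : forall i f, (degree f <= S)%N -> disp act (x i (mon f)) xi <= L0.

Definition box_card : R := (S.+1 ^ m.+1)%N%:R.
Local Notation P := box_card.

(** The distance from [xi] after k box averages: a box has at most [box_card] elements, each moving
    [xi] by at most [L0]. *)
Definition near k v := `|v - xi| <= k%:R * (P * L0).

Lemma L0_ge0 : 0 <= L0.
Proof. by apply: le_trans (L0P 0%N (f := epow ord0 0%N) _); rewrite ?disp_ge0 // degree_pow. Qed.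

Lemma P_ge1 : 1 <= P.
Proof. by rewrite /box_card ler1n expn_gt0. Qed.

Lemma near0 : near 0 xi.
Proof. by rewrite /near subrr normr0 mul0r. Qed.

Lemma near_box k i a v : (a <= S)%N -> near k v -> near k.+1 (B i a v).
Proof.
move=> aS hv; rewrite /near /B.
have -> : avgs act (box gen (x i) a) v - xi =
  (avgs act (box gen (x i) a) v - avgs act (box gen (x i) a) xi) + (avgs act (box gen (x i) a) xi - xi).
  by lincomb R ltac:(lra).
apply: le_trans (ler_normD _ _) _.
have h1 := avgs_dist hact (box gen (x i) a) v xi.
have h2 : `|avgs act (box gen (x i) a) xi - xi| <= (size (box gen (x i) a))%:R * L0.
  apply: avgs_moves => // _ /mapP[f hf ->]; apply: L0P; apply: leq_trans aS.
  by rewrite -mem_expos.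
have h3 : (size (box gen (x i) a))%:R * L0 <= P * L0.
  rewrite ler_wpM2r ?L0_ge0 // ler_nat size_map (leq_trans (size_expos _ _)) //.
  by rewrite leq_exp2r.
rewrite -[k.+1%:R]natr1 mulrDl mul1r; move: hv; rewrite /near; lra.
Qed.

(** 9 = 1 + 2 * 4: a point at most four boxes away from [xi] is displaced by [L0] plus twice its
    distance from [xi]. *)
Definition letter_bound : R := 9 * (P * L0).

Lemma near_disp k v i f : (k <= 4)%N -> near k v -> (degree f <= S)%N ->
  disp act (x i (mon f)) v <= letter_bound.
Proof.
move=> k4 hv hf; apply: le_trans (disp_dist hact _ xi v) _.
rewrite distrC; have PL : L0 <= P * L0 by rewrite ler_peMl ?L0_ge0 ?P_ge1.
have : k%:R * (P * L0) <= 4 * (P * L0) by rewrite ler_wpM2r ?ler_nat // (le_trans L0_ge0).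
have := L0P i hf; move: hv; rewrite /near /letter_bound; lra.
Qed.

Definition grow_error h : R := (S%:R * P) * (growth_rate rho h * letter_bound).
Definition swap_error h : R := (P * P) * (2^-1 ^+ h * letter_bound).

Lemma letter_bound_ge0 : 0 <= letter_bound.
Proof. by rewrite /letter_bound !mulr_ge0 ?L0_ge0 // (le_trans ler01 P_ge1). Qed.

Lemma grow k i h a b c d v :
  (0 < h)%N -> (c <= d)%N -> (8 * h ^ 3 <= a)%N -> (8 * h ^ 3 <= b)%N ->
  (m.+1 * (4 * h ^ 3) <= c.+1)%N -> (d + 8 * h ^ 3 <= a + b)%N -> (d + h <= S)%N ->
  (k <= 4)%N -> near k v ->
  `|B i.+2 a (B i.+1 c (B i b v)) - B i.+2 a (B i.+1 d (B i b v))| <= grow_error h /\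
  `|B i a (B i.+1 c (B i.+2 b v)) - B i a (B i.+1 d (B i.+2 b v))| <= grow_error h.
Proof.
move=> h0 cd ha hb hc hab hd k4 hv.
have e0 : 0 <= growth_rate rho h * letter_bound.
  by rewrite mulr_ge0 ?letter_bound_ge0 // growth_rate_ge0.
have le : (d * d.+1 ^ m.+1)%N%:R * (growth_rate rho h * letter_bound) <= grow_error h.
  rewrite /grow_error ler_wpM2r // /box_card -natrM ler_nat leq_mul ?leq_exp2r //; lia.
split; apply: le_trans _ le.
  apply: (box_grow gen0 hact r_rho rho_lt1 contract (heisenberg_sym (x_heis i)) h0 cd ha hb hc hab).
  by move=> f hf; apply: near_disp k4 hv _; lia.
apply: (box_grow gen0 hact r_rho rho_lt1 contract (x_heis i) h0 cd ha hb hc hab).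
by move=> f hf; apply: near_disp k4 hv _; lia.
Qed.

Lemma B_comm i a b v : B i a (B i.+1 b v) = B i.+1 b (B i a v).
Proof.
apply: (avgs_comm hact) => _ _ /mapP[f _ ->] /mapP[f' _ ->].
by apply: commute_sym; exact: heisZX (x_heis i) _ _.
Qed.

Lemma B_dist i a u v : `|B i a u - B i a v| <= `|u - v|.
Proof. exact: avgs_dist. Qed.

(** The middle box commutes with both outer ones, so it can be applied before them and then damps
    the commutators that arise from exchanging them. *)
Lemma reverse k i l a b c v :
  (a + b + l <= c)%N -> (a <= S)%N -> (b <= S)%N -> (c <= S)%N -> (k <= 4)%N -> near k v ->
  `|B i.+2 a (B i.+1 c (B i b v)) - B i b (B i.+1 c (B i.+2 a v))| <= swap_error l.
Proof.
move=> le aS bS cS k4 hv; rewrite -[B i.+1 c (B i b v)]B_comm.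
have -> : B i.+1 c (B i.+2 a v) = B i.+2 a (B i.+1 c v) by rewrite B_comm.
have hd f : (degree f <= c)%N -> disp act (x i.+1 (mon f)) v <= letter_bound.
  by move=> hf; apply: near_disp k4 hv _; lia.
have h1 := box_swap gen0 hact (heisenberg_sym (x_heis i)) le hd.
apply: le_trans h1 _.
have q0 : 0 <= 2^-1 ^+ l * letter_bound.
  by apply: mulr_ge0; [rewrite exprn_ge0 ?invr_ge0 | exact: letter_bound_ge0].
rewrite /swap_error; apply: ler_wpM2r => //.
by rewrite /box_card -natrM ler_nat leq_mul ?leq_exp2r.
Qed.

(* By periodicity the indices 4 ... 9 cover the six root subgroups.  Boxes of
   sizes (n, 3n, n) for consecutive indices may be written in either order,
   since the cross terms are absorbed by the middle box. *)
Definition tower a9 a8 a7 a6 a5 a4 := B 9 a9 (B 8 a8 (B 7 a7 (B 6 a6 (B 5 a5 (B 4 a4 xi))))).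

(** A box can be changed only between its two neighbours, and only up to the sum of their sizes
    minus 8 h^3. Hence the detour through temporarily enlarged boxes, and the reversal that brings
    the two end boxes into the interior. *)
Lemma tower_step h n n' :
  (0 < h)%N -> (n <= n')%N -> (3 * n' + 8 * h ^ 3 <= 4 * n)%N ->
  (m.+1 * (4 * h ^ 3) <= n.+1)%N -> (3 * n' + h <= S)%N ->
  `|tower n (3 * n) n n (3 * n) n - tower n' (3 * n') n' n' (3 * n') n'| <=
     8 * grow_error h + 4 * swap_error h.
Proof.
move=> h0 nn' n4 hm hS.
have hk : (h <= 8 * h ^ 3)%N.
  by apply: (@leq_trans (h ^ 3)%N); [rewrite -{1}(expn1 h) leq_pexp2l | rewrite leq_pmull].
have gr k i := @grow k i h.
move: (8 * h ^ 3)%N n4 hk gr => K n4 hk gr.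
have nS a : (a <= 3 * n')%N -> (a <= S)%N by lia.
have nr j a v i : near j v -> (a <= 3 * n')%N -> near j.+1 (B i a v).
  by move=> hv ha; apply: near_box hv; exact: nS.
have d3 : forall f g k : E, forall c1 c2 : R, `|f - g| <= c1 -> `|g - k| <= c2 -> `|f - k| <= c1 + c2.
  by move=> f g q c1 c2 h1 h2; apply: le_trans (ler_distD g _ _) _; exact: lerD.
have nB := B_dist.
have {}gr k i a b c d v : (k <= 4)%N -> near k v ->
  [&& c <= d, K <= a, K <= b, n <= c, d + K <= a + b & d <= 3 * n']%N ->
  `|B i.+2 a (B i.+1 c (B i b v)) - B i.+2 a (B i.+1 d (B i b v))| <= grow_error h /\
  `|B i a (B i.+1 c (B i.+2 b v)) - B i a (B i.+1 d (B i.+2 b v))| <= grow_error h.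
  move=> k4 hv /and5P[h1 h2 h3 h4 /andP[h5 h6]]; apply: gr k4 hv => //.
    by apply: leq_trans hm _.
  by apply: leq_trans hS; rewrite leq_add2r.
have a1 : (n <= 3 * n')%N by lia.
have a2 : (3 * n <= 3 * n')%N by lia.
have a3 : (n' <= 3 * n')%N by lia.
have n0 := near0.
pose v5 a5 a4 := B 5 a5 (B 4 a4 xi).
pose v6 a6 a5 a4 := B 6 a6 (v5 a5 a4).
have n5 a5 a4 : (a5 <= 3 * n')%N -> (a4 <= 3 * n')%N -> near 2 (v5 a5 a4).
  by move=> h1 h2; apply: (nr) => //; exact: (nr).
have n6 a6 a5 a4 : (a6 <= 3 * n')%N -> (a5 <= 3 * n')%N -> (a4 <= 3 * n')%N -> near 3 (v6 a6 a5 a4).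
  by move=> h1 h2 h3; apply: (nr) => //; exact: n5.
have q0 : [&& n <= 3 * n, K <= 3 * n, K <= n, n <= n, 3 * n + K <= 3 * n + n & 3 * n <= 3 * n']%N by lia.
have q1 : [&& 3 * n <= 3 * n', K <= n, K <= 3 * n, n <= 3 * n, 3 * n' + K <= n + 3 * n & 3 * n' <= 3 * n']%N by lia.
have q2 : [&& n' <= 3 * n, K <= 3 * n', K <= n, n <= n', 3 * n + K <= 3 * n' + n & 3 * n <= 3 * n']%N by lia.
have q3 : [&& n <= 3 * n, K <= n', K <= 3 * n, n <= n, 3 * n + K <= n' + 3 * n & 3 * n <= 3 * n']%N by lia.
have q4 : [&& 3 * n <= 3 * n', K <= 3 * n, K <= n, n <= 3 * n, 3 * n' + K <= 3 * n + n & 3 * n' <= 3 * n']%N by lia.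
have q5 : [&& n' <= 3 * n, K <= n', K <= 3 * n', n <= n', 3 * n + K <= n' + 3 * n' & 3 * n <= 3 * n']%N by lia.
have q6 : [&& n <= n', K <= 3 * n', K <= n, n <= n, n' + K <= 3 * n' + n & n' <= 3 * n']%N by lia.
have q7 : [&& n <= n', K <= n', K <= 3 * n', n <= n, n' + K <= n' + 3 * n' & n' <= 3 * n']%N by lia.
have q8 : (n + n' + h <= 3 * n')%N by lia.
have q9 : (n' + n' + h <= 3 * n')%N by lia.
(* Box 7 is inflated to 3n so that box 8, between sizes n and 3n, may grow to 3n'; boxes 6 and 5 are
   treated alike below. *)
have s1 : `|tower n (3 * n) n n (3 * n) n - tower n (3 * n) (3 * n) n (3 * n) n| <= grow_error h.
  apply: le_trans (nB _ _ _ _) _.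
  have [|||h1 _] := gr 2%N 6%N (3 * n)%N n n (3 * n)%N (v5 (3 * n)%N n); [by []|exact: n5|exact: q0|exact: h1].
have s2 : `|tower n (3 * n) (3 * n) n (3 * n) n - tower n (3 * n') (3 * n) n (3 * n) n| <= grow_error h.
  have [|||h1 _] := gr 3%N 7%N n (3 * n)%N (3 * n)%N (3 * n')%N (v6 n (3 * n)%N n); [by []|exact: n6|exact: q1|exact: h1].
(* Shrinking box 7 from 3n to n' is the growth from n' to 3n read backwards. *)
have s3 : `|tower n (3 * n') (3 * n) n (3 * n) n - tower n (3 * n') n' n (3 * n) n| <= grow_error h.
  apply: le_trans (nB _ _ _ _) _; rewrite distrC.
  have [|||h1 _] := gr 2%N 6%N (3 * n')%N n n' (3 * n)%N (v5 (3 * n)%N n); [by []|exact: n5|exact: q2|exact: h1].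
have s4 : `|tower n (3 * n') n' n (3 * n) n - tower n (3 * n') n' (3 * n) (3 * n) n| <= grow_error h.
  apply: le_trans (nB _ _ _ _) _; apply: le_trans (nB _ _ _ _) _.
  have [|||h1 _] := gr 1%N 5%N n' (3 * n)%N n (3 * n)%N (B 4 n xi); [by []|exact: (nr)|exact: q3|exact: h1].
have s5 : `|tower n (3 * n') n' (3 * n) (3 * n) n - tower n (3 * n') n' (3 * n) (3 * n') n| <= grow_error h.
  apply: le_trans (nB _ _ _ _) _; apply: le_trans (nB _ _ _ _) _; apply: le_trans (nB _ _ _ _) _.
  have [|||h1 _] := gr 0%N 4%N (3 * n)%N n (3 * n)%N (3 * n')%N xi; [by []|exact: near0|exact: q4|exact: h1].
have s6 : `|tower n (3 * n') n' (3 * n) (3 * n') n - tower n (3 * n') n' n' (3 * n') n| <= grow_error h.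
  apply: le_trans (nB _ _ _ _) _; apply: le_trans (nB _ _ _ _) _; rewrite distrC.
  have [|||h1 _] := gr 1%N 5%N n' (3 * n')%N n' (3 * n)%N (B 4 n xi); [by []|exact: (nr)|exact: q5|exact: h1].
(* Boxes 9 and 4 are neighbours in the cyclic order. After both triples are reversed they stand next
   to each other, and by periodicity 4, 5 may be read as 10, 11. *)
pose rtower a7 a8 a9 a4 a5 a6 := B 7 a7 (B 8 a8 (B 9 a9 (B 4 a4 (B 5 a5 (B 6 a6 xi))))).
have rev a b : (a + b + h <= 3 * n')%N -> (a <= 3 * n')%N -> (b <= 3 * n')%N ->
   `|tower a (3 * n') b b (3 * n') a - rtower b (3 * n')%N a a (3 * n')%N b| <= 2 * swap_error h.
  move=> ab ha hb.
  have -> : 2 * swap_error h = swap_error h + swap_error h by ring.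
  apply: (d3 _ (B 7 b (B 8 (3 * n')%N (B 9 a (v6 b (3 * n')%N a))))).
    by apply: (@reverse 3%N 7%N h a b (3 * n')%N) => //; do ?[exact: nS]; apply: n6.
  do 3 apply: le_trans (nB _ _ _ _) _.
  apply: (@reverse 0%N 4%N h b a (3 * n')%N) => //; do ?[exact: nS].
  by rewrite addnAC -addnA [(h + _)%N]addnC addnA [(b + a)%N]addnC.
have s7 := rev n n' q8 a1 a3; have s10 := rev n' n' q9 a3 a3.
have B10 i a v : B (i + 6) a v = B i a v by rewrite /B x_periodic.
have s8 : `|rtower n' (3 * n')%N n n (3 * n')%N n' - rtower n' (3 * n')%N n' n (3 * n')%N n'| <= grow_error h.
  apply: le_trans (nB _ _ _ _) _; rewrite -!(B10 4).
  have [|||_ h1] := gr 2%N 8%N (3 * n')%N n n n' (B 5 (3 * n')%N (B 6 n' xi)); [by []|do 2 apply: (nr) => //|exact: q6|exact: h1].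
have s9 : `|rtower n' (3 * n')%N n' n (3 * n')%N n' - rtower n' (3 * n')%N n' n' (3 * n')%N n'| <= grow_error h.
  do 2 apply: le_trans (nB _ _ _ _) _; rewrite -!(B10 4) -!(B10 5).
  have [|||_ h1] := gr 1%N 9%N n' (3 * n')%N n n' (B 6 n' xi); [by []|exact: (nr)|exact: q7|exact: h1].
have {}s7 : `|tower n (3 * n') n' n' (3 * n') n - rtower n' (3 * n')%N n n (3 * n')%N n'| <= 2 * swap_error h.
  exact: s7.
have {}s10 : `|rtower n' (3 * n')%N n' n' (3 * n')%N n' - tower n' (3 * n') n' n' (3 * n') n'| <= 2 * swap_error h.
  by rewrite distrC; exact: s10.
apply: le_trans (d3 _ _ _ _ _ s1 (d3 _ _ _ _ _ s2 (d3 _ _ _ _ _ s3 (d3 _ _ _ _ _ s4 (d3 _ _ _ _ _ s5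
  (d3 _ _ _ _ _ s6 (d3 _ _ _ _ _ s7 (d3 _ _ _ _ _ s8 (d3 _ _ _ _ _ s9 s10))))))))) _.
lra.
Qed.

(** The only box above box 8 is box 9, which commutes with [x 8]. *)
Lemma tower_disp n l f : (3 * n <= S)%N -> (degree f + l <= 3 * n)%N ->
  disp act (x 8 (mon f)) (tower n (3 * n) n n (3 * n) n) <= 2^-1 ^+ l * letter_bound.
Proof.
move=> nS hf; have n1 : (n <= S)%N by lia.
have nn : near 4 (B 7 n (B 6 n (B 5 (3 * n)%N (B 4 n xi)))).
  by do 4 (apply: near_box => //); exact: near0.
 apply: le_trans (disp_avgs_comm hact (w := box gen (x 9) n) _ _) _.
  by move=> _ /mapP[f' _ ->]; apply: commute_sym; apply: commute_sym; exact: heisZY (x_heis 7) _ _.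
apply: le_trans (disp_box gen0 hact (l := l) _ (heisZ (x_heis 7)) _) _; first by lia.
rewrite ler_wpM2l ?exprn_ge0 ?invr_ge0 //.
apply: (near_disp (k := 4)) => //; last by rewrite degree_add degree_pow; lia.
Qed.

End Moves.
End Hexagon.

(** * Signed sums of monomials *)

Section Span.
Variables (A : comPzRingType) (m : nat) (gen : 'I_m.+1 -> A).

Definition signed_sum (l : seq (bool * expo m)) : A :=
  \sum_(q <- l) (-1) ^+ q.1 * mon gen q.2.

Lemma monomials_span (s : seq A) :
  (forall S : {pred A}, subring_closed S -> {subset s <= S} -> forall a, a \in S) ->
  (forall a, a \in s -> exists i, gen i = a) ->
  forall a, exists l, a = signed_sum l.
Proof.
move=> hs hg a; pose S := [pred a : A | `[< exists l, a = signed_sum l >]].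
suff : a \in S by move/asboolP.
apply: (hs S) => [|b bs]; last first.
  have [i <-] := hg b bs; apply/asboolP; exists [:: (false, epow i 1%N)].
  by rewrite /signed_sum big_seq1 mon_pow expr0 mul1r expr1.
split.
- apply/asboolP; exists [:: (false, epow ord0 0%N)].
  by rewrite /signed_sum big_seq1 mon_pow !expr0 mul1r.
- move=> b c /asboolP[l ->] /asboolP[l' ->]; apply/asboolP.
  exists (l ++ [seq (~~ q.1, q.2) | q <- l']); rewrite /signed_sum big_cat; congr (_ + _).
  by rewrite big_map -sumrN; apply: eq_bigr => -[[] e] _ /=; rewrite ?expr0 ?expr1; ring.
move=> b c /asboolP[l ->] /asboolP[l' ->]; apply/asboolP.
exists [seq (q.1 (+) q'.1, eadd q.2 q'.2) | q <- l, q' <- l'].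
rewrite /signed_sum big_allpairs_dep mulr_suml; apply: eq_bigr => q _.
rewrite mulr_sumr; apply: eq_bigr => q' _ /=; rewrite mon_add signr_addb; ring.
Qed.

End Span.

(** * Convergence of the towers *)

Section HexagonBounded.
Variables (A : comPzRingType) (m : nat) (gen : 'I_m.+1 -> A).
Hypothesis gen0 : gen ord0 = 2.
Hypothesis gen_span : forall a, exists l, a = signed_sum gen l.
Variables (R : realType) (E : completeNormedModType R) (G : groupType).
Hypothesis ucE : uniformly_convex E.
Variables (act : G -> E -> E) (hact : affine_isometric_action act).
Variable x : nat -> A -> G.
Hypothesis x_periodic : forall i, x (i + 6)%N = x i.
Hypothesis x_heis : forall i, heisenberg (x i) (x i.+1) (x i.+2).
Variable xi : E.
Local Notation mon := (mon gen).
Local Notation M := m.+1.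

(** Writing a monomial as a product of two of half the degree makes its root element a commutator of
    elements of the adjacent subgroups: doubling the degree costs a factor 4. The index i + 5 stands
    for the predecessor of i. *)
Lemma letter_growth : exists2 C : R, 0 <= C &
  forall i f D, (degree f <= D)%N -> disp act (x i (mon f)) xi <= 4 * C * D.+1%:R ^+ 2.
Proof.
pose C : R := \sum_(i < 6) \sum_(f <- expos m 1) disp act (x i (mon f)) xi.
have d0 i f : 0 <= disp act (x i (mon f)) xi by exact: disp_ge0.
have C0 : 0 <= C by apply: sumr_ge0 => i _; apply: sumr_ge0 => f _.
have xmod i : x i = x (i %% 6)%N.
  rewrite {1}(divn_eq i 6) addnC; elim: (i %/ 6)%N => [|k IHk]; first by rewrite mul0n addn0.
  by rewrite mulSn addnA addnAC x_periodic.
have H j i f : (degree f <= 2 ^ j)%N -> disp act (x i (mon f)) xi <= 4 ^+ j * C.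
  elim: j i f => [|j IHj] i f hf.
    rewrite expr0 mul1r xmod /C (bigD1 (Ordinal (ltn_pmod i (isT : 0 < 6)%N))) //=.
    rewrite (big_rem f) ?mem_expos //= -addrA ler_wpDr // addr_ge0 //.
      by apply: sumr_ge0 => f' _.
    by apply: sumr_ge0 => k _; apply: sumr_ge0 => f' _.
  have [|e1 [e2 [ef d1]]] := @expo_split m f ord0 0%N (minn (2 ^ j) (degree f)) (leq0n _).
    by rewrite geq_minr.
  have d2 : (degree e2 <= 2 ^ j)%N.
    by move: hf; rewrite ef !degree_add degree_pow expnS in d1 *; lia.
  have {}d1 : (degree e1 <= 2 ^ j)%N by lia.
  have -> : mon f = mon e1 * mon e2.
    by rewrite ef !mon_add mon_pow expr0 mulr1.
  have := disp_heisenberg hact (mon e1) (mon e2) xi (x_heis (i + 5)%N).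
  have -> : x (i + 5).+1 = x i by rewrite -addnS x_periodic.
  have := IHj (i + 5)%N e1 d1; have := IHj (i + 5).+2 e2 d2.
  by rewrite exprS; lra.
exists C => // i f D hf.
have D2 : (D <= 2 ^ up_log 2 D)%N by apply: up_logP.
apply: le_trans (H _ i f (leq_trans hf D2)) _.
suff h : (2 ^ up_log 2 D <= 2 * D.+1)%N.
  have -> : (4 : R) ^+ up_log 2 D = ((2 ^ up_log 2 D)%N%:R) ^+ 2.
    by rewrite natrX -!exprM mulnC exprM; congr (_ ^+ _); rewrite expr2; ring.
  rewrite -mulrA [C * _]mulrC mulrA ler_wpM2r //.
  apply: (@le_trans _ _ ((2 * D.+1)%N%:R ^+ 2)); first by rewrite lerXn2r ?nnegrE // ler_nat.
  by rewrite natrM exprMn; lra.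
case: (leqP D 1) => [|D1]; first by case: D {hf D2} => [|[|D]] //; rewrite ?up_log0 ?up_log1.
have := @up_log_gtn 2 D isT D1; set j := up_log 2 D; case: j => [|j] //; rewrite expnS /=; lia.
Qed.

(** Once 9 (h+1)^3 <= 11 h^3, the requirement [3 * n' + 8 * h ^ 3 <= 4 * n] of [tower_step] reduces
    to 88 M + 8 <= 96 M. *)
Let size_const := (24 * M)%N.
Let scale h := (size_const * h ^ 3)%N.

(** The errors of [tower_step] are a polynomial in h times [rho ^+ h], hence summable. An element p
    is a fixed finite signed sum of monomials, and each of them displaces the h-th tower by a
    quantity tending to 0. *)
Lemma hexagon_tower : exists T : nat -> E, exists B : R, exists N : nat,
  (forall h, (N <= h)%N -> `|T h - xi| <= B) /\
  forall p (e : R), 0 < e -> exists2 h, (N <= h)%N & disp act (x 8 p) (T h) <= e.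
Proof.
have [r /andP[r0 r1] contract0] := heisenberg_dichotomy ucE.
pose rho := Num.max r (2 / 3).
(* The powers of [s h] are 2M + 8 in the growth error (M + 1 from counting, 5 from [growth_rate], M
   + 2 from [letter_bound]) and 3M + 2 in the swap error. *)
pose q := (3 * M + 8)%N.
have q1 : (2 * M + 8 = 1 + M + 5 + (M + 2))%N by lia.
have q2 : (2 * M + 8 <= q)%N by rewrite /q; lia.
have q3 : (M + M + (M + 2) <= q)%N by rewrite /q; lia.
have q4 : (M + 2 <= q)%N by rewrite /q; lia.
have shift h : (20 <= h)%N -> exists t, h = (20 + t)%N by exists (h - 20)%N; lia.
have r_rho : 0 <= r <= rho by rewrite r0 le_max lexx.
have rho_lt1 : 2 / 3 <= rho < 1.
  by rewrite le_max lexx orbT /= gt_max r1; lra.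
have contract := contract0 G act hact.
have [C C0 hC] := letter_growth.
have /andP[rho23 rho1] := rho_lt1.
have rho0 : 0 <= rho by lra.
(* The largest box of the next tower, and h further doublings. *)
pose S h := (3 * scale h.+1 + h)%N.
pose L0 h : R := 4 * C * (S h).+1%:R ^+ 2.
have L0P h i f : (degree f <= S h)%N -> disp act (x i (mon f)) xi <= L0 h by exact: hC.
pose s h : R := (5 * size_const)%:R * h.+1%:R ^+ 3.
have Ss h : (S h).+1%:R <= s h.
  rewrite /s -natrX -natrM ler_nat /S /scale -!mulnA.
  have : (h.+1 <= h.+1 ^ 3)%N by rewrite -{1}(expn1 h.+1) leq_pexp2l.
  have : (h.+1 ^ 3 <= size_const * h.+1 ^ 3)%N by rewrite leq_pmull.
  lia.
have s1 h : 1 <= s h by apply: le_trans (Ss h); rewrite ler1n.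
have s0 h : 0 <= s h by apply: le_trans (s1 h).
have hs h : h%:R <= s h by apply: le_trans (Ss h); rewrite ler_nat /S; lia.
pose P h := @box_card m R (S h).
have Ps h : P h <= s h ^+ M by rewrite /P /box_card natrX lerXn2r ?nnegrE.
have P0 h : 0 <= P h by rewrite /P /box_card.
have L0s h : L0 h <= 4 * C * s h ^+ 2.
  by rewrite /L0 ler_wpM2l ?mulr_ge0 // lerXn2r ?nnegrE.
have L00 h : 0 <= L0 h by rewrite /L0 !mulr_ge0 ?exprn_ge0.
pose LB h := letter_bound m (S h) (L0 h).
have LBs h : LB h <= 36 * C * s h ^+ (M + 2).
  have : P h * L0 h <= s h ^+ M * (4 * C * s h ^+ 2) by apply: ler_pM.
  by rewrite /LB /letter_bound -/(P h) exprD; lra.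
have LB0 h : 0 <= LB h by rewrite /LB /letter_bound !mulr_ge0.
have half h : 2^-1 ^+ h <= rho ^+ h by rewrite lerXn2r ?nnegrE ?invr_ge0 //; lra.
have rate h : growth_rate rho h <= 7 * s h ^+ 5 * rho ^+ h.
  have q0 : 0 <= rho ^+ h by exact: exprn_ge0.
  have h5 : h%:R * (2 + 4 * h%:R ^+ 4) + 1 <= 7 * s h ^+ 5.
    have a1 : (h%:R : R) ^+ 5 <= s h ^+ 5 by rewrite lerXn2r ?nnegrE.
    have a2 : s h <= s h ^+ 5 by rewrite -{1}(expr1 (s h)) ler_weXn2l.
    by have := hs h; have := s1 h; rewrite mulrDr mulrCA -exprS; lra.
  apply: (@le_trans _ _ ((h%:R * (2 + 4 * h%:R ^+ 4) + 1) * rho ^+ h)); last by rewrite ler_wpM2r.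
  rewrite /growth_rate /contraction_rate !natrM.
  have := half h; have : h%:R * (h%:R * h%:R * (h%:R * h%:R) * 4 * 2^-1 ^+ h) <=
     h%:R * (h%:R * h%:R * (h%:R * h%:R) * 4 * rho ^+ h) :> R.
    by rewrite !ler_wpM2l ?mulr_ge0.
  have -> : h%:R ^+ 4 = h%:R * h%:R * (h%:R * h%:R) :> R by ring.
  lra.
have rate0 h : 0 <= growth_rate rho h by exact: growth_rate_ge0 rho_lt1 h.
(* 2160 = 8 * 252 + 4 * 36, where 36 C bounds [letter_bound] and 252 = 7 * 36. *)
pose K := 2160 * C.
pose err h := 8 * @grow_error m R rho (S h) (L0 h) h + 4 * swap_error m (S h) (L0 h) h.
have errs h : err h <= K * (s h ^+ q * rho ^+ h).
  have q0 : 0 <= rho ^+ h by exact: exprn_ge0.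
  have g1 : @grow_error m R rho (S h) (L0 h) h <= (s h * s h ^+ M) * (7 * s h ^+ 5 * rho ^+ h * (36 * C * s h ^+ (M + 2))).
    have Sh : (S h)%:R <= s h by apply: le_trans (Ss h); rewrite ler_nat.
    rewrite /grow_error -/(P h) -/(LB h); apply: ler_pM.
    - by rewrite mulr_ge0.
    - by rewrite mulr_ge0.
    - exact: ler_pM.
    - exact: ler_pM.
  have g2 : swap_error m (S h) (L0 h) h <= (s h ^+ M * s h ^+ M) * (rho ^+ h * (36 * C * s h ^+ (M + 2))).
    rewrite /swap_error -/(P h) -/(LB h); apply: ler_pM.
    - by rewrite mulr_ge0.
    - by rewrite mulr_ge0 ?exprn_ge0 ?invr_ge0.
    - exact: ler_pM.
    - by apply: ler_pM; rewrite ?exprn_ge0 ?invr_ge0.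
  have g3 : (s h * s h ^+ M) * (7 * s h ^+ 5 * rho ^+ h * (36 * C * s h ^+ (M + 2))) <=
     252 * C * (s h ^+ q * rho ^+ h).
    have -> : (s h * s h ^+ M) * (7 * s h ^+ 5 * rho ^+ h * (36 * C * s h ^+ (M + 2))) =
       252 * C * (s h ^+ (2 * M + 8) * rho ^+ h).
      by rewrite q1 [in RHS]exprD 2![in RHS]exprD expr1; ring.
    apply: ler_wpM2l; first by apply: mulr_ge0 C0; exact: ler0n.
    by rewrite ler_wpM2r // ler_weXn2l.
  have g4 : (s h ^+ M * s h ^+ M) * (rho ^+ h * (36 * C * s h ^+ (M + 2))) <=
     36 * C * (s h ^+ q * rho ^+ h).
    have -> : (s h ^+ M * s h ^+ M) * (rho ^+ h * (36 * C * s h ^+ (M + 2))) =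
       36 * C * (s h ^+ (M + M + (M + 2)) * rho ^+ h).
      by rewrite [in RHS]exprD [in RHS](exprD _ M M); ring.
    apply: ler_wpM2l; first by apply: mulr_ge0 C0; exact: ler0n.
    by rewrite ler_wpM2r // ler_weXn2l.
  rewrite /err /K; lra.
pose K' := K * (5 * size_const)%:R ^+ q.
have errs' h : err h <= K' * (h.+1%:R ^+ (3 * q) * rho ^+ h).
  apply: le_trans (errs h) _; rewrite /s exprMn -exprM /K'.
  by rewrite -!mulrA.
pose T h := tower gen act x xi (scale h) (3 * scale h) (scale h) (scale h) (3 * scale h) (scale h).
have step h : (20 <= h)%N -> `|T h - T h.+1| <= err h.
  move=> h20; apply: (tower_step gen0 hact r_rho rho_lt1 contract x_periodic x_heis (@L0P h)).
  - by apply: leq_trans h20.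
  - by rewrite /scale leq_mul2l leq_exp2r // leqnSn orbT.
  (* The threshold 20 suffices, as (21/20)^3 < 11/9. *)
  - have h3 : (9 * h.+1 ^ 3 <= 11 * h ^ 3)%N.
      have [t ->] := shift h h20.
      by clear; rewrite !expnS expn0; nia.
    have : (24 * h ^ 3 <= size_const * h ^ 3)%N by rewrite leq_mul2r /size_const leq_pmulr ?orbT.
    have : (size_const * (9 * h.+1 ^ 3) <= size_const * (11 * h ^ 3))%N by rewrite leq_mul2l h3 orbT.
    rewrite /scale ![(size_const * (_ * _))%N]mulnCA; clear; lia.
  - rewrite /scale /size_const; have : (M * (4 * h ^ 3) <= 24 * M * h ^ 3)%N by rewrite [(24 * M)%N]mulnC -mulnA leq_mul2l leq_mul2r orbT orbT.
    by clear; lia.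
  - by rewrite /S.
have [BS BS0 hBS] := @poly_decay_sum R (3 * q) rho (introT andP (conj rho0 rho1)).
have K0 : 0 <= K by apply: mulr_ge0 C0; exact: ler0n.
have K'0 : 0 <= K' by apply: mulr_ge0 K0 _; apply: exprn_ge0; exact: ler0n.
exists T, (`|T 20%N - xi| + K' * BS), 20%N; split.
  move=> h /shift[t ->].
  have sumT : `|T (20 + t)%N - T 20%N| <= \sum_(i < t) err (20 + i)%N.
    elim: t => [|t IHt]; first by rewrite addn0 subrr normr0 big_ord0.
    rewrite big_ord_recr /= addnS; apply: le_trans (ler_distD (T (20 + t)%N) _ _) _.
    rewrite addrC; apply: lerD => //; rewrite distrC; apply: step; exact: leq_addr.
  apply: le_trans (ler_distD (T 20%N) _ _) _; rewrite addrC lerD2l.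
  apply: le_trans sumT _.
  apply: (@le_trans _ _ (\sum_(i < t) K' * ((20 + i).+1%:R ^+ (3 * q) * rho ^+ (20 + i)))).
    by apply: ler_sum => i _.
  rewrite -mulr_sumr ler_wpM2l //; apply: le_trans (hBS (20 + t)%N).
  rewrite big_split_ord /= lerDr sumr_ge0 // => i _.
  by rewrite mulr_ge0 ?exprn_ge0.
move=> p e e0; have [l ->] := gen_span p.
pose dl := (\sum_(b <- l) degree b.2)%N.
have sl0 : 0 < (size l).+1%:R * (K' + 1) by rewrite mulr_gt0 ?ltr0n //; lra.
have [|N hN] := @poly_decay_small R (3 * q) rho (e / ((size l).+1%:R * (K' + 1)))
   (introT andP (conj rho0 rho1)); first by rewrite divr_gt0.
pose h := (20 + N + dl)%N; exists h; first by rewrite /h -addnA leq_addr.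
pose e1 := e / (size l).+1%:R.
have e10 : 0 <= e1 by rewrite divr_ge0 ?ltW.
have small f : (degree f <= dl)%N -> disp act (x 8 (mon f)) (T h) <= e1.
  move=> hf.
  have sc : (h <= scale h)%N.
    by rewrite /scale -{1}(expn1 h) (leq_trans (n := h ^ 3)) ?leq_pmull // leq_pexp2l // /h -!addnA.
  apply: le_trans (tower_disp gen0 hact r_rho rho_lt1 x_heis (@L0P h) (n := scale h) (l := h) _ _) _.
  - have : (scale h <= scale h.+1)%N by rewrite /scale leq_mul2l leq_exp2r // leqnSn orbT.
    by rewrite /S; move: (scale h) (scale h.+1); clear; lia.
  - have : (dl <= h)%N by rewrite /h leq_addl.
    by move: hf sc; move: (scale h); clear; lia.
  apply: (@le_trans _ _ (K' * (h.+1%:R ^+ (3 * q) * rho ^+ h))).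
    rewrite /K' -mulrA; have -> : (5 * size_const)%:R ^+ q * (h.+1%:R ^+ (3 * q) * rho ^+ h) = s h ^+ q * rho ^+ h.
      by rewrite /s exprMn -exprM mulrA.
    apply: (@le_trans _ _ (rho ^+ h * (36 * C * s h ^+ (M + 2)))).
      by apply: ler_pM; [rewrite exprn_ge0 ?invr_ge0|exact: LB0|exact: half|exact: LBs].
    have -> : rho ^+ h * (36 * C * s h ^+ (M + 2)) = (36 * C) * (s h ^+ (M + 2) * rho ^+ h) by ring.
    apply: ler_pM.
    - by apply: mulr_ge0 C0; exact: ler0n.
    - by rewrite mulr_ge0 ?exprn_ge0.
    - by rewrite /K; lra.
    - by rewrite ler_wpM2r ?exprn_ge0 // ler_weXn2l.
  have := hN h; rewrite -/h => /(_ _) hN'.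
  have {}hN' : h.+1%:R ^+ (3 * q) * rho ^+ h <= e / ((size l).+1%:R * (K' + 1)) by apply: hN; rewrite /h; clear; lia.
  apply: (@le_trans _ _ (K' * (e / ((size l).+1%:R * (K' + 1))))); first by rewrite ler_wpM2l.
  have K1 : 0 < K' + 1 by lra.
  have -> : K' * (e / ((size l).+1%:R * (K' + 1))) = e1 * (K' / (K' + 1)).
    by rewrite /e1 invfM; ring.
  by apply: ler_piMr => //; rewrite ler_pdivrMr // mul1r lerDl.
apply: (@le_trans _ _ ((size l)%:R * e1)); last first.
  rewrite /e1 mulrCA; apply: ler_piMr; first exact: ltW.
  by rewrite ler_pdivrMr ?ltr0n // mul1r ler_nat.
have : all (fun b => degree b.2 <= dl)%N l.
  by apply/allP => b bl; rewrite /dl (big_rem b) //= leq_addr.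
elim: (l) => [|[b f] l' IHl] /=.
  move=> _; rewrite /signed_sum big_nil mul0r.
  rewrite (_ : x 8 0 = 1%g) ?disp1 //; exact: additive0 (heisX (x_heis 8)).
case/andP=> hf /IHl {}IHl; rewrite /signed_sum big_cons /= (heisX (x_heis 8)).
apply: le_trans (dispM hact _ _ _) _; rewrite -[(size l').+1%:R]natr1 mulrDl mul1r addrC lerD //.
have := small f hf; case: b; rewrite ?expr0 ?expr1 ?mul1r // mulN1r.
by rewrite (additiveN (heisX (x_heis 8))) dispV.
Qed.

(** Which tower is almost fixed depends on p, but its distance from [xi] does not exceed [B]; this
    makes the bound uniform in p. *)
Theorem hexagon_bounded : exists B : R, forall p, disp act (x 2 p) xi <= B.
Proof.
have [T [B [N [hT hd]]]] := hexagon_tower.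
exists (2 * B + 1) => p; have <- : x 8 = x 2 by exact: x_periodic 2%N.
have [h Nh le] := hd p 1 ltr01.
have := disp_dist hact (x 8 p) (T h) xi; have := hT h Nh.
by rewrite distrC; lra.
Qed.

End HexagonBounded.

(** * Chebyshev centres *)

Section Center.
Variables (R : realType) (E : completeNormedModType R).
Hypothesis ucE : uniformly_convex E.

(** If u or v is shorter than (1 - t) rho, the midpoint is short by the triangle inequality;
    otherwise rescaling v to the norm of u moves it by at most t rho and the sphere version
    applies. *)
Lemma uniformly_convex_ball (eps : R) : 0 < eps <= 2 ->
  exists2 d : R, 0 < d <= 1 & forall (rho : R) (u v : E),
    `|u| <= rho -> `|v| <= rho -> eps * rho <= `|u - v| ->
    `|2^-1 *: (u + v)| <= (1 - d) * rho.
Proof.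
move=> he; have [|r /andP[r0 r1] hr] := @uniformly_convex_sphere R E ucE (eps / 2); first by lra.
pose t := Num.min (eps / 4) (1 - r).
have t1 : t <= eps / 4 by rewrite ge_min lexx.
have t2 : t <= 1 - r by rewrite ge_min lexx orbT.
have t0 : 0 < t by rewrite lt_min; lra.
exists (t / 2) => [|rho u v hu hv huv]; first by lra.
have rho0 : 0 <= rho by apply: le_trans hu.
have half (w : E) : `|2^-1 *: w| = 2^-1 * `|w| by rewrite normrZ ger0_norm ?invr_ge0.
have [lu|gu] := leP `|u| ((1 - t) * rho).
  by rewrite half; have := ler_normD u v; lra.
have [lv|gv] := leP `|v| ((1 - t) * rho).
  by rewrite half; have := ler_normD u v; lra.
have v0 : 0 < `|v| by apply: le_lt_trans gv; rewrite mulr_ge0 //; lra.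
pose v' := (`|u| / `|v|) *: v.
have nv' : `|u| = `|v'|.
  by rewrite /v' normrZ ger0_norm ?divr_ge0 // divfK // gt_eqF.
have dv : `|v' - v| <= t * rho.
  have -> : v' - v = ((`|u| - `|v|) / `|v|) *: v.
    by rewrite /v' mulrBl divff ?gt_eqF // scalerBl scale1r.
  rewrite normrZ normrM normfV normr_id -mulrA mulVf ?gt_eqF // mulr1.
  by rewrite ler_norml; apply/andP; split; lra.
case: (hr u v' nv') => h.
  have -> : 2^-1 *: (u + v) = 2^-1 *: (u + v') + 2^-1 *: (v - v') by lincomb R ltac:(lra).
  apply: le_trans (ler_normD _ _) _; rewrite [X in _ + X]half distrC.
  have : r * `|u| <= r * rho by rewrite ler_wpM2l.
  have : t * rho <= (1 - r) * rho by rewrite ler_wpM2r.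
  by move: h dv; lra.
have : `|u - v| <= `|u - v'| + `|v' - v| by exact: ler_distD.
have : eps / 2 * `|u| <= eps / 2 * rho by rewrite ler_wpM2l //; lra.
have : t * rho <= eps / 4 * rho by rewrite ler_wpM2r.
have : 0 < rho by apply: lt_le_trans hv.
move=> rp h1 h2 h3; have : eps / 4 * rho > 0 by rewrite mulr_gt0 //; lra.
lra.
Qed.

Variables (G : groupType) (act : G -> E -> E).
Hypothesis hact : affine_isometric_action act.
Variable K : set G.
Hypothesis KM : forall g h, K g -> K h -> K (g^-1 * h)%g.
Hypothesis K1 : K 1%g.

Theorem bounded_orbit_fixed (x0 : E) (B : R) : (forall g, K g -> disp act g x0 <= B) ->
  exists x, forall g, K g -> act g x = x.
Proof.
move=> hB; pose P (rho : R) x := forall g, K g -> `|x - act g x0| <= rho.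
pose S : set R := [set rho | exists x, P rho x]%classic.
have S0 : (S !=set0)%classic by exists B, x0 => g /hB; rewrite /disp distrC.
have Slb : lbound S 0 by move=> rho [x /(_ 1%g K1)]; apply: le_trans.
have hS : has_inf S by split => //; exists 0.
set r0 := inf S.
have r00 : 0 <= r0 by exact: lb_le_inf.
have near_r0 e : 0 < e -> exists x, P (r0 + e) x.
  move=> e0; have [rho [x hx] lt] := inf_adherent e0 hS.
  by exists x => g Kg; apply: le_trans (hx g Kg) (ltW lt).
have below x rho : rho < r0 -> ~ P rho x.
  move=> lt hP; have : r0 <= rho by apply: ge_inf => //; [exists 0|exists x].
  by rewrite leNgt lt.
(* Approximate uniqueness of the centre: near-optimal centres are close to one another. It yields
   both invariance and the Cauchy property below. *)
have close tau : 0 < tau -> exists2 e, 0 < e & forall x y, P (r0 + e) x -> P (r0 + e) y -> `|x - y| <= tau.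
  move=> tau0; have tri x y rho : P rho x -> P rho y -> `|x - y| <= 2 * rho.
    move=> /(_ 1%g K1) hx /(_ 1%g K1) hy.
    by have := ler_distD (act 1%g x0) x y; rewrite (distrC (act _ _) y); lra.
  have [r0z|r0p] := eqVneq r0 0.
    exists (tau / 2); first by lra.
    by move=> x y hx hy; have := tri _ _ _ hx hy; rewrite r0z; lra.
  have {}r0p : 0 < r0 by rewrite lt_neqAle eq_sym r0p.
  pose eps := Num.min 2 (tau / (2 * r0)).
  have eps0 : 0 < eps <= 2.
    by rewrite lt_min ge_min lexx divr_gt0 ?mulr_gt0 //=; lra.
  have [d /andP[d0 d1] hd] := uniformly_convex_ball eps0.
  (* With e = r0 d / 2 the radius (1 - d)(r0 + e) is below r0, so the midpoint of two distant
     near-optimal centres would beat the infimum. *)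
  exists (r0 * d / 2); first by rewrite !mulr_gt0 //; lra.
  set e := r0 * d / 2; have e0 : 0 < e by rewrite !mulr_gt0 //; lra.
  have er : e <= r0 by rewrite /e; have := ler_pM (ltW r0p) (ltW d0) (lexx r0) d1; lra.
  move=> x y hx hy; rewrite leNgt; apply/negP => lt.
  have : P ((1 - d) * (r0 + e)) (2^-1 *: (x + y)).
    move=> g Kg.
    have -> : 2^-1 *: (x + y) - act g x0 = 2^-1 *: ((x - act g x0) + (y - act g x0)).
      by lincomb R ltac:(lra).
    apply: hd; [exact: hx|exact: hy|].
    have -> : x - act g x0 - (y - act g x0) = x - y by lincomb R ltac:(lra).
    apply: le_trans (ltW lt); apply: (@le_trans _ _ (tau / (2 * r0) * (r0 + e))).
      by rewrite ler_wpM2r ?ge_min ?lexx ?orbT //; lra.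
    rewrite mulrAC ler_pdivrMr ?mulr_gt0 // ler_pM2l //; lra.
  apply: below; have : 0 < d * r0 by rewrite mulr_gt0.
  have : 0 < d * e by rewrite mulr_gt0.
  by rewrite /e; lra.
(* g maps the orbit to itself, so [act g x] is a centre of the same radius. *)
have fix_of x : P r0 x -> forall g, K g -> act g x = x.
  move=> hx g Kg; apply/eqP; rewrite -subr_eq0 -normr_eq0; apply/eqP/le_anti.
  rewrite normr_ge0 andbT; apply/ler_addgt0Pr => tau tau0; rewrite add0r.
  have [e e0] := close tau tau0; apply => h Kh.
    have -> : act h x0 = act g (act (g^-1 * h)%g x0) by rewrite -(actM hact) mulVKg.
    rewrite (act_dist hact); apply: le_trans (hx _ (KM Kg Kh)) _; lra.
  by apply: le_trans (hx _ Kh) _; lra.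
have [xs hxs] : exists xs : nat -> E, forall n, P (r0 + n.+1%:R^-1) (xs n).
  have /choice[xs hxs] : forall n, exists x, P (r0 + n.+1%:R^-1) x.
    by move=> n; apply: near_r0; rewrite invr_gt0.
  by exists xs.
have small e : 0 < e -> exists N, forall n, (N <= n)%N -> P (r0 + e) (xs n).
  move=> e0; exists (Num.truncn e^-1).+1 => n hn g Kg; apply: le_trans (hxs n g Kg) _.
  rewrite lerD2l invf_ple ?posrE //; apply: ltW; apply: lt_le_trans (truncnS_gt _) _.
  by rewrite ler_nat leqW.
have cv : cvgn xs.
  apply: cauchy_cvg; apply/cauchy_exP => tau tau0.
  have [|e e0 he] := close (tau / 2); first by lra.
  have [N hN] := small e e0.
  exists (xs N); exists N => // n /= Nn; rewrite -ball_normE /=.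
  by have := he _ _ (hN N (leqnn N)) (hN n Nn); lra.
exists (limn xs); apply: fix_of => g Kg.
apply/ler_addgt0Pr => e e0.
have /cvgrPdist_le hl := cv; have [|N1 _ hN1] := hl (e / 2); first by lra.
have [|N2 hN2] := small (e / 2); first by lra.
have := hN1 (maxn N1 N2) (leq_maxl _ _); have := hN2 (maxn N1 N2) (leq_maxr _ _) g Kg.
have := ler_distD (xs (maxn N1 N2)) (limn xs) (act g x0) => /=; lra.
Qed.

End Center.

(** * Bounded subadditive functions on a ring *)

Section RingBounds.
Variables (R : realType) (A : comPzRingType) (L : A -> R).
Hypothesis L0 : L 0 = 0.
Hypothesis LD : forall p q, L (p + q) <= L p + L q.
Hypothesis LN : forall p, L (- p) = L p.

Record subring (D : A -> Prop) : Prop := Subring {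
  subring1 : D 1;
  subringB : forall x y, D x -> D y -> D (x - y);
  subringM : forall x y, D x -> D y -> D (x * y) }.

Lemma subring0 D : subring D -> D 0.
Proof. by move=> DS; have := subringB DS (subring1 DS) (subring1 DS); rewrite subrr. Qed.

Lemma subringN D x : subring D -> D x -> D (- x).
Proof. by move=> DS Dx; rewrite -sub0r; apply: subringB => //; exact: subring0. Qed.

Lemma subringD D x y : subring D -> D x -> D y -> D (x + y).
Proof. by move=> DS Dx Dy; rewrite -[y]opprK; apply: subringB => //; exact: subringN. Qed.

(** A quadratic equation for t over D makes D + t D a subring. In (x + t y) q = x q + y (t q) the
    factor t joins q, which is why bounds are kept for all q. *)
Lemma adjoin_bounded (s : seq A) (D0 : A -> Prop) : subring D0 ->
  (forall q, exists B, forall a, D0 a -> L (a * q) <= B) ->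
  (forall t, t \in s -> exists u v, [/\ D0 u, D0 v & t * t = u + t * v]) ->
  exists D, [/\ subring D, forall a, D0 a -> D a, forall t, t \in s -> D t &
    forall q, exists B, forall a, D a -> L (a * q) <= B].
Proof.
move=> D0S D0B; elim: s => [|t s IHs] hs; first by exists D0.
have [|D [DS D0D sD DB]] := IHs; first by move=> t' ts; apply: hs; rewrite inE ts orbT.
have [u [v [Du Dv tt]]] := hs t (mem_head _ _).
exists (fun a => exists x y, [/\ D x, D y & a = x + t * y]); split.
- split.
  + by exists 1, 0; split; [exact: subring1 | exact: subring0 | rewrite mulr0 addr0].
  + move=> _ _ [x [y [Dx Dy ->]]] [x' [y' [Dx' Dy' ->]]].
    by exists (x - x'), (y - y'); split; [exact: subringB | exact: subringB | ring].
  + move=> _ _ [x [y [Dx Dy ->]]] [x' [y' [Dx' Dy' ->]]].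
    exists (x * x' + u * (y * y')), (x * y' + y * x' + v * (y * y')); split.
    * by do ![apply: subringD => //|apply: subringM => //|apply: D0D].
    * by do ![apply: subringD => //|apply: subringM => //|apply: D0D].
    * have -> : (x + t * y) * (x' + t * y') = x * x' + t * (x * y' + y * x') + t * t * (y * y') by ring.
      by rewrite tt; ring.
- by move=> a /D0D Da; exists a, 0; split=> //; [exact: subring0 | rewrite mulr0 addr0].
- move=> t'; rewrite inE => /orP[/eqP ->|/sD Dt].
    by exists 0, 1; split; [exact: subring0 | exact: subring1 | rewrite mulr1 add0r].
  by exists t', 0; split=> //; [exact: subring0 | rewrite mulr0 addr0].
- move=> q; have [B1 hB1] := DB q; have [B2 hB2] := DB (t * q).
  exists (B1 + B2) => _ [x [y [Dx Dy ->]]].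
  rewrite (_ : (x + t * y) * q = x * q + y * (t * q)); last by ring.
  by apply: le_trans (LD _ _) _; apply: lerD; [exact: hB1 | exact: hB2].
Qed.

Variable s : seq A.
Hypothesis fg : forall S : {pred A}, subring_closed S -> {subset s <= S} -> forall a, a \in S.

Lemma adjoin_bounded_all (D0 : A -> Prop) : subring D0 ->
  (forall q, exists B, forall a, D0 a -> L (a * q) <= B) ->
  (forall t, t \in s -> exists u v, [/\ D0 u, D0 v & t * t = u + t * v]) ->
  exists B, forall a, L a <= B.
Proof.
move=> D0S D0B hs; have [D [DS _ sD DB]] := adjoin_bounded D0S D0B hs.
have [B hB] := DB 1; exists B => a; rewrite -[a]mulr1; apply: hB.
have : a \in (fun x => `[< D x >] : bool).
  apply: fg; last by move=> t /sD Dt; apply/asboolP.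
  split; first by apply/asboolP; exact: subring1.
    by move=> x y /asboolP Dx /asboolP Dy; apply/asboolP; exact: subringB.
  by move=> x y /asboolP Dx /asboolP Dy; apply/asboolP; exact: subringM.
by move=> /asboolP.
Qed.

Lemma bounded_of_squares :
  (forall q, exists B, forall p, L (p ^+ 2 * q) <= B) -> exists B, forall a, L a <= B.
Proof.
move=> sqB.
have LB x y : L (x - y) <= L x + L y by rewrite -(LN y); exact: LD.
have twoB q : exists B, forall p, L (2 * p * q) <= B.
  have [B hB] := sqB q; exists (B + B + L q) => p.
  have -> : 2 * p * q = (p + 1) ^+ 2 * q - p ^+ 2 * q - q by ring.
  apply: le_trans (LB _ _) _; rewrite lerD2r; apply: le_trans (LB _ _) _.
  exact: lerD.
(* The set is a subring because squaring is additive modulo 2; each generator t is quadratic over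
   it, as t^2 belongs to it. *)
apply: (@adjoin_bounded_all (fun a => exists x y, a = x ^+ 2 + 2 * y)).
- split.
  + by exists 1, 0; ring.
  + by move=> _ _ [x [y ->]] [x' [y' ->]]; exists (x + x'), (y - y' - x * x' - x' ^+ 2); ring.
  + by move=> _ _ [x [y ->]] [x' [y' ->]]; exists (x * x'), (x ^+ 2 * y' + y * x' ^+ 2 + 2 * y * y'); ring.
- move=> q; have [B1 h1] := sqB q; have [B2 h2] := twoB q.
  exists (B1 + B2) => _ [x [y ->]]; rewrite mulrDl.
  by apply: le_trans (LD _ _) _; exact: lerD.
- move=> t _; exists (t ^+ 2), 0; split; [by exists t, 0; ring | by exists 0, 0; ring | by ring].
Qed.

Record ideal (I : A -> Prop) : Prop := Ideal {
  idealB : forall x y, I x -> I y -> I (x - y);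
  idealM : forall x y, I x -> I (x * y) }.

Lemma bounded_of_idempotents :
  (forall p, exists B, forall q, L ((p ^+ 2 - p) * q) <= B) -> exists B, forall a, L a <= B.
Proof.
move=> idB.
have [I [II I2 Is [B hB]]] : exists I, [/\ ideal I, I 2, forall t, t \in s -> I (t ^+ 2 - t) &
    exists B, forall a, I a -> L a <= B].
  elim: s => [|t s' [I [II I2 Is [B hB]]]].
    exists (fun a => exists b, a = 2 * b); split=> //.
    - split; first by move=> _ _ [x ->] [y ->]; exists (x - y); ring.
      by move=> _ y [x ->]; exists (x * y); ring.
    - by exists 1; ring.
    (* 2 = (-1)^2 - (-1). *)
    - have [B hB] := idB (-1); exists B => _ [b ->].
      by rewrite (_ : 2 * b = ((-1) ^+ 2 - -1) * b); [exact: hB | ring].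
  exists (fun a => exists x b, I x /\ a = x + (t ^+ 2 - t) * b); split.
  - split.
    + move=> _ _ [x [b [Ix ->]]] [y [d [Iy ->]]]; exists (x - y), (b - d).
      by split; [exact: idealB | ring].
    + move=> _ y [x [b [Ix ->]]]; exists (x * y), (b * y).
      by split; [exact: idealM | ring].
  - by exists 2, 0; split=> //; ring.
  - move=> t'; rewrite inE => /orP[/eqP ->|/Is It].
      exists 0, 1; split; last by ring.
      by have := idealB II I2 I2; rewrite subrr.
    by exists (t' ^+ 2 - t'), 0; split=> //; ring.
  - have [B' hB'] := idB t; exists (B + B') => _ [x [b [Ix ->]]].
    by apply: le_trans (LD _ _) _; apply: lerD; [exact: hB | exact: hB'].
have I0 : I 0 by have := idealB II I2 I2; rewrite subrr.
have IN x : I x -> I (- x) by move=> Ix; rewrite -sub0r; exact: idealB.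
have ID x y : I x -> I y -> I (x + y) by move=> Ix Iy; rewrite -[y]opprK; apply: idealB => //; exact: IN.
have IM x y : I x -> I (y * x) by move=> Ix; rewrite mulrC; exact: idealM.
(* [I] together with 1 + [I] is a subring since 2 lies in [I], and t^2 = (t^2 - t) + t is quadratic
   over it. This replaces counting the quotient by [I]. *)
apply: (@adjoin_bounded_all (fun a => I a \/ I (a - 1))).
- split.
  + by right; rewrite subrr.
  + move=> x y [Ix|Ix] [Iy|Iy].
    * by left; exact: idealB.
    * right; rewrite (_ : x - y - 1 = x - (y - 1) - 2); last by ring.
      by apply: idealB => //; exact: idealB.
    * by right; rewrite (_ : x - y - 1 = x - 1 - y); [exact: idealB | ring].
    * by left; rewrite (_ : x - y = x - 1 - (y - 1)); [exact: idealB | ring].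
  + move=> x y [Ix|Ix] [Iy|Iy].
    * by left; exact: idealM.
    * by left; exact: idealM.
    * by left; exact: IM.
    * right; rewrite (_ : x * y - 1 = (x - 1) * y + (y - 1)); last by ring.
      by apply: ID => //; exact: idealM.
- move=> q; exists (B + L q) => a [Ia|Ia].
    by apply: (le_trans (hB _ (idealM II q Ia))); rewrite lerDl; have := LD q (- q); rewrite subrr L0 LN; lra.
  rewrite (_ : a * q = (a - 1) * q + q); last by ring.
  by apply: le_trans (LD _ _) _; rewrite lerD2r; apply: hB; exact: idealM.
- move=> t ts; exists (t ^+ 2 - t), 1; split; [by left; exact: Is | by right; rewrite subrr | ring].
Qed.

End RingBounds.

(** * Structure constants *)

Section StructureConstants.
Variables (K : numFieldType) (V : vectType K) (br : {bilinear V -> V -> V}).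
Hypothesis lie : lie_bracket br.

Lemma brN x y : br x y = - br y x.
Proof.
case: lie => alt _; apply/eqP; rewrite -addr_eq0; apply/eqP.
by have := alt (x + y); rewrite linearDl !linearDr !alt add0r addr0.
Qed.

Lemma br_brr x y z : br x (br y z) = br (br x y) z + br y (br x z).
Proof.
case: lie => _ jac; have := jac x y z; rewrite (brN z (br x y)) (brN z x) linearNr => h.
have {}h : br x (br y z) - br y (br x z) - br (br x y) z = 0 by exact: h.
by rewrite -[LHS]subr0 -[X in _ - X]h; lincomb K ltac:(ring).
Qed.

Lemma br_brl x y z : br (br x y) z = br x (br y z) - br y (br x z).
Proof. by rewrite br_brr addrK. Qed.

Lemma brZl a x y : br (a *: x) y = a *: br x y.
Proof. by rewrite brN linearZr -scalerN -brN. Qed.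

Lemma brZr a x y : br x (a *: y) = a *: br x y.
Proof. exact: linearZr. Qed.

(* A system of root vectors: n alpha beta is the value of the root beta at the
   coroot of alpha. *)
Variables (E : zmodType) (Phi : pred E) (e : E -> V) (n : E -> E -> K).
Hypothesis PhiN : forall a, Phi (- a) = Phi a.
Hypothesis nD : forall a b c, n a (b + c) = n a b + n a c.
Hypothesis n_diag : forall a, Phi a -> n a a = 2.
Let h a := br (e a) (e (- a)).
Hypothesis he : forall a b, Phi a -> Phi b -> br (h a) (e b) = n a b *: e b.
Variable c : E -> E -> K.
Hypothesis ee : forall a b, Phi a -> Phi b -> Phi (a + b) ->
  br (e a) (e b) = c a b *: e (a + b) /\ br (e (- a)) (e (- b)) = - c a b *: e (- a - b).
Hypothesis ee0 : forall a b, Phi a -> Phi b -> ~~ Phi (a + b) -> a + b != 0 -> br (e a) (e b) = 0.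
Hypothesis e_neq0 : forall a, Phi a -> e a != 0.

Lemma nB a b d : n a (b - d) = n a b - n a d.
Proof. by apply/eqP; rewrite eq_sym subr_eq -nD subrK. Qed.

Lemma nMn a b k : n a (b *+ k) = n a b *+ k.
Proof.
elim: k => [|k IHk]; last by rewrite !mulrS nD IHk.
by rewrite !mulr0n; have := nB a 0 0; rewrite !subrr.
Qed.

Section String.
Variables (a b : E) (p : nat).
Hypothesis Pa : Phi a.
Hypothesis string : forall k, (k <= p)%N -> Phi (b + a *+ k).
Hypothesis no_lower : ~~ Phi (b - a).
Hypothesis ba : b != a.
Hypothesis no_upper : ~~ Phi (b + a *+ p.+1).
Hypothesis b_upper : b + a *+ p.+1 != 0.

(** The sl_2 computation, upwards from the bottom [b], which [e (- a)] annihilates. The product of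
    the two structure constants between neighbours of the string is known from the preceding
    step. *)
Lemma string_pairing k : (k <= p)%N ->
  br (e (- a)) (br (e a) (e (b + a *+ k))) = (k.+1%:R * (- n a b - k%:R)) *: e (b + a *+ k).
Proof.
have heN : forall d, Phi d -> br (br (e (- a)) (e a)) (e d) = - n a d *: e d.
  by move=> d Pd; rewrite (brN (e (- a))) linearNl he // scaleNr.
elim: k => [|k IHk] kp.
  have Pb := string (leq0n p); rewrite mulr0n addr0 in Pb *.
  have z : br (e (- a)) (e b) = 0.
    by apply: ee0; rewrite ?PhiN // addrC // subr_eq0.
  by rewrite br_brr heN // z linear0r addr0 subr0 mul1r.
have {}IHk := IHk (ltnW kp).
have Pk := string (ltnW kp); have Pk1 := string kp.
have ak : a + (b + a *+ k) = b + a *+ k.+1 by rewrite addrCA -mulrS.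
have ak' : - a + (b + a *+ k.+1) = b + a *+ k by rewrite -ak addKr.
have [e1 _] : _ /\ _ := ee (a := a) (b := b + a *+ k) Pa Pk ltac:(by rewrite ak).
have [e2 _] : _ /\ _ := ee (a := - a) (b := b + a *+ k.+1) ltac:(by rewrite PhiN) Pk1 ltac:(by rewrite ak').
rewrite ak in e1; rewrite ak' in e2.
set k1 := c _ _ in e1; set k2 := c _ _ in e2.
have k12 : k1 * k2 = k.+1%:R * (- n a b - k%:R).
  move: IHk; rewrite e1 brZr e2 scalerA => /eqP; rewrite -subr_eq0 -scalerBl scaler_eq0.
  by rewrite (negPf (e_neq0 Pk)) orbF subr_eq0 => /eqP.
rewrite br_brr heN // e2 brZr e1 scalerA -scalerDl; congr (_ *: _).
rewrite mulrC k12 nD nMn n_diag // -[k.+2%:R]natr1 -[k.+1%:R]natr1; ring.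
Qed.

(** At the top of the string the bracket in [string_pairing] vanishes, while [p.+1] is invertible in
    characteristic 0. *)
Lemma string_length : n a b = - p%:R.
Proof.
have := string_pairing (leqnn p).
have -> : br (e a) (e (b + a *+ p)) = 0.
  by apply: ee0; rewrite ?string // addrCA -mulrS.
rewrite linear0r => /esym/eqP; rewrite scaler_eq0 (negPf (e_neq0 (string (leqnn p)))) orbF.
rewrite mulf_eq0 pnatr_eq0 /= subr_eq0 => /eqP <-.
by rewrite opprK.
Qed.

End String.

Section Pair.
Variables (a b : E).
Hypothesis Pa : Phi a.
Hypothesis Pb : Phi b.
Hypothesis Pab : Phi (a + b).
Hypothesis nPba : ~~ Phi (b - a).
Hypothesis ba : b != a.
Hypothesis nba : n b a = -1.

Let nPab : ~~ Phi (a - b). Proof. by rewrite -PhiN opprB. Qed.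

Let e1 := (ee Pa Pb Pab).1.
Let e2 := (ee Pa Pb Pab).2.

Let z1 : br (e (- a)) (e b) = 0.
Proof. by apply: ee0; rewrite ?PhiN // addrC // subr_eq0. Qed.

Let z2 : br (e a) (e (- b)) = 0.
Proof. by apply: ee0; rewrite ?PhiN // subr_eq0 eq_sym. Qed.

(** The bracket of [e_a, e_b] with [e_(-a), e_(-b)], computed once from the structure constants and
    once by Jacobi. *)
Lemma coroot_add : c a b ^+ 2 *: h (a + b) = - n a b *: h b + h a.
Proof.
have -> : c a b ^+ 2 *: h (a + b) = - br (br (e a) (e b)) (br (e (- a)) (e (- b))).
  by rewrite e1 e2 brZl brZr scalerA mulrN scaleNr opprK expr2 /h opprD.
rewrite (br_brr (br (e a) (e b))) [br (br (e a) (e b)) (e (- a))]brN (br_brr (e (- a))).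
have -> : br (br (e (- a)) (e a)) (e b) = - n a b *: e b.
  by rewrite (brN (e (- a))) linearNl he // scaleNr.
rewrite z1 linear0r addr0 (br_brl (e a)) z2 linear0r subr0.
have -> : br (e a) (br (e b) (e (- b))) = e a.
  by rewrite brN he // nba scaleN1r opprK.
rewrite linearNl brZl (brN (e (- a))) -/(h a) -/(h b).
by lincomb K ltac:(ring).
Qed.

(** Both sides of [coroot_add] act on [e (a + b)] by scalars; with [n b a = -1] the integer [n a b]
    cancels and 2 = 2 remains. *)
Lemma constant_sqr : c a b ^+ 2 = 1.
Proof.
have h1 : c a b ^+ 2 * n (a + b) (a + b) = - n a b * n b (a + b) + n a (a + b).
  have := congr1 (fun x => br x (e (a + b))) coroot_add.
  rewrite brZl linearDl brZl !he // => /eqP.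
  rewrite !scalerA -scalerDl -subr_eq0 -scalerBl scaler_eq0 (negPf (e_neq0 Pab)) orbF subr_eq0.
  by move/eqP.
move: h1; rewrite n_diag // !nD !n_diag // nba => h1.
apply: (@mulIf _ 2); first by rewrite pnatr_eq0.
rewrite h1; ring.
Qed.

Section Second.
Hypothesis Paab : Phi (a + (a + b)).
Let u := a + b.

(** The computation of [coroot_add] one step higher in the string. The right side equals 4 both for
    [n a b = -2] (type [B_2]) and for [n a b = -3] (type [G_2]). *)
Lemma second_constant_sqr : c a u ^+ 2 = (- n a b *+ 2 - 2) * (4 + n a b).
Proof.
have c2 := constant_sqr.
have c0 : c a b != 0 by apply/eqP => c0; move: c2; rewrite c0 expr0n /= => /eqP; rewrite eq_sym oner_eq0.
have [f1 f2] := ee Pa Pab Paab; rewrite -/u in f1 f2.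
have ua : - a + u = b by rewrite /u addKr.
have [g1 g2] : _ /\ _ := ee (a := - a) (b := u) ltac:(by rewrite PhiN) Pab ltac:(by rewrite ua).
rewrite ua in g1; rewrite opprK (_ : a - u = - b) in g2; last by rewrite -ua opprD opprK.
set d := c (- a) u in g1 g2.
have cd : c a b * d = - n a b.
  have := br_brr (e (- a)) (e a) (e b).
  rewrite e1 brZr g1 scalerA z1 linear0r addr0 (brN (e (- a)) (e a)) linearNl he // -scaleNr.
  move/eqP; rewrite -subr_eq0 -scalerBl scaler_eq0 (negPf (e_neq0 Pb)) orbF subr_eq0.
  by move/eqP.
have fu : br (e u) (e (- b)) = c a b *: e a.
  have -> : e u = c a b *: br (e a) (e b) by rewrite e1 scalerA -expr2 c2 scale1r.
  by rewrite brZl br_brl z2 linear0r subr0 brN he // nba scaleN1r opprK.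
have hu : h u = - n a b *: h b + h a by have := coroot_add; rewrite c2 scale1r.
have eah : br (e a) (h u) = - (2 + n a b) *: e a.
  rewrite hu linearDr brZr [br _ (h b)]brN [br _ (h a)]brN !he // nba n_diag //.
  by lincomb K ltac:(ring).
have k1 : br (e (- a)) (br (e a) (e u)) = - (n a b *+ 2 + 2) *: e u.
  rewrite br_brr g1 brZr e1 scalerA (mulrC d) cd (brN (e (- a)) (e a)) linearNl he // /u nD n_diag //.
  by lincomb K ltac:(ring).
have main : c a u ^+ 2 *: h (a + u) = (- n a b *+ 2 - 2) *: h u + (- n a b *+ 2 - 2) *: h a.
  have -> : c a u ^+ 2 *: h (a + u) = - br (br (e a) (e u)) (br (e (- a)) (e (- u))).
    by rewrite f1 f2 brZl brZr scalerA mulrN scaleNr opprK expr2 /h opprD.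
  rewrite (br_brr (br (e a) (e u))) [br (br (e a) (e u)) (e (- a))]brN k1.
  rewrite (br_brl (e a)) g2 brZr fu -/(h u) eah.
  have -> : br (e (- a)) (- (2 + n a b) *: e a - - d *: (c a b *: e a)) = (2 + n a b + n a b) *: h a.
    have -> : - (2 + n a b) *: e a - - d *: (c a b *: e a) = - (2 + n a b + n a b) *: e a.
      by rewrite scalerA mulNr (mulrC d) cd; lincomb K ltac:(ring).
    by rewrite brZr (brN (e (- a))) scaleNr scalerN opprK.
  rewrite linearNl brZl -/(h u).
  by lincomb K ltac:(ring).
have h1 : c a u ^+ 2 * n (a + u) (a + u) = (- n a b *+ 2 - 2) * n u (a + u) + (- n a b *+ 2 - 2) * n a (a + u).
  have := congr1 (fun x => br x (e (a + u))) main.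
  rewrite brZl linearDl !brZl !he // => /eqP.
  rewrite !scalerA -scalerDl -subr_eq0 -scalerBl scaler_eq0 (negPf (e_neq0 Paab)) orbF subr_eq0.
  by move/eqP.
have nu d' : Phi d' -> n u d' = - n a b * n b d' + n a d'.
  move=> Pd; have := congr1 (fun x => br x (e d')) hu.
  rewrite linearDl brZl !he // => /eqP.
  rewrite !scalerA -scalerDl -subr_eq0 -scalerBl scaler_eq0 (negPf (e_neq0 Pd)) orbF subr_eq0.
  by move/eqP.
apply: (@mulIf _ 2); first by rewrite pnatr_eq0.
move: h1; rewrite n_diag // nu // /u !nD !n_diag // nba => ->.
ring.
Qed.

End Second.
End Pair.
End StructureConstants.

(** * Exponentials of nilpotent endomorphisms *)

Section NilpotentExponential.
Import passmx.
Variables (K : numFieldType) (V : vectType K).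

Lemma limn_eventually_constant (n : nat) (u : nat -> 'M[K]_n) (l : 'M[K]_n) N :
  (forall k, (N <= k)%N -> u k = l) -> limn u = l.
Proof.
move=> hu; apply: cvg_lim; first exact: norm_hausdorff.
by apply: cvg_near_cst; exists N.
Qed.

Lemma exp_end_nilpotent (f : 'End(V)) N v : (forall w, iter N f w = 0) ->
  exp_end f v = \sum_(k < N) (k`!%:R)^-1 *: iter k f v.
Proof.
move=> hN; pose b := vbasis {:V}.
have bb : basis_of fullv b by exact: vbasisP.
pose M := passmx.mxof b b f.
have rM k w : passmx.rVof b w *m M ^+ k = passmx.rVof b (iter k f w).
  elim: k w => [|k IHk] w; first by rewrite expr0 mulmx1.
  by rewrite exprSr mulmxA IHk -(@passmx.rVof_app _ _ _ b b bb).
have M0 k : (N <= k)%N -> M ^+ k = 0.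
  move=> Nk; apply/row_matrixP => i; rewrite row0 rowE.
  have := rM k (passmx.vecof b (delta_mx 0 i)); rewrite passmx.vecofK // => ->.
  have -> : iter k f (passmx.vecof b (delta_mx 0 i)) = 0.
    rewrite -(subnK Nk) iterD hN; elim: (k - N)%N => //= j ->; exact: linear0.
  by rewrite linear0.
have e1 : expmx M = \sum_(k < N) (k`!%:R)^-1 *: M ^+ k.
  apply: (@limn_eventually_constant _ _ _ N) => k Nk.
  rewrite /series /= -(big_mkord xpredT (fun k => (k`!%:R)^-1 *: M ^+ k)) (big_cat_nat _ Nk) //=.
  rewrite -[RHS]addr0 big_mkord; congr (_ + _).
  by rewrite big_nat_cond big1 // => j /andP[/andP[Nj _] _]; rewrite M0 ?scaler0.
rewrite /exp_end -/b -/M passmx.hommxE // e1 mulmx_sumr linear_sum; apply: eq_bigr => k _.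
by rewrite -scalemxAr linearZ /= rM passmx.rVofK.
Qed.

Lemma iter_linear_scale (f : {linear V -> V}) (s : K) k v :
  iter k (fun w => s *: f w) v = s ^+ k *: iter k f v.
Proof.
by elim: k v => [|k IHk] v; rewrite ?expr0 ?scale1r //= IHk linearZ scalerA exprS.
Qed.

(** exp f commutes with f and is the identity on the kernel of f. If exp f kills w, the last nonzero
    f^j w would be both fixed and killed by it. *)
Lemma exp_end_injective (f : 'End(V)) N : (forall w, iter N f w = 0) -> lker (exp_end f) = 0%VS.
Proof.
move=> hN; apply/eqP; apply/lker0P => u v /eqP; rewrite -subr_eq0 -linearB => /eqP.
set w := u - v; move=> h; apply/eqP; rewrite -subr_eq0 -/w; apply/eqP.
suff H k : (k <= N)%N -> iter (N - k) f w = 0 by have := H N (leqnn N); rewrite subnn.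
elim: k => [|k IHk] kN; first by rewrite subn0.
have {}IHk := IHk (ltnW kN).
have il j x : iter j f (exp_end f x) = exp_end f (iter j f x).
  rewrite !(exp_end_nilpotent _ hN).
  have -> : iter j f (\sum_(k < N) (k`!%:R)^-1 *: iter k f x) = \sum_(k < N) (k`!%:R)^-1 *: iter j f (iter k f x).
    elim: j => [//|j IHj] /=; rewrite IHj linear_sum; apply: eq_bigr => i _.
    by rewrite linearZ.
  by apply: eq_bigr => i _; rewrite -!iterD addnC.
have := il (N - k.+1)%N w; rewrite h.
have -> : iter (N - k.+1) f 0 = 0 by elim: (N - k.+1)%N => //= j ->; exact: linear0.
move/esym; rewrite (exp_end_nilpotent _ hN).
have N0 : (0 < N)%N by lia.
case: N N0 hN h kN IHk {il} => // N' _ hN h kN IHk.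
rewrite big_ord_recl fact0 invr1 scale1r big1 ?addr0 => [h0|i _]; first exact: h0.
rewrite -iterD; have -> : (lift ord0 i + (N'.+1 - k.+1) = i + (N'.+1 - k))%N.
  by rewrite lift0 addSnnS; congr (_ + _)%N; move: kN; clear; lia.
rewrite iterD IHk.
have -> : iter i f 0 = 0 by elim: (nat_of_ord i) => //= j ->; exact: linear0.
by rewrite scaler0.
Qed.

End NilpotentExponential.

(** * Polynomial jets *)

Section Jets.
Import passmx.
Variables (K : numFieldType) (V : vectType K).
Implicit Types (F : K -> V).

Definition polyfun F := exists n (c : nat -> V), forall s, F s = \sum_(k < n) s ^+ k *: c k.

Lemma polyfun_cst v : polyfun (fun=> v).
Proof. by exists 1%N, (fun=> v) => s; rewrite big_ord1 expr0 scale1r. Qed.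

Lemma polyfun_add F1 F2 : polyfun F1 -> polyfun F2 -> polyfun (fun s => F1 s + F2 s).
Proof.
move=> [n1 [c1 h1]] [n2 [c2 h2]].
pose ext n (c : nat -> V) k := if (k < n)%N then c k else 0.
have hext n (c : nat -> V) (s : K) m : (n <= m)%N -> \sum_(k < n) s ^+ k *: c k = \sum_(k < m) s ^+ k *: ext n c k.
  move=> nm; rewrite (big_ord_widen m (fun k => s ^+ k *: c k) nm) big_mkcond.
  by apply: eq_bigr => k _; rewrite /ext; case: ifP => //; rewrite scaler0.
exists (maxn n1 n2), (fun k => ext n1 c1 k + ext n2 c2 k) => s.
rewrite h1 h2 (hext n1 c1 s _ (leq_maxl n1 n2)) (hext n2 c2 s _ (leq_maxr n1 n2)) -big_split.
by apply: eq_bigr => k _; rewrite scalerDr.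
Qed.

Lemma polyfun_sum I (r : seq I) (P : pred I) (F : I -> K -> V) :
  (forall i, polyfun (F i)) -> polyfun (fun s => \sum_(i <- r | P i) F i s).
Proof.
move=> hF; elim: r => [|i r IHr].
  by have [n [c h]] := polyfun_cst 0; exists n, c => s; rewrite big_nil -h.
case: (boolP (P i)) => Pi.
  have [n [c h]] := polyfun_add (hF i) IHr; exists n, c => s.
  by rewrite big_cons Pi -h.
by have [n [c h]] := IHr; exists n, c => s; rewrite big_cons (negPf Pi) -h.
Qed.

Lemma polyfun_linear (f : {linear V -> V}) F : polyfun F -> polyfun (fun s => f (F s)).
Proof.
move=> [n [c h]]; exists n, (f \o c) => s; rewrite h linear_sum.
by apply: eq_bigr => k _; rewrite linearZ.
Qed.

Lemma polyfun_iter (f : {linear V -> V}) F j : polyfun F -> polyfun (fun s => iter j f (F s)).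
Proof. by move=> hF; elim: j => [//|j IHj] /=; exact: polyfun_linear. Qed.

Lemma polyfun_scale a F : polyfun F -> polyfun (fun s => a *: F s).
Proof.
move=> [n [c h]]; exists n, (fun k => a *: c k) => s; rewrite h scaler_sumr.
by apply: eq_bigr => k _; rewrite !scalerA mulrC.
Qed.

Lemma polyfun_pow m F : polyfun F -> polyfun (fun s => s ^+ m *: F s).
Proof.
move=> [n [c h]]; exists (m + n)%N, (fun k => if (k < m)%N then 0 else c (k - m)%N) => s.
rewrite h big_split_ord /= [X in _ = X + _]big1 ?add0r => [|k _]; last by rewrite /= ltn_ord scaler0.
rewrite scaler_sumr; apply: eq_bigr => k _.
by rewrite ltnNge leq_addr /= addKn scalerA exprD.
Qed.

(** In coordinates, a polynomial of size at most n vanishing at 0, ..., n-1, which are distinct in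
    characteristic 0. *)
Lemma polyfun_eq0 n (c : nat -> V) : (forall s : K, \sum_(k < n) s ^+ k *: c k = 0) ->
  forall k, (k < n)%N -> c k = 0.
Proof.
move=> h k kn; apply: (can_inj (@passmx.rVofK _ _ (vbasis {:V}) (vbasisP {:V}))).
rewrite linear0; apply/rowP => i; rewrite [RHS]mxE.
pose p := \poly_(j < n) passmx.rVof (vbasis {:V}) (c j) 0 i.
suff p0 : p = 0 by have := congr1 (fun q : {poly K} => q`_k) p0; rewrite coef_poly kn coef0.
apply: (@roots_geq_poly_eq0 _ _ [seq j%:R | j <- iota 0 n]).
- apply/allP => _ /mapP[j _ ->]; rewrite /root horner_poly.
  have := congr1 (fun v => passmx.rVof (vbasis {:V}) v 0 i) (h j%:R).
  rewrite linear_sum linear0 summxE mxE => e; apply/eqP; rewrite -[RHS]e.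
  by apply: eq_bigr => l _; rewrite linearZ !mxE mulrC.
- rewrite map_inj_uniq ?iota_uniq // => j1 j2 /eqP.
  by rewrite eqr_nat => /eqP.
- by rewrite size_map size_iota size_poly.
Qed.

(** A Taylor expansion at 0 with polynomial remainder: its coefficients are unique by algebra
    alone. *)
Definition jet1 F c0 c1 := exists2 G, polyfun G & forall s, F s = c0 + s *: c1 + s ^+ 2 *: G s.

Definition jet2 F c0 c1 c2 := exists2 G, polyfun G &
  forall s, F s = c0 + s *: c1 + s ^+ 2 *: c2 + s ^+ 3 *: G s.

Lemma jet2_unique F c0 c1 c2 d0 d1 d2 : jet2 F c0 c1 c2 -> jet2 F d0 d1 d2 ->
  [/\ c0 = d0, c1 = d1 & c2 = d2].
Proof.
move=> [G hG h] [G' hG' h'].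
have [n [c hc]] := polyfun_add hG (polyfun_scale (-1) hG').
pose c' k := nth (c (k - 3)%N) [:: c0 - d0; c1 - d1; c2 - d2] k.
have z s : \sum_(k < 3 + n) s ^+ k *: c' k = 0.
  rewrite big_split_ord /= !big_ord_recl big_ord0 /= expr0 expr1.
  have -> : \sum_(i < n) s ^+ (3 + i) *: c' (3 + i)%N = s ^+ 3 *: (G s + -1 *: G' s).
    rewrite hc scaler_sumr; apply: eq_bigr => i _.
    by rewrite scalerA -exprD /c' nth_default ?addKn.
  have := h' s; rewrite h => e; apply/eqP; rewrite /c' /=.
  rewrite -[X in _ == X](subrr (d0 + s *: d1 + s ^+ 2 *: d2 + s ^+ 3 *: G' s)) -[X in _ == X - _]e.
  by apply/eqP; lincomb K ltac:(ring).
have := polyfun_eq0 z => /(_ _ _) z'.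
by split; apply/eqP; rewrite -subr_eq0; apply/eqP; [apply: (z' 0%N)|apply: (z' 1%N)|apply: (z' 2%N)]; lia.
Qed.

Lemma jet1_unique F c0 c1 d0 d1 : jet1 F c0 c1 -> jet1 F d0 d1 -> c0 = d0 /\ c1 = d1.
Proof.
have up a0 a1 : jet1 F a0 a1 -> jet2 (fun s => s *: F s) 0 a0 a1.
  by move=> [G hG h]; exists G => // s; rewrite h; lincomb K ltac:(ring).
by move=> /up h /up h'; have [] := jet2_unique h h'.
Qed.

Lemma jet1_linear (f : {linear V -> V}) F c0 c1 : jet1 F c0 c1 -> jet1 (f \o F) (f c0) (f c1).
Proof.
move=> [G hG h]; exists (f \o G) => [|s /=]; first exact: polyfun_linear.
by rewrite h !linearD !linearZ.
Qed.

Lemma jet2_linear (f : {linear V -> V}) F c0 c1 c2 :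
  jet2 F c0 c1 c2 -> jet2 (f \o F) (f c0) (f c1) (f c2).
Proof.
move=> [G hG h]; exists (f \o G) => [|s /=]; first exact: polyfun_linear.
by rewrite h !linearD !linearZ.
Qed.

Variable N : nat.

(** With [N.+3] terms the orders 0, 1 and 2 can be split off for every N. *)
Definition expo_sum (f : V -> V) (t : K) v := \sum_(k < N.+3) (t ^+ k / k`!%:R) *: iter k f v.

Lemma expo_sumE (f : V -> V) t v : expo_sum f t v = v + t *: f v + (t ^+ 2 / 2) *: f (f v) +
  t ^+ 3 *: \sum_(k < N) (t ^+ k / (k + 3)`!%:R) *: iter (k + 3) f v.
Proof.
rewrite /expo_sum !big_ord_recl /= /bump /= fact0 !expr0 invr1 mulr1 scale1r.
rewrite !addn0 mulr1 expr1 (_ : (1 + 1)`!%:R = 2%:R :> K) // !addrA.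
congr (_ + _); rewrite scaler_sumr; apply: eq_bigr => k _.
by rewrite !add1n addn3 scalerA mulrA -exprD add3n.
Qed.

Lemma polyfun_expo_tail (f : {linear V -> V}) F a j (m : nat) : polyfun F ->
  polyfun (fun s => \sum_(k < N) ((a * s ^+ j) ^+ k / (k + m)`!%:R) *: iter (k + m) f (F s)).
Proof.
move=> hF; apply: polyfun_sum => k.
have [n [c h]] := polyfun_pow (j * k)%N (polyfun_scale (a ^+ k / (k + m)`!%:R) (polyfun_iter f (k + m) hF)).
by exists n, c => s; rewrite -h scalerA exprMn -exprM mulrAC mulrA mulrC -!mulrA; congr (_ *: _).
Qed.

Lemma jet1_expo (f : {linear V -> V}) F c0 c1 a j : jet1 F c0 c1 -> (0 < j)%N ->
  jet1 (fun s => expo_sum f (a * s ^+ j) (F s)) c0 (c1 + (if j == 1%N then a else 0) *: f c0).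
Proof.
move=> [G hG h] j0.
have hF : polyfun F.
  have [n [c hc]] := polyfun_add (polyfun_add (polyfun_cst c0) (polyfun_pow 1 (polyfun_cst c1))) (polyfun_pow 2 hG).
  by exists n, c => s; rewrite h -hc expr1.
set T := fun s => \sum_(k < N) ((a * s ^+ j) ^+ k / (k + 3)`!%:R) *: iter (k + 3) f (F s).
have hT : polyfun T by exact: polyfun_expo_tail.
have hfF := polyfun_linear f hF; have hffF := polyfun_linear f hfF.
case: eqP => [j1|jn1].
  exists (fun s => G s + a *: f c1 + s ^+ 1 *: (a *: f (G s)) + (a ^+ 2 / 2) *: f (f (F s)) + s ^+ 1 *: (a ^+ 3 *: T s)).
    by do ![apply: polyfun_add|apply: polyfun_cst|apply: polyfun_pow|apply: polyfun_scale|apply: polyfun_linear|exact: hG|exact: hF|exact: hT].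
  move=> s; rewrite expo_sumE -/(T s) j1 expr1 {1 2}h !linearD !linearZ /=.
  by lincomb K ltac:(field).
exists (fun s => G s + s ^+ (j - 2) *: (a *: f (F s)) + s ^+ (j + j - 2) *: ((a ^+ 2 / 2) *: f (f (F s))) + s ^+ (j + j + j - 2) *: (a ^+ 3 *: T s)).
  by do ![apply: polyfun_add|apply: polyfun_cst|apply: polyfun_pow|apply: polyfun_scale|apply: polyfun_linear|exact: hG|exact: hF|exact: hT].
move=> s; rewrite expo_sumE -/(T s) {1}h scale0r addr0.
have -> : s ^+ j = s ^+ 2 * s ^+ (j - 2) by rewrite -exprD; congr (_ ^+ _); lia.
have -> : s ^+ (j + j - 2) = s ^+ 2 * s ^+ (j - 2) * s ^+ (j - 2) by rewrite -!exprD; congr (_ ^+ _); lia.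
have -> : s ^+ (j + j + j - 2) = (s ^+ 2 * s ^+ (j - 2)) ^+ 2 * s ^+ (j - 2) by rewrite -!exprD -exprM -exprD; congr (_ ^+ _); lia.
by lincomb K ltac:(field).
Qed.

Lemma jet2_expo (f : {linear V -> V}) F c0 c1 c2 : jet2 F c0 c1 c2 ->
  jet2 (fun s => expo_sum f s (F s)) c0 (c1 + f c0) (c2 + f c1 + 2^-1 *: f (f c0)).
Proof.
move=> [G hG h].
have hF : polyfun F.
  have [n [c hc]] := polyfun_add (polyfun_add (polyfun_add (polyfun_cst c0) (polyfun_pow 1 (polyfun_cst c1)))
     (polyfun_pow 2 (polyfun_cst c2))) (polyfun_pow 3 hG).
  by exists n, c => s; rewrite h -hc expr1.
set T := fun s => \sum_(k < N) ((1 * s ^+ 1) ^+ k / (k + 3)`!%:R) *: iter (k + 3) f (F s).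
have hT : polyfun T by exact: polyfun_expo_tail.
exists (fun s => G s + f c2 + s ^+ 1 *: f (G s) + 2^-1 *: f (f c1) + s ^+ 1 *: (2^-1 *: f (f c2)) +
   s ^+ 2 *: (2^-1 *: f (f (G s))) + T s).
  by do ![apply: polyfun_add|apply: polyfun_cst|apply: polyfun_pow|apply: polyfun_scale|apply: polyfun_linear|exact: hG|exact: hF|exact: hT].
move=> s; rewrite expo_sumE.
have -> : \sum_(k < N) (s ^+ k / (k + 3)`!%:R) *: iter (k + 3) f (F s) = T s.
  by apply: eq_bigr => k _; rewrite mul1r expr1.
rewrite {1 2 3}h !(linearD, linearZ) /=.
by lincomb K ltac:(field).
Qed.

End Jets.

Lemma jet2_add (K : numFieldType) (V : vectType K) (F F' : K -> V) c0 c1 c2 d0 d1 d2 :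
  jet2 F c0 c1 c2 -> jet2 F' d0 d1 d2 ->
  jet2 (fun s => F s + F' s) (c0 + d0) (c1 + d1) (c2 + d2).
Proof.
move=> [G hG h] [G' hG' h']; exists (fun s => G s + G' s); first exact: polyfun_add.
by move=> s; rewrite h h'; lincomb K ltac:(ring).
Qed.

Lemma jet2_pow (K : numFieldType) (V : vectType K) (w : V) i : (0 < i)%N ->
  jet2 (fun s => s ^+ i *: w) 0 (if i == 1%N then w else 0) (if i == 2%N then w else 0).
Proof.
case: i => [//|[|[|i]]] _ /=.
- by exists (fun=> 0) => [|s]; [exact: polyfun_cst | rewrite expr1; lincomb K ltac:(ring)].
- by exists (fun=> 0) => [|s]; [exact: polyfun_cst | lincomb K ltac:(ring)].
- exists (fun s => s ^+ i *: w) => [|s]; first exact/polyfun_pow/polyfun_cst.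
  by rewrite !scaler0 !add0r scalerA -exprD.
Qed.

Lemma jet2_ext (K : numFieldType) (V : vectType K) (F F' : K -> V) c0 c1 c2 :
  F =1 F' -> jet2 F c0 c1 c2 -> jet2 F' c0 c1 c2.
Proof. by move=> FF' [G hG h]; exists G => // s; rewrite -FF'. Qed.

(** * The commutator formula to low order *)

Section CommutatorConstants.
Variables (K : numFieldType) (V : vectType K) (br : {bilinear V -> V -> V}).
Hypothesis lie : lie_bracket br.
Variables (E : zmodType) (e : E -> V) (N : nat).
Variables (C : nat -> nat -> int) (a b : E) (s : seq (nat * nat)).
Let y g t v := expo_sum N (br (e g)) t v.
Hypothesis s_uniq : uniq s.
Hypothesis s_gt0 : forall i j, (i, j) \in s -> (0 < i)%N /\ (0 < j)%N.
Hypothesis commE : forall s1 s2 v, y a s1 (y b s2 v) =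
  y b s2 (y a s1 (foldr (fun ij w =>
    y (a *+ ij.1 + b *+ ij.2) ((C ij.1 ij.2)%:~R * s1 ^+ ij.1 * s2 ^+ ij.2) w) v s)).

Let y_linear g t : linear (y g t).
Proof.
move=> k u v; rewrite /y /expo_sum scaler_sumr -big_split; apply: eq_bigr => i _ /=.
have -> : iter i (br (e g)) (k *: u + v) = k *: iter i (br (e g)) u + iter i (br (e g)) v.
  by elim: (nat_of_ord i) => //= j ->; rewrite linearP.
by rewrite scalerDr !scalerA mulrC.
Qed.

Let yL g t : {linear V -> V} :=
  HB.pack (y g t) (GRing.isLinear.Build K V V *:%R (y g t) (y_linear g t)).

Let D i j := br (e (a *+ i + b *+ j)).

(* The coefficient of s2 in commE. *)
Lemma first_order s1 v : y a s1 (br (e b) v) =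
  y a s1 (\sum_(ij <- s) (if ij.2 == 1%N then (C ij.1 ij.2)%:~R * s1 ^+ ij.1 else 0) *: D ij.1 ij.2 v) +
  br (e b) (y a s1 v).
Proof.
set S := \sum_(ij <- s) _.
have jv : jet1 (fun _ : K => v) v 0.
  by exists (fun=> 0) => [|t]; [exact: polyfun_cst | rewrite !scaler0 !addr0].
have j1 : jet1 (fun t => y a s1 (y b t v)) (y a s1 v) (y a s1 (br (e b) v)).
  have := jet1_expo N (br (e b)) 1 jv (isT : (0 < 1)%N); rewrite /= add0r scale1r.
  move=> /(jet1_linear (yL a s1)) [G hG h]; exists G => // t; rewrite -h /=.
  by rewrite mul1r expr1.
have j2 : jet1 (fun t => foldr (fun ij w =>
    y (a *+ ij.1 + b *+ ij.2) ((C ij.1 ij.2)%:~R * s1 ^+ ij.1 * t ^+ ij.2) w) v s) v S.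
  rewrite /S; elim: s s_gt0 => [_|[i j] s' IHs sgt]; first by rewrite big_nil.
  rewrite big_cons addrC /=; apply: jet1_expo; last by have [] := sgt i j (mem_head _ _).
  by apply: IHs => i' j' ij; apply: sgt; rewrite inE ij orbT.
have := jet1_expo N (br (e b)) 1 (jet1_linear (yL a s1) j2) (isT : (0 < 1)%N).
rewrite /= scale1r => -[G hG h].
have j3 : jet1 (fun t => y a s1 (y b t v)) (y a s1 v) (y a s1 S + br (e b) (y a s1 v)).
  by exists G => // t; rewrite commE -h mul1r expr1.
by have [_ ->] := jet1_unique j1 j3.
Qed.

(* The coefficients of s1 and s1^2 in first_order. *)
Lemma second_order v : (1%N, 1%N) \in s ->
  br (e a) (br (e b) v) = (C 1 1)%:~R *: D 1 1 v + br (e b) (br (e a) v) /\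
  ((2%N, 1%N) \in s ->
   2^-1 *: br (e a) (br (e a) (br (e b) v)) =
   (C 2 1)%:~R *: D 2 1 v + (C 1 1)%:~R *: br (e a) (D 1 1 v) +
   2^-1 *: br (e b) (br (e a) (br (e a) v))).
Proof.
move=> s11.
have jc (w : V) : jet2 (fun _ : K => w) w 0 0.
  by exists (fun=> 0) => [|t]; [exact: polyfun_cst | rewrite !scaler0 !addr0].
have jexp w : jet2 (fun t => y a t w) w (br (e a) w) (2^-1 *: br (e a) (br (e a) w)).
  by have := jet2_expo N (br (e a)) (jc w); rewrite !linear0 !add0r.
have jS : jet2 (fun t => \sum_(ij <- s) (if ij.2 == 1%N then (C ij.1 ij.2)%:~R * t ^+ ij.1 else 0) *: D ij.1 ij.2 v)
   0 (\sum_(ij <- s) (if ij == (1, 1)%N then (C 1 1)%:~R *: D 1 1 v else 0))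
   (\sum_(ij <- s) (if ij == (2, 1)%N then (C 2 1)%:~R *: D 2 1 v else 0)).
  elim: s s_gt0 => [_|[i j] s' IHs sgt].
    by rewrite !big_nil; apply: jet2_ext (jc 0) => t; rewrite big_nil.
  rewrite !big_cons -[X in jet2 _ X _ _](addr0 0).
  apply: (@jet2_ext _ _ (fun t => (if j == 1%N then t ^+ i *: ((C i j)%:~R *: D i j v) else 0) +
    \sum_(ij <- s') (if ij.2 == 1%N then (C ij.1 ij.2)%:~R * t ^+ ij.1 else 0) *: D ij.1 ij.2 v)).
    by move=> t; rewrite big_cons /=; case: eqP => _; rewrite ?scale0r // scalerA mulrC.
  apply: jet2_add; last by apply: IHs => i' j' ij; apply: sgt; rewrite inE ij orbT.
  rewrite !xpair_eqE; case: eqP => [->|_]; last by rewrite !andbF; exact: jc.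
  rewrite !andbT; have [i0 _] := sgt i j (mem_head _ _).
  have := jet2_pow ((C i 1)%:~R *: D i 1 v) i0.
  by case: eqP => [->|] //; case: eqP => [->|].
have pick (q : nat * nat) (w : V) : q \in s -> \sum_(ij <- s) (if ij == q then w else 0) = w.
  by move=> qs; rewrite (bigD1_seq q) //= eqxx big1 ?addr0 // => i /negPf ->.
rewrite (pick (1, 1)%N) // in jS.
have jR := jet2_add (jet2_expo N (br (e a)) jS) (jet2_linear (br (e b)) (jexp v)).
have jR' := @jet2_ext _ _ _ (fun t => y a t (br (e b) v)) _ _ _ (fun t => esym (first_order t v)) jR.
have [_ e1 e2] := jet2_unique (jexp (br (e b) v)) jR'.
move: e1 e2; rewrite !linear0 ?scaler0 ?addr0 => e1 e2; split=> [|s21]; first exact: e1.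
by rewrite e2 pick // !linearZ.
Qed.

Variables c11 c21 : K.
Variables h1 h2 : V.

(** In order s1 s2 the formula says that the operators satisfy [ad e_a, ad e_b] = C11 ad e_(a+b);
    [h1] witnesses that the latter is nonzero. *)
Lemma commutator_constant11 : (1%N, 1%N) \in s -> br (e a) (e b) = c11 *: e (a + b) ->
  br (e (a + b)) h1 != 0 -> (C 1 1)%:~R = c11.
Proof.
move=> s11 e11 nz; have [+ _] := second_order h1 s11.
rewrite br_brr // e11 brZl // /D !mulr1n => /addIr /eqP.
by rewrite -subr_eq0 -scalerBl scaler_eq0 (negPf nz) orbF subr_eq0 => /eqP.
Qed.

Lemma commutator_constant21 : (1%N, 1%N) \in s -> (2%N, 1%N) \in s ->
  br (e a) (e b) = c11 *: e (a + b) -> br (e a) (e (a + b)) = c21 *: e (a + (a + b)) ->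
  br (e (a + b)) h1 != 0 -> br (e (a + (a + b))) h2 != 0 ->
  (C 2 1)%:~R = - (c11 * c21 / 2).
Proof.
move=> s11 s21 e11 e21 nz1 nz2; have C11 := commutator_constant11 s11 e11 nz1.
have [_ /(_ s21)] := second_order h2 s11.
have AB w : br (e a) (br (e b) w) = c11 *: br (e (a + b)) w + br (e b) (br (e a) w).
  by rewrite br_brr // e11 brZl.
have AD w : br (e a) (br (e (a + b)) w) = c21 *: br (e (a + (a + b))) w + br (e (a + b)) (br (e a) w).
  by rewrite br_brr // e21 brZl.
rewrite /D !mulr1n (mulr2n a) -(addrA a) C11 AB linearDr brZr // AB AD.
set X := br _ h2; set Y := br (e (a + b)) (br (e a) h2); set Z := br (e b) _ => h.
have {}h : ((C 2 1)%:~R + c11 * c21 / 2) *: X = 0.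
  have : 2^-1 *: (c11 *: (c21 *: X + Y) + (c11 *: Y + Z)) - 
    ((C 2 1)%:~R *: X + c11 *: (c21 *: X + Y) + 2^-1 *: Z) = 0 by rewrite h subrr.
  by move=> h'; apply: oppr_inj; rewrite oppr0 -h'; lincomb K ltac:(field).
by move/eqP: h; rewrite scaler_eq0 (negPf nz2) orbF addr_eq0 => /eqP.
Qed.

End CommutatorConstants.

(** A trivial kernel makes [f^-1] a genuine inverse. With the inverses multiplied out, both sides of
    the commutator formula become polynomial in the parameters. *)
Lemma commutator_endE (K : fieldType) (V : vectType K) (f g : 'End(V)) v :
  lker f == 0%VS -> lker g == 0%VS -> g (f (commutator_end f g v)) = f (g v).
Proof.
move=> f0 g0; rewrite /commutator_end.
have -> : (f^-1 \o (g^-1 \o (f \o g)))%VF v = f^-1%VF (g^-1%VF (f (g v))) by rewrite !comp_lfunE.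
by rewrite (lker0_lfunVK f0) (lker0_lfunVK g0).
Qed.

(** * Root vectors of a Chevalley basis *)

Section RootVectors.
Variables (R : realType) (E : vectType R) (Phi : {fset E}).
Variables (V : vectType R[i]) (br : {bilinear V -> V -> V}) (H : {vspace V}).
Variables (rho : E -> 'Hom(subvs_of H, R[i]^o)) (Delta : seq E) (e : E -> V).
Hypothesis Phi0 : 0 \notin Phi.
Hypothesis PhiN : forall a, (- a \in Phi) = (a \in Phi).
Hypothesis lie : lie_bracket br.
Hypothesis type : lie_type Phi br rho.
Hypothesis chev : chevalley_basis Phi br rho Delta e.

Let rhoD u v : rho (u + v) = rho u + rho v.
Proof. by have [h _ _] := type; have := h 1 u v; rewrite !scale1r. Qed.

Let rho_inj : injective rho. Proof. by have [_ h _] := type. Qed.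

Let rho0 : rho 0 = 0.
Proof. by apply: (addrI (rho 0)); rewrite -rhoD !addr0. Qed.

Lemma root_space_eq0 g x : g \notin Phi -> g != 0 -> lie_root_space br (rho g) x -> x = 0.
Proof.
move=> gP g0 hx; apply/eqP/negPn/negP => x0; move/negP: gP; apply.
have [_ _ h] := type; have [|d dP /rho_inj -> //] := (h (rho g)).1.
split; last by exists x.
by rewrite -rho0 (inj_eq rho_inj).
Qed.

Lemma root_space_br g d x z : lie_root_space br (rho g) x -> lie_root_space br (rho d) z ->
  lie_root_space br (rho (g + d)) (br x z).
Proof.
move=> hx hz h; rewrite br_brr // hx hz brZl // brZr // -scalerDl; congr (_ *: _).
by rewrite rhoD lfunE.
Qed.

Lemma root_space_e g : g \in Phi -> lie_root_space br (rho g) (e g).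
Proof. by have [_ h _ _ _] := chev => /h. Qed.

Lemma root_vector_neq0 g : g \in Phi -> e g != 0.
Proof.
move=> gP; have [_ _ _ _ /basis_free/free_not0 nz] := chev.
apply: nz; rewrite mem_cat; apply/orP; right; exact: map_f.
Qed.

Lemma coroot_exists : exists h : E -> subvs_of H, forall g, g \in Phi ->
  vsval (h g) = br (e g) (e (- g)) /\ rho g (h g) = 2.
Proof.
have [_ _ hh _ _] := chev.
have /choice[h hP] : forall g, exists h : subvs_of H, g \in Phi ->
    vsval h = br (e g) (e (- g)) /\ rho g h = 2.
  move=> g; case: (boolP (g \in Phi)) => [gP|_]; last by exists 0.
  by have [h h1 h2] := hh g gP; exists h.
by exists h.
Qed.

(** Pigeonhole: [#|Phi| + 2] distinct vectors do not fit into [Phi] together with 0. *)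
Lemma string_leaves g d : g \in Phi -> exists2 k, (k < (#|` Phi|).+2)%N &
  d + g *+ k \notin Phi /\ d + g *+ k != 0.
Proof.
move=> gP.
have g0 : g != 0 by apply: contraNneq Phi0 => <-.
apply/not_exists2P => hk.
have sub : {subset [seq d + g *+ k | k <- iota 0 (#|` Phi|).+2] <= 0 :: enum_fset Phi}.
  move=> _ /mapP[k + ->]; rewrite mem_iota add0n => /andP[_ kn].
  have [/(_ kn) []//|] := hk k; rewrite inE; case: eqP => //= _ nz.
  by apply/negPn/negP => z; apply: nz.
have u : uniq [seq d + g *+ k | k <- iota 0 (#|` Phi|).+2].
  rewrite map_inj_in_uniq ?iota_uniq // => i j _ _ /addrI /eqP.
  rewrite -(scaler_nat i g) -(scaler_nat j g) -subr_eq0 -scalerBl scaler_eq0 (negPf g0) orbF subr_eq0 eqr_nat.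
  by move/eqP.
by have := uniq_leq_size u sub; rewrite size_map size_iota ltnn.
Qed.

Lemma ad_root_vector_nilpotent g w : g \in Phi -> iter (#|` Phi|).+2 (br (e g)) w = 0.
Proof.
move=> gP; have [h hP] := coroot_exists.
set n := (#|` Phi|).+2.
have it0 k : iter k (br (e g)) 0 = 0 by elim: k => //= k ->; rewrite linear0.
have itD k u v : iter k (br (e g)) (u + v) = iter k (br (e g)) u + iter k (br (e g)) v.
  by elim: k => //= k ->; rewrite linearD.
have itZ k a u : iter k (br (e g)) (a *: u) = a *: iter k (br (e g)) u.
  by elim: k => //= k ->; rewrite linearZ.
have [[Dsub _ _] _ _ _ bas] := chev.
set X := _ ++ _ in bas.
have onX x : x \in X -> iter n (br (e g)) x = 0.
  rewrite mem_cat => /orP[] /mapP[d dP ->{x}].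
    have dPhi := Dsub d dP.
    (* On a coroot two brackets suffice: the first gives a multiple of [e g], which the second
       kills. *)
    have -> : n = (#|` Phi| + 2)%N by rewrite addn2.
    rewrite iterD /= -[br (e d) _](hP d dPhi).1 (brN lie (e g) (vsval _)) root_space_e //.
    by rewrite -scaleNr brZr (lie.1 (e g)) scaler0 it0.
  have [k kn [kP k0]] := string_leaves d gP.
  have hw j : lie_root_space br (rho (d + g *+ j)) (iter j (br (e g)) (e d)).
    elim: j => [|j IHj]; first by rewrite mulr0n addr0; exact: root_space_e.
    by rewrite mulrS addrCA /=; apply: root_space_br => //; exact: root_space_e.
  have -> : n = (n - k + k)%N by rewrite subnK // ltnW.
  by rewrite iterD (root_space_eq0 kP k0 (hw k)) it0.
have : w \in <<X>>%VS by rewrite (span_basis bas) memvf.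
rewrite (_ : X = in_tuple X) // => /coord_span ->.
elim/big_rec: _ => [|i u _ IHu]; first by rewrite it0.
by rewrite itD itZ onX ?IHu ?scaler0 ?addr0 // mem_nth.
Qed.

Lemma root_automorphismE g t v : g \in Phi ->
  root_automorphism br e g t v = expo_sum (#|` Phi|) (br (e g)) t v.
Proof.
move=> gP; rewrite /root_automorphism.
have il k u : iter k (t *: linfun (br (e g))) u = t ^+ k *: iter k (br (e g)) u.
  rewrite -iter_linear_scale; elim: k => //= k ->.
  by rewrite !lfunE /= lfunE.
rewrite (@exp_end_nilpotent _ _ _ (#|` Phi|).+3).
  by apply: eq_bigr => k _; rewrite il scalerA mulrC.
by move=> w; rewrite il iterS (ad_root_vector_nilpotent w gP) linear0 scaler0.
Qed.

Lemma root_automorphism_lker g t : g \in Phi -> lker (root_automorphism br e g t) = 0%VS.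
Proof.
move=> gP; apply: (@exp_end_injective _ _ _ (#|` Phi|).+2) => w.
have il k u : iter k (t *: linfun (br (e g))) u = t ^+ k *: iter k (br (e g)) u.
  rewrite -iter_linear_scale; elim: k => //= k ->.
  by rewrite !lfunE /= lfunE.
by rewrite il ad_root_vector_nilpotent // scaler0.
Qed.

End RootVectors.

(** * Signs of the Chevalley constants *)

Section ChevalleyConstants.
Variables (R : realType) (E : vectType R) (Phi : {fset E}).
Variable C : E -> E -> nat -> nat -> int.
Hypothesis Phi0 : 0 \notin Phi.
Hypothesis PhiN : forall a, (- a \in Phi) = (a \in Phi).
Hypothesis CP : chevalley_constants Phi C.
Variables (a b : E) (s : seq (nat * nat)).
Hypotheses (aP : a \in Phi) (bP : b \in Phi) (abP : a + b \in Phi).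
Hypotheses (baP : b - a \notin Phi) (abbP : a + b *+ 2 \notin Phi).
Hypotheses (ba : b != a) (bNa : b != - a) (abb : a + b *+ 2 != 0).
Hypothesis sP : commutator_pairs Phi a b s.

Let sqr_pm1 (K : numFieldType) (z : int) (x : K) : z%:~R = x -> x ^+ 2 = 1 -> z ^+ 2 = 1.
Proof. by move=> <- h; apply/eqP; rewrite -(eqr_int K) rmorphXn /= h. Qed.

Let s11 : (1%N, 1%N) \in s.
Proof. by have [_ _ ->] := sP; rewrite !mulr1n abP. Qed.

(** C11 is the structure constant c11 of e_a, e_b, and C21 is -c11 c21 / 2 with c21 that of e_a,
    e_(a+b); the squares of c11 and c21 are 1 and 4. The number p is the length of the a-string
    through b: 2 in [B_2], 3 in [G_2]. *)
Lemma chevalley_constants_sqr :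
  C a b 1 1 ^+ 2 = 1 /\
  (forall p, a *+ 2 + b \in Phi -> (p == 2%N) || (p == 3%N) ->
    (forall k, (k <= p)%N -> b + a *+ k \in Phi) ->
    b + a *+ p.+1 \notin Phi -> b + a *+ p.+1 != 0 -> C a b 2 1 ^+ 2 = 1).
Proof.
have [V [br [H [rho [Delta [e [/= [lie _ _] _ type chev comm]]]]]]] := CP.
have PN : forall x, (mem Phi) (- x) = (mem Phi) x by move=> x; exact: PhiN.
have [h hP] := coroot_exists chev.
pose n x z : R[i] := rho z (h x).
have rhoD u v : rho (u + v) = rho u + rho v.
  by have [r _ _] := type; have := r 1 u v; rewrite !scale1r.
have nD x u v : n x (u + v) = n x u + n x v by rewrite /n rhoD lfunE.
have nd x : mem Phi x -> n x x = 2 by move=> /hP[].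
have he x z : mem Phi x -> mem Phi z -> br (br (e x) (e (- x))) (e z) = n x z *: e z.
  by move=> /hP[<- _] zP; rewrite (root_space_e chev zP).
have [c ee] : exists c : E -> E -> R[i], forall x z, mem Phi x -> mem Phi z -> mem Phi (x + z) ->
    br (e x) (e z) = c x z *: e (x + z) /\ br (e (- x)) (e (- z)) = - c x z *: e (- x - z).
  have [_ _ _ hc _] := chev.
  have /choice[c cP] : forall x : E * E, exists c : R[i], mem Phi x.1 -> mem Phi x.2 -> mem Phi (x.1 + x.2) ->
    br (e x.1) (e x.2) = c *: e (x.1 + x.2) /\ br (e (- x.1)) (e (- x.2)) = - c *: e (- x.1 - x.2).
    move=> x; case: (pselect [/\ mem Phi x.1, mem Phi x.2 & mem Phi (x.1 + x.2)]).
      by move=> [x1 x2 x12]; have [c hc'] := hc _ _ x1 x2 x12; exists c.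
    by move=> nx; exists 0 => x1 x2 x12; case: nx.
  by exists (fun x z => c (x, z)) => x z; exact: (cP (x, z)).
have ee0 x z : mem Phi x -> mem Phi z -> ~~ mem Phi (x + z) -> x + z != 0 -> br (e x) (e z) = 0.
  move=> xP zP xzP xz; apply: (root_space_eq0 type xzP xz).
  by apply: (root_space_br lie type); exact: (root_space_e chev).
have e0 x : mem Phi x -> e x != 0 by exact: root_vector_neq0 chev _.
(* The coroot of x is the vector on which [ad (e x)] is seen to be nonzero. *)
have e_coroot x : x \in Phi -> br (e x) (br (e x) (e (- x))) != 0.
  move=> xP; rewrite (brN lie) he // nd // oppr_eq0 scaler_eq0 negb_or e0 // andbT.
  by rewrite pnatr_eq0.
have ab0 : a - b \notin Phi by rewrite -PhiN opprB.
(* The b-string through a consists of a and a + b only. *)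
have nba : n b a = -1.
  rewrite (@string_length _ _ _ lie _ (mem Phi) e n PN nD nd he c ee ee0 e0 b a 1) //.
  - by move=> [|[|]] // _; rewrite ?mulr0n ?mulr1n ?addr0.
  - by rewrite eq_sym.
have c2 : c a b ^+ 2 = 1.
  by apply: (@constant_sqr _ _ _ lie _ (mem Phi) e n PN nD nd he c ee ee0 e0).
have [s_u s_s sE] := sP.
have yE g t v : g \in Phi -> root_automorphism br e g t v = expo_sum (#|` Phi|) (br (e g)) t v.
  by move=> gP; exact: (root_automorphismE Phi0 lie type chev).
have y0 g t : g \in Phi -> lker (root_automorphism br e g t) == 0%VS.
  by move=> gP; apply/eqP; exact: (root_automorphism_lker Phi0 lie type chev).
have s_gt0 i j : (i, j) \in s -> (0 < i)%N /\ (0 < j)%N.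
  by rewrite sE => /and3P[].
pose prd s1 s2 (s' : seq (nat * nat)) v := foldr (fun ij w =>
    expo_sum (#|` Phi|) (br (e (a *+ ij.1 + b *+ ij.2))) ((C a b ij.1 ij.2)%:~R * s1 ^+ ij.1 * s2 ^+ ij.2) w) v s'.
have prdE s1 s2 s' v : {subset s' <= s} -> (\big[(@comp_lfun _ _ _ _) / \1%VF]_(ij <- s')
     root_automorphism br e (a *+ ij.1 + b *+ ij.2) ((C a b ij.1 ij.2)%:~R * s1 ^+ ij.1 * s2 ^+ ij.2)) v = prd s1 s2 s' v.
  elim: s' v => [|[i j] s' IHs] v ss; first by rewrite big_nil lfunE.
  rewrite big_cons lfunE /= yE ?IHs //.
    by move=> x xs; apply: ss; rewrite inE xs orbT.
  by have := ss (i, j) (mem_head _ _); rewrite sE => /and3P[].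
have commE s1 s2 v : expo_sum (#|` Phi|) (br (e a)) s1 (expo_sum (#|` Phi|) (br (e b)) s2 v) =
    expo_sum (#|` Phi|) (br (e b)) s2 (expo_sum (#|` Phi|) (br (e a)) s1 (prd s1 s2 s v)).
  rewrite -prdE // -comm // -!yE //; apply/esym.
  by apply: commutator_endE; exact: y0.
have [e11 _] := ee a b aP bP abP.
have C11 := commutator_constant11 lie s_u s_gt0 commE s11 e11 (e_coroot _ abP).
split=> [|p aabP p23 strP upP up0]; first exact: sqr_pm1 C11 c2.
have aabP' : a + (a + b) \in Phi by rewrite addrA -mulr2n.
have [e21 _] := ee a (a + b) aP abP aabP'.
have s21 : (2%N, 1%N) \in s by rewrite sE /= mulr1n.
have C21 := commutator_constant21 lie s_u s_gt0 commE s11 s21 e11 e21 (e_coroot _ abP) (e_coroot _ aabP').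
have nab : n a b = - p%:R.
  by apply: (@string_length _ _ _ lie _ (mem Phi) e n PN nD nd he c ee ee0 e0).
have c3 := @second_constant_sqr _ _ _ lie _ (mem Phi) e n PN nD nd he c ee ee0 e0 a b aP bP abP baP ba nba aabP'.
apply: sqr_pm1 C21 _; rewrite sqrrN !exprMn c2 c3 nab.
by case/orP: p23 => /eqP ->; field.
Qed.

End ChevalleyConstants.

(** * Root combinatorics *)

Lemma int_sqr_le4 (i : int) : i * i <= 4 -> i \in [:: -2; -1; 0; 1; 2].
Proof.
move=> h; have : -2 <= i <= 2 by move: h; clear; nia.
by rewrite !inE; clear; lia.
Qed.

(** The form is the squared length of i b + j g relative to b, for b and g of equal length at 120
    degrees. Norm 3 gives the long roots of a [G_2], norm 1 the roots of the [A_2]. *)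
Lemma eisenstein_norm3 (i j : int) : i * i + j * j - i * j = 3 ->
  (i, j) \in [:: (1, 2); (2, 1); (1, -1); (-1, -2); (-2, -1); (-1, 1)].
Proof.
move=> h.
have /int_sqr_le4 : j * j <= 4.
  by have := sqr_ge0 (2 * i - j); rewrite expr2; move: h; clear; nia.
have /int_sqr_le4 : i * i <= 4.
  by have := sqr_ge0 (2 * j - i); rewrite expr2; move: h; clear; nia.
move: h; rewrite !inE => h /or4P[/eqP i1|/eqP i1|/eqP i1|/orP[/eqP i1|/eqP i1]];
  rewrite i1 in h *; move=> /or4P[/eqP j1|/eqP j1|/eqP j1|/orP[/eqP j1|/eqP j1]]; rewrite j1 in h *; by [].
Qed.

Lemma eisenstein_norm1 (i j : int) : i * i + j * j - i * j = 1 ->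
  (i, j) \in [:: (1, 0); (0, 1); (1, 1); (-1, 0); (0, -1); (-1, -1)].
Proof.
move=> h.
have /int_sqr_le4 : j * j <= 4.
  by have := sqr_ge0 (2 * i - j); rewrite expr2; move: h; clear; nia.
have /int_sqr_le4 : i * i <= 4.
  by have := sqr_ge0 (2 * j - i); rewrite expr2; move: h; clear; nia.
move: h; rewrite !inE => h /or4P[/eqP i1|/eqP i1|/eqP i1|/orP[/eqP i1|/eqP i1]];
  rewrite i1 in h *; move=> /or4P[/eqP j1|/eqP j1|/eqP j1|/orP[/eqP j1|/eqP j1]]; rewrite j1 in h *; by [].
Qed.

(** a and b are the doubled coordinates of a root in a frame, m and m' the pairings of the frame
    vectors with it. Adding the squares of the equations gives (m^2 + m'^2)(a^2 + b^2) = 16, so few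
    cases remain. *)
Lemma frame_integers (a b c m m' : int) : a + b = 2 * c ->
  4 * a = m * (a * a + b * b) -> 4 * b = m' * (a * a + b * b) -> 0 < a * a + b * b ->
  [|| (a \in [:: -2; 0; 2]) && (b \in [:: -2; 0; 2]), (a \in [:: -1; 1]) && (b \in [:: -1; 1]),
      (a \in [:: -4; 4]) && (b == 0) | (a == 0) && (b \in [:: -4; 4])].
Proof.
move=> hab h1 h2 N0.
have h3 : (m * m + m' * m') * (a * a + b * b) = 16.
  apply: (@mulIf _ (a * a + b * b)); first by rewrite gt_eqF.
  have -> : (m * m + m' * m') * (a * a + b * b) * (a * a + b * b) = 4 * a * (4 * a) + 4 * b * (4 * b).
    by rewrite h1 h2; ring.
  by ring.
have K0 : 0 < m * m + m' * m' by rewrite -(pmulr_lgt0 _ N0) h3.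
have N16 : a * a + b * b <= 16.
  by move: h3 N0 K0; move: (m * m + m' * m') (a * a + b * b) => K N; clear; nia.
have ha : -4 <= a <= 4 by move: N16; clear; nia.
have hb : -4 <= b <= 4 by move: N16; clear; nia.
have ca : [|| a == -4, a == -3, a == -2, a == -1 | [|| a == 0, a == 1, a == 2, a == 3 | a == 4]].
  by move: ha; clear; lia.
have cb : [|| b == -4, b == -3, b == -2, b == -1 | [|| b == 0, b == 1, b == 2, b == 3 | b == 4]].
  by move: hb; clear; lia.
clear h3 ha hb; move: hab h1 h2 N0 N16; rewrite !inE.
by case/or4P: ca => [/eqP->|/eqP->|/eqP->|/orP[/eqP->|/or4P[/eqP->|/eqP->|/eqP->|/orP[]/eqP->]]];
  case/or4P: cb => [/eqP->|/eqP->|/eqP->|/orP[/eqP->|/or4P[/eqP->|/eqP->|/eqP->|/orP[]/eqP->]]] => //; clear; lia.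
Qed.

(** x is the squared norm of a root orthogonal neither to a short root of squared norm n nor to a
    long one of squared norm 2n. *)
Lemma norm_ratio_double (R : realType) (n x : R) : 0 < n ->
  [\/ n = x, n = 2 * x | n = 3 * x] \/ (x = 2 * n \/ x = 3 * n) ->
  [\/ 2 * n = x, 2 * n = 2 * x | 2 * n = 3 * x] \/ (x = 2 * (2 * n) \/ x = 3 * (2 * n)) ->
  x = n \/ x = 2 * n.
Proof.
move=> n0 [[]|[]] h1 [[]|[]] h2; by [left; lra | right; lra | exfalso; lra].
Qed.

Section HalfIntegers.
Variables (R : realType) (z : int).

Lemma half_mem : z \in [:: -2; 0; 2] -> (z%:~R / 2 : R) \in [:: -1; 0; 1].
Proof.
by rewrite !inE => /or3P[] /eqP ->; apply/or3P; [constructor 1|constructor 2|constructor 3];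
  apply/eqP; lra.
Qed.

Lemma half_unit : z \in [:: -1; 1] -> (2 * (z%:~R / 2) == 1 :> R) || (2 * (z%:~R / 2) == -1 :> R).
Proof. by rewrite !inE => /orP[] /eqP ->; apply/orP; [right|left]; apply/eqP; lra. Qed.

Lemma half_not_unit : z \in [:: -4; 4] -> ~ (z%:~R / 2 = 1 :> R \/ z%:~R / 2 = -1 :> R).
Proof. by rewrite !inE => /orP[] /eqP -> []; lra. Qed.

End HalfIntegers.

(** * Pairs of roots and rank two subsystems *)

Section RootGeometry.
Variables (R : realType) (E : vectType R) (Phi : {fset E}) (ip : {dot E for idfun}).
Implicit Types (a b g u v w d : E).
Hypothesis PhiR : root_system Phi.
Hypothesis crystal : {in Phi &, forall alpha beta,
  let c := 2 * ip alpha beta / ip beta beta in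
  c \is a Num.int /\ alpha - c *: beta \in Phi}.
Hypothesis red : reduced_root_system Phi.

Lemma ipC a b : ip a b = ip b a.
Proof. by rewrite [LHS]hermitian_subproof expr0 mul1r. Qed.

Lemma ipDl a b g : ip (a + b) g = ip a g + ip b g. Proof. exact: linearDl. Qed.
Lemma ipZl t a b : ip (t *: a) b = t * ip a b. Proof. exact: linearZl_LR. Qed.
Lemma ipNl a b : ip (- a) b = - ip a b. Proof. exact: linearNl. Qed.
Lemma ipDr a b g : ip a (b + g) = ip a b + ip a g. Proof. by rewrite ipC ipDl !(ipC a). Qed.
Lemma ipZr t a b : ip a (t *: b) = t * ip a b. Proof. by rewrite ipC ipZl ipC. Qed.
Lemma ipNr a b : ip a (- b) = - ip a b. Proof. by rewrite ipC ipNl ipC. Qed.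

Definition ipE := (ipDl, ipDr, ipNl, ipNr, ipZl, ipZr).

Lemma ip_gt0 a : a != 0 -> 0 < ip a a. Proof. exact: neq0_dnorm_gt0. Qed.

Lemma ip_eq0 a : (ip a a == 0) = (a == 0).
Proof.
apply/eqP/eqP => [h|->]; last by have := ipZl 0 0 0; rewrite scale0r mul0r.
by apply/eqP/negPn/negP => /ip_gt0; rewrite h ltxx.
Qed.

Lemma root_neq0 a : a \in Phi -> a != 0.
Proof. by move=> aP; have [_ _ n0 _] := PhiR; apply: contraNneq n0 => <-. Qed.

Lemma root_gt0 a : a \in Phi -> 0 < ip a a.
Proof. by move=> /root_neq0 /ip_gt0. Qed.

Lemma rootN a : (- a \in Phi) = (a \in Phi).
Proof. by have [_ _ _] := PhiR. Qed.

Lemma pairing_int a b : a \in Phi -> b \in Phi -> exists m : int, 2 * ip a b = m%:~R * ip b b.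
Proof.
move=> aP bP; have [/intrP[m mE] _] := crystal aP bP; exists m.
by rewrite -mE divfK // gt_eqF // root_gt0.
Qed.

Lemma root_reflect a b c : a \in Phi -> b \in Phi -> 2 * ip a b = c * ip b b -> a - c *: b \in Phi.
Proof.
move=> aP bP h; have [_] := crystal aP bP.
by rewrite h mulfK // gt_eqF // root_gt0.
Qed.

Lemma root_scale a t : a \in Phi -> t *: a \in Phi -> t = 1 \/ t = -1.
Proof.
move=> aP taP; have a0 := root_neq0 aP.
have := red (L := <[a]>%VS); rewrite dim_vline a0 => /(_ erefl) card2.
have [/eqP t1|t1] := boolP (t == 1); first by left.
have [/eqP t2|t2] := boolP (t == -1); first by right.
have sub : {subset [:: a; - a; t *: a] <= [fset x in Phi | x \in <[a]>%VS]%fset}.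
  move=> x; rewrite !inE /= => /or3P[] /eqP ->; rewrite ?rootN ?aP ?taP /=.
  - exact: memv_line.
  - by rewrite memvN memv_line.
  - by rewrite memvZ // memv_line.
have : uniq [:: a; - a; t *: a].
  rewrite /= !inE andbT negb_or; apply/andP; split; first (apply/andP; split).
  - by rewrite -subr_eq0 opprK -mulr2n -scaler_nat scaler_eq0 (negPf a0) orbF pnatr_eq0.
  - by rewrite -subr_eq0 -[X in X - _]scale1r -scalerBl scaler_eq0 (negPf a0) orbF subr_eq0 eq_sym.
  - by rewrite -subr_eq0 -[X in X - _]scaleN1r -scalerBl scaler_eq0 (negPf a0) orbF subr_eq0 eq_sym.
by move=> /uniq_leq_size /(_ sub) /=; rewrite leqNgt ltnS card2.
Qed.

(** The Cartan integers satisfy 0 < m m' < 4, strictly on the right because proportional roots are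
    opposite or equal; the smaller one in absolute value is then 1 or -1. *)
Lemma norm_ratio a b : a \in Phi -> b \in Phi -> ip a b != 0 -> b != a -> b != - a ->
  ip b b <= ip a a ->
  exists2 k : R, [\/ k = 1, k = 2 | k = 3] &
    ip a a = k * ip b b /\ (2 * ip a b = ip a a \/ 2 * ip a b = - ip a a).
Proof.
move=> aP bP ab0 nba nbNa le.
have [m hm] := pairing_int aP bP; have [m' hm'] := pairing_int bP aP.
have a0 := root_gt0 aP; have b0 := root_gt0 bP.
have cs : ip a b ^+ 2 < ip a a * ip b b.
  have v0 : ip b b *: a - ip a b *: b != 0.
    rewrite subr_eq0; apply/negP => /eqP h.
    have : b = (ip b b / ip a b) *: a by rewrite mulrC -scalerA h scalerA mulVf // scale1r.
    move=> hb; have := bP; rewrite {1}hb => /(root_scale aP)[] h1; rewrite h1 ?scale1r ?scaleN1r in hb.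
      by rewrite {1}hb eqxx in nba.
    by rewrite {1}hb eqxx in nbNa.
  have := ip_gt0 v0; rewrite !ipE (ipC b a) => h.
  have {}h : 0 < ip b b * (ip a a * ip b b - ip a b ^+ 2).
    by apply: (lt_le_trans h); rewrite le_eqVlt; apply/orP; left; apply/eqP; ring.
  by rewrite -subr_gt0 -(pmulr_rgt0 _ b0).
have mm : 0 < m * m' < 4.
  have e4 : 4 * ip a b ^+ 2 = (m * m')%:~R * (ip a a * ip b b).
    rewrite rmorphM /= (_ : 4 * _ = (2 * ip a b) * (2 * ip b a)); last by rewrite (ipC b a); ring.
    by rewrite hm hm'; ring.
  have p0 : 0 < ip a a * ip b b by exact: mulr_gt0.
  have q0 : 0 < ip a b ^+ 2 by rewrite exprn_even_gt0.
  rewrite -(ltr_int R) -(ltr_int R 0) -(pmulr_lgt0 _ p0) -e4 -(ltr_pM2r p0) -e4; apply/andP; split; lra.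
have hmm : m%:~R * ip b b = m'%:~R * ip a a by rewrite -hm -hm' ipC.
have [m'0|m'0] : 0 < m' \/ m' < 0.
  by case: (ltgtP m' 0) mm => [||->]; [right|left|rewrite mulr0 ltxx].
  have mm' : m' <= m.
    rewrite -(ler_int R) -(ler_pM2r b0) hmm ler_pM2l ?ltr0z //.
  have [m1 m3] : m' = 1 /\ [\/ m = 1, m = 2 | m = 3].
    have m1 : m' = 1 by case/andP: mm => _; move: mm' m'0; clear; nia.
    split=> //; have : m = 1 \/ m = 2 \/ m = 3 by move: mm mm'; rewrite m1; clear; lia.
    by case=> [|[]] h; [constructor 1|constructor 2|constructor 3].
  exists m%:~R; first by case: m3 => ->; [constructor 1|constructor 2|constructor 3].
  by rewrite hmm m1 mul1r; split=> //; left; rewrite hm hmm m1 mul1r.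
have mm' : m <= m'.
  by rewrite -(ler_int R) -(ler_pM2r b0) hmm ler_nM2l ?ltrz0.
have [m1 m3] : m' = -1 /\ [\/ m = -1, m = -2 | m = -3].
  have m1 : m' = -1 by case/andP: mm => _; move: mm' m'0; clear; nia.
  split=> //; have : m = -1 \/ m = -2 \/ m = -3 by move: mm mm'; rewrite m1; clear; lia.
  by case=> [|[]] h; [constructor 1|constructor 2|constructor 3].
exists (- m%:~R); first by case: m3 => ->; rewrite -rmorphN opprK; [constructor 1|constructor 2|constructor 3].
have -> : ip a a = - m%:~R * ip b b by rewrite mulNr hmm m1 mulN1r opprK.
by split=> //; right; rewrite hm mulNr opprK.
Qed.

Definition a2pair b g := [/\ b \in Phi, g \in Phi, ip g g = ip b b & 2 * ip b g = - ip b b].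

(* The condition on b - g excludes the short roots of a G_2. *)
Definition good_pair b g := a2pair b g /\ b - g \notin Phi.

Definition good a := exists b g, good_pair b g /\ a = b + g.

Lemma a2pair_sym b g : a2pair b g -> a2pair g b.
Proof. by move=> [bP gP e1 e2]; split=> //; rewrite (ipC g b) e2 e1. Qed.

Lemma a2pair_add b g : a2pair b g -> b + g \in Phi.
Proof.
move=> [bP gP e1 e2]; have := root_reflect (c := -1) bP gP.
by rewrite scaleN1r opprK; apply; rewrite e1 e2 mulN1r.
Qed.

(** Rotation of the hexagon by 60 degrees: three steps give the opposite pair, six the original
    one. *)
Lemma a2pair_rot b g : a2pair b g -> a2pair (b + g) (- b).
Proof.
move=> h; have [bP gP e1 e2] := h; split; rewrite ?rootN ?a2pair_add // !ipE ?(ipC g b); lra.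
Qed.

(** The reflection in [b] maps each of the two vectors to the negative of the other. *)
Lemma a2pair_sub b g : a2pair b g -> (b + b + g \in Phi) = (b - g \in Phi).
Proof.
move=> [bP gP e1 e2]; apply/idP/idP => h.
  have := root_reflect (c := 3) h bP; rewrite !ipE (ipC g b).
  move=> /(_ _); rewrite -rootN.
  have -> : - (b + b + g - 3 *: b) = b - g by lincomb R ltac:(lra).
  by apply; lra.
have := root_reflect (c := 3) h bP; rewrite !ipE (ipC g b) -rootN.
have -> : - (b - g - 3 *: b) = b + b + g by lincomb R ltac:(lra).
by apply; lra.
Qed.

(** Let N be the norm of (i, j). The Cartan integers of [b] and [g] against the root satisfy (m^2 +
    m'^2 + m m') N = 3, so N divides 3. *)
Lemma a2pair_lattice b g (i j : int) : a2pair b g -> b *~ i + g *~ j \in Phi ->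
  (i * i + j * j - i * j == 1) || (i * i + j * j - i * j == 3).
Proof.
move=> [bP gP e1 e2]; rewrite -(scaler_int i b) -(scaler_int j g) => dP.
have b0 := root_gt0 bP.
have [m hm] := pairing_int bP dP; have [m' hm'] := pairing_int gP dP.
move: hm hm'; rewrite !ipE (ipC g b) e1.
set I := i%:~R; set J := j%:~R => hm hm'.
have ipbg : ip b g = - ip b b / 2 by lra.
rewrite ipbg in hm hm'.
have hm1 : 2 * i - j = m * (i * i + j * j - i * j).
  apply/eqP; rewrite -(eqr_int R) !(rmorphB, rmorphM, rmorphD) /= -/I -/J; apply/eqP.
  by apply: (@mulIf _ (ip b b)); [rewrite gt_eqF|lra].
have hm2 : 2 * j - i = m' * (i * i + j * j - i * j).
  apply/eqP; rewrite -(eqr_int R) !(rmorphB, rmorphM, rmorphD) /= -/I -/J; apply/eqP.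
  by apply: (@mulIf _ (ip b b)); [rewrite gt_eqF|lra].
have N0 : 0 < i * i + j * j - i * j.
  have := root_gt0 dP; rewrite !ipE (ipC g b) e1 ipbg => h.
  rewrite -(ltr_int R) !(rmorphB, rmorphM, rmorphD) /= -/I -/J -(pmulr_lgt0 _ b0).
  by lra.
move: hm1 hm2 N0; set N := i * i + j * j - i * j => hm1 hm2 N0.
have h3 : (m * m + m' * m' + m * m') * N = 3.
  apply: (@mulIf _ N); first by rewrite gt_eqF.
  have -> : (m * m + m' * m' + m * m') * N * N = (2 * i - j) * (2 * i - j) +
    (2 * j - i) * (2 * j - i) + (2 * i - j) * (2 * j - i) by rewrite hm1 hm2; ring.
  by rewrite /N; ring.
have d3 : (`|N| %| 3)%N.
  have h4 : absz ((m * m + m' * m' + m * m') * N) = 3%N by rewrite h3.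
  by rewrite -h4 abszM dvdn_mull.
move: N0 d3; clearbody N; clear; case: N => // n n0; rewrite absz_nat.
move=> d3; have := dvdn_leq (isT : (0 < 3)%N) d3.
by case: n n0 d3 => [|[|[|[|]]]].
Qed.

Lemma good_pair_lattice b g (i j : int) : good_pair b g -> b *~ i + g *~ j \in Phi ->
  i * i + j * j - i * j = 1.
Proof.
move=> [h ns] dP; have := a2pair_lattice h dP => /orP[/eqP -> //|/eqP N3].
have [bP gP e1 e2] := h.
have ns1 : b + b + g \notin Phi by rewrite a2pair_sub.
have ns2 : g + g + b \notin Phi.
  by rewrite (a2pair_sub (a2pair_sym h)) -rootN opprB.
move: dP; rewrite -(scaler_int i b) -(scaler_int j g).
move: (eisenstein_norm3 N3); rewrite !inE => /or4P[|||/or3P[||]] /eqP[-> ->].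
- by rewrite (_ : _ + _ = g + g + b) ?(negPf ns2) //; lincomb R ltac:(lra).
- by rewrite (_ : _ + _ = b + b + g) ?(negPf ns1) //; lincomb R ltac:(lra).
- by rewrite (_ : _ + _ = b - g) ?(negPf ns) //; lincomb R ltac:(lra).
- by rewrite (_ : _ + _ = - (g + g + b)) ?rootN ?(negPf ns2) //; lincomb R ltac:(lra).
- by rewrite (_ : _ + _ = - (b + b + g)) ?rootN ?(negPf ns1) //; lincomb R ltac:(lra).
- by rewrite (_ : _ + _ = - (b - g)) ?rootN ?(negPf ns) //; lincomb R ltac:(lra).
Qed.

Lemma good_pair_rot b g : good_pair b g -> good_pair (b + g) (- b).
Proof.
move=> [h ns]; split; first exact: a2pair_rot.
by rewrite opprK addrAC a2pair_sub.
Qed.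

Lemma good_opp a : good a -> good (- a).
Proof.
move=> [b [g [/good_pair_rot/good_pair_rot/good_pair_rot h ->]]].
exists (- b), (- g); split; last by rewrite opprD.
have e1 : b + g - b + - (b + g) = - b by lincomb R ltac:(lra).
have e2 : - (b + g - b) = - g by lincomb R ltac:(lra).
by rewrite e1 e2 in h.
Qed.

Definition reflect v d : E := v - (2 * ip v d / ip d d) *: d.

Lemma reflectD u v d : reflect (u + v) d = reflect u d + reflect v d.
Proof. by rewrite /reflect !ipE; lincomb R ltac:(ring). Qed.

Lemma reflectN v d : reflect (- v) d = - reflect v d.
Proof. by rewrite /reflect !ipE; lincomb R ltac:(ring). Qed.

Lemma reflect_ip u v d : d \in Phi -> ip (reflect u d) (reflect v d) = ip u v.
Proof.
move=> /root_gt0 d0; rewrite /reflect !ipE (ipC d v); field.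
by rewrite gt_eqF.
Qed.

Lemma reflect_root v d : v \in Phi -> d \in Phi -> reflect v d \in Phi.
Proof. by move=> vP dP; have [_] := crystal vP dP. Qed.

Lemma reflectK v d : d \in Phi -> reflect (reflect v d) d = v.
Proof.
move=> /root_gt0 d0; rewrite {1}/reflect.
have -> : 2 * ip (reflect v d) d / ip d d = - (2 * ip v d / ip d d).
  by rewrite /reflect !ipE; field; rewrite gt_eqF.
by rewrite /reflect; lincomb R ltac:(ring).
Qed.

Lemma good_reflect a d : d \in Phi -> good a -> good (reflect a d).
Proof.
move=> dP [b [g [[[bP gP e1 e2] ns] ->]]].
exists (reflect b d), (reflect g d); split; last exact: reflectD.
split; first by split; rewrite ?reflect_ip // reflect_root.
apply: contra ns => /reflect_root /(_ dP).
by rewrite -reflectN -reflectD reflectK.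
Qed.

Lemma reflectE v d c : d \in Phi -> 2 * ip v d = c * ip d d -> reflect v d = v - c *: d.
Proof. by move=> /root_gt0 d0 h; rewrite /reflect h mulfK // gt_eqF. Qed.

Lemma multiple_notin a k : a \in Phi -> 1 < k -> k *: a \notin Phi.
Proof. by move=> aP k1; apply/negP => /(root_scale aP)[] h; move: k1; rewrite h; lra. Qed.

(** The long roots of a [G_2] form an [A_2] in which the difference of a pair is three times a root,
    hence no root. *)
Lemma g2_long_good b g : a2pair b g -> b - g \in Phi ->
  [/\ good (g - b), good (b + b + g) & good (g + g + b)].
Proof.
move=> h dP; have [bP gP e1 e2] := h.
have bbgP : b + b + g \in Phi by rewrite a2pair_sub.
have ggbP : g + g + b \in Phi by rewrite (a2pair_sub (a2pair_sym h)) -rootN opprB.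
split.
- exists (g + g + b), (- (b + b + g)); split; last by lincomb R ltac:(lra).
  split; first by split; rewrite ?rootN // !ipE ?(ipC g b); lra.
  by rewrite (_ : _ - _ = 3%:R *: (b + g)) ?multiple_notin ?a2pair_add //; [lra|lincomb R ltac:(lra)].
- exists (g + g + b), (b - g); split; last by lincomb R ltac:(lra).
  split; first by split=> //; rewrite !ipE ?(ipC g b); lra.
  by rewrite (_ : _ - _ = 3%:R *: g) ?multiple_notin //; [lra|lincomb R ltac:(lra)].
- exists (b + b + g), (- (b - g)); split; last by lincomb R ltac:(lra).
  split; first by split; rewrite ?rootN // !ipE ?(ipC g b); lra.
  by rewrite (_ : _ - _ = 3%:R *: b) ?multiple_notin //; [lra|lincomb R ltac:(lra)].
Qed.

(* The orthogonal short roots u, w of a B_2; its long roots are +/- u +/- w. *)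
Definition frame u w :=
  [/\ u \in Phi, w \in Phi, u + w \in Phi, u - w \in Phi & ip w w = ip u u /\ ip u w = 0].

Lemma frame_sym u w : frame u w -> frame w u.
Proof.
move=> [uP wP pP mP [e1 e2]]; split=> //; rewrite 1?addrC // 1?ipC //.
by rewrite -rootN opprD opprK.
Qed.

Lemma frame_opp u w : frame u w -> frame (- u) w.
Proof.
move=> [uP wP pP mP [e1 e2]]; split; rewrite ?rootN //.
- by rewrite -rootN opprD opprK.
- by rewrite -opprD rootN.
- by rewrite !ipE e1 e2; split; lra.
Qed.

(** The pairings with u and w make 2s and 2t integers; [frame_integers] leaves the roots of the
    [B_2], their halves and doubles of short roots, and the last two kinds contradict
    reducedness. *)
Lemma frame_lattice u w s t : frame u w -> s *: u + t *: w \in Phi ->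
  (s \in [:: -1; 0; 1]) && (t \in [:: -1; 0; 1]).
Proof.
move=> [uP wP pP mP [e1 e2]] dP; set d := s *: u + t *: w in dP.
have u0 := root_gt0 uP.
have [a ha] := pairing_int dP uP; have [b hb] := pairing_int dP wP.
have [c hc] := pairing_int dP pP.
have [m hm] := pairing_int uP dP; have [m' hm'] := pairing_int wP dP.
have hs : s = a%:~R / 2.
  by apply: (@mulIf _ (ip u u)); [rewrite gt_eqF | move: ha; rewrite /d !ipE (ipC w u) e2; lra].
have ht : t = b%:~R / 2.
  by apply: (@mulIf _ (ip u u)); [rewrite gt_eqF | move: hb; rewrite /d !ipE e2 e1; lra].
have hab : a + b = 2 * c.
  apply/eqP; rewrite -(eqr_int R) rmorphD rmorphM /=; apply/eqP.
  apply: (@mulIf _ (ip u u)); first by rewrite gt_eqF.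
  by move: hc ha hb; rewrite /d !ipE (ipC w u) e2 e1; lra.
have h1 : 4 * a = m * (a * a + b * b).
  apply/eqP; rewrite -(eqr_int R) !(rmorphD, rmorphM) /=; apply/eqP.
  apply: (@mulIf _ (ip u u)); first by rewrite gt_eqF.
  by move: hm; rewrite /d !ipE (ipC w u) e2 e1 hs ht; lra.
have h2 : 4 * b = m' * (a * a + b * b).
  apply/eqP; rewrite -(eqr_int R) !(rmorphD, rmorphM) /=; apply/eqP.
  apply: (@mulIf _ (ip u u)); first by rewrite gt_eqF.
  by move: hm'; rewrite /d !ipE (ipC w u) e2 e1 hs ht; lra.
have N0 : 0 < a * a + b * b.
  rewrite -(ltr_int R) !(rmorphD, rmorphM) /= -(pmulr_lgt0 _ u0).
  by have := root_gt0 dP; rewrite /d !ipE (ipC w u) e2 e1 hs ht; lra.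
have no2 k : 1 < k -> k *: d \in Phi -> False by move=> k1; apply/negP/multiple_notin.
have half x y : (x == 1) || (x == -1) -> (y == 1) || (y == -1) -> x *: u + y *: w \in Phi.
  have e3 : - u + w = - (u - w) by rewrite opprB addrC.
  have e4 : - u - w = - (u + w) by rewrite opprD.
  by case/orP=> /eqP -> /orP[] /eqP ->; rewrite ?scale1r ?scaleN1r // ?e3 ?e4 rootN.
rewrite hs ht; case/or4P: (frame_integers hab h1 h2 N0) => /andP[].
- by move=> /half_mem -> /half_mem ->.
- move=> ca cb; case: (no2 2); first by lra.
  by rewrite /d hs ht scalerDr !scalerA; apply: half; exact: half_unit.
- move=> ca /eqP b0; move: dP; rewrite /d hs ht b0 mul0r scale0r addr0 => /(root_scale uP) h.
  by case: (half_not_unit ca h).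
- move=> /eqP a0 cb; move: dP; rewrite /d hs ht a0 mul0r scale0r add0r => /(root_scale wP) h.
  by case: (half_not_unit cb h).
Qed.

(* A short root of a G_2 with short simple root b and long simple root g - b. *)
Definition g2_sum a := exists b g, [/\ a2pair b g, b - g \in Phi & a = b + g].

Lemma good_or_g2_sum a b : a \in Phi -> b \in Phi -> ip b b = ip a a -> ip a b != 0 ->
  b != a -> b != - a -> good a \/ g2_sum a.
Proof.
move=> aP bP e1 ab0 nba nbNa.
have [k _ [_ h]] := norm_ratio aP bP ab0 nba nbNa ltac:(by rewrite e1).
suff [b' [g [h' aE]]] : exists b' g, a2pair b' g /\ a = b' + g.
  case: (boolP (b' - g \in Phi)) => dP; first by right; exists b', g.
  by left; exists b', g.
case: h => h.
- exists b, (a - b); split; last by rewrite addrC subrK.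
  have abP : a - b \in Phi by have := root_reflect (c := 1) aP bP; rewrite scale1r; apply; lra.
  by split=> //; rewrite !ipE ?(ipC b a); lra.
- exists (- b), (a + b); split; last by rewrite addrC addrK.
  have abP : a + b \in Phi by have := root_reflect (c := -1) aP bP; rewrite scaleN1r opprK; apply; lra.
  by split; rewrite ?rootN // !ipE ?(ipC b a); lra.
Qed.

Lemma norm_ratios a b : a \in Phi -> b \in Phi -> ip a b != 0 -> b != a -> b != - a ->
  [\/ ip a a = ip b b, ip a a = 2 * ip b b | ip a a = 3 * ip b b] \/
  (ip b b = 2 * ip a a \/ ip b b = 3 * ip a a).
Proof.
move=> aP bP ab0 nba nbNa; case: (lerP (ip b b) (ip a a)) => [le|/ltW le].
  by have [k [] -> [-> _]] := norm_ratio aP bP ab0 nba nbNa le; left;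
    [constructor 1; rewrite mul1r|constructor 2|constructor 3].
have nab : a != - b by rewrite -eqr_oppLR eq_sym.
have [k [] -> [-> _]] := norm_ratio bP aP ltac:(by rewrite ipC) ltac:(by rewrite eq_sym) nab le.
- by left; constructor 1; rewrite mul1r.
- by right; left.
- by right; right.
Qed.

Lemma norm_neq a b : ip a a != ip b b -> b != a /\ b != - a.
Proof.
by move=> h; split; apply: contraNneq h => ->; rewrite ?ipE ?opprK.
Qed.

(* A g2_sum a comes with roots of squared norm 3|a|^2, while the norms of
   non-orthogonal roots are never in ratio 3/2 or 6. *)
Lemma not_g2_sum a b1 b2 : b1 \in Phi -> b2 \in Phi -> ip b2 b2 = ip b1 b1 ->
  ip a (b1 + b2) != 0 -> ip b1 b1 = 2 * ip a a \/ ip a a = 2 * ip b1 b1 -> ~ g2_sum a.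
Proof.
move=> b1P b2P e12 nz hn [b' [g [h dP aE]]].
have [bP gP e1 e2] := h.
have bbgP : b' + b' + g \in Phi by rewrite a2pair_sub.
have ggbP : g + g + b' \in Phi by rewrite (a2pair_sub (a2pair_sym h)) -rootN opprB.
have key x y : x \in Phi -> y \in Phi -> ip x x = 3 * ip a a -> ip y y = ip b1 b1 -> ip x y = 0.
  move=> xP yP hx hy; apply/eqP/negPn/negP => xy0.
  have x0 := root_gt0 xP; have y0 := root_gt0 yP.
  have [n3 n4] : y != x /\ y != - x by apply: norm_neq; apply/eqP; case: hn; lra.
  by have [[]|[]] := norm_ratios xP yP xy0 n3 n4; case: hn; lra.
have na : ip a a = ip b' b' by rewrite aE !ipE (ipC g b'); lra.
have m1 : ip (b' + b' + g) (b' + b' + g) = 3 * ip a a by rewrite na !ipE (ipC g b'); lra.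
have m2 : ip (g + g + b') (g + g + b') = 3 * ip a a by rewrite na !ipE (ipC g b'); lra.
move: (key _ _ bbgP b1P m1 erefl) (key _ _ bbgP b2P m1 e12) (key _ _ ggbP b1P m2 erefl) (key _ _ ggbP b2P m2 e12).
rewrite !ipE => z1 z2 z3 z4.
by move/eqP: nz; apply; rewrite aE !ipE; lra.
Qed.

(** As g is not orthogonal to u, it is not orthogonal to one of the long roots u + w, u - w.
    Compatibility of the length ratios gives g the length of u or of that long root, hence an [A_2];
    [not_g2_sum] rules out that it sits in a [G_2]. *)
Lemma frame_good_aux u w g : frame u w -> g \in Phi -> (forall s t, g != s *: u + t *: w) ->
  ip g u != 0 -> (good u /\ good w) \/ (good (u + w) /\ good (u - w)).
Proof.
move=> [uP wP pP mP [e1 e2]] gP out gu0.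
have u0 := root_gt0 uP.
have npm x s t : x = s *: u + t *: w -> g != x /\ g != - x.
  by move=> ->; split; [exact: out | rewrite opprD -!scaleNr; exact: out].
have [gu1 gu2] := npm u 1 0 ltac:(by lincomb R ltac:(lra)).
have r1 := norm_ratios uP gP ltac:(by rewrite ipC) gu1 gu2.
have [e [eE ge0]] : exists e, (e = 1 \/ e = -1) /\ ip g (u + e *: w) != 0.
  have [h|h] := eqVneq (ip g (u + w)) 0; last by exists 1; rewrite scale1r; split=> //; left.
  exists (-1); rewrite scaleN1r; split; first by right.
  by apply: contraNneq gu0 => h'; move: h h'; rewrite !ipE; lra.
have vP : u + e *: w \in Phi by case: eE => ->; rewrite ?scale1r ?scaleN1r.
have ve : ip (u + e *: w) (u + e *: w) = 2 * ip u u.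
  by rewrite !ipE (ipC w u) e2 e1; case: eE => ->; lra.
have [gv1 gv2] := npm (u + e *: w) 1 e ltac:(by lincomb R ltac:(lra)).
have r2 := norm_ratios vP gP ltac:(by rewrite ipC) gv1 gv2.
have g0 := root_gt0 gP.
have [gn|gn] : ip g g = ip u u \/ ip g g = ip (u + e *: w) (u + e *: w).
  by move: r2; rewrite ve => r2; exact: norm_ratio_double r1 r2.
- left; have [gu|] := good_or_g2_sum uP gP gn ltac:(by rewrite ipC) gu1 gu2.
    split=> //; have -> : w = reflect u (u - w).
      by rewrite (reflectE (c := 1) mP); [lincomb R ltac:(lra) | rewrite !ipE (ipC w u) e2 e1; lra].
    exact: good_reflect.
  move/(not_g2_sum pP mP); case.
  + by rewrite !ipE (ipC w u) e2 e1; lra.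
  + by rewrite !ipE e2 gt_eqF //; lra.
  + by left; rewrite !ipE (ipC w u) e2 e1; lra.
- right; have [gv|] := good_or_g2_sum vP gP gn ltac:(by rewrite ipC) gv1 gv2.
    have gv' : good (u - e *: w).
      have -> : u - e *: w = reflect (u + e *: w) w.
        by rewrite (reflectE (c := 2 * e) wP); [lincomb R ltac:(lra) | rewrite !ipE e2 e1; lra].
      exact: good_reflect.
    by case: eE gv gv' => ->; rewrite ?scale1r ?scaleN1r ?opprK.
  have ewP : e *: w \in Phi by case: eE => ->; rewrite ?scale1r ?scaleN1r ?rootN.
  move/(not_g2_sum uP ewP); case.
  + by rewrite !ipE e1; case: eE => ->; lra.
  + by rewrite ve gt_eqF //; lra.
  + by right; rewrite ve.
Qed.

Lemma frame_good u w g : frame u w -> g \in Phi -> (forall s t, g != s *: u + t *: w) ->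
  ip g u != 0 \/ ip g w != 0 -> (good u /\ good w) \/ (good (u + w) /\ good (u - w)).
Proof.
move=> fr gP out [gu|gw]; first exact: frame_good_aux fr gP out gu.
have out' s t : g != s *: w + t *: u by rewrite addrC.
have [[h1 h2]|[h1 h2]] := frame_good_aux (frame_sym fr) gP out' gw; first by left.
by right; split; [rewrite addrC | rewrite -opprB; exact: good_opp].
Qed.

Lemma ip_span0 (X : seq E) x y : (forall a, a \in X -> ip a y = 0) -> x \in <<X>>%VS -> ip x y = 0.
Proof.
move=> h; rewrite (_ : X = in_tuple X) // => /coord_span ->.
elim/big_rec: _ => [|i v _ IHv]; first by have := ipZl 0 0 y; rewrite scale0r mul0r.
by rewrite !ipE IHv h ?mulr0 ?addr0 // mem_nth.
Qed.

Hypothesis irr : irreducible_root_system Phi.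

(** Otherwise P splits [Phi] into two orthogonal parts, and a vector in both spans is orthogonal to
    itself. *)
Lemma irreducible_connected (P : pred E) a0 b0 : a0 \in Phi -> P a0 -> b0 \in Phi -> ~~ P b0 ->
  exists a b, [/\ a \in Phi /\ P a, b \in Phi, ~~ P b & ip a b != 0].
Proof.
move=> a0P Pa0 b0P Pb0.
apply: contrapT => none; apply: irr.
exists [fset x in Phi | P x]%fset, [fset x in Phi | ~~ P x]%fset; split.
- split; apply/fset0Pn; [exists a0|exists b0]; by rewrite !inE /= ?a0P ?b0P.
- by apply/fdisjointP => x; rewrite !inE /= => /andP[-> ->].
- by apply/fsetP => x; rewrite !inE /= -andb_orr orbN andbT.
apply/eqP; rewrite -subv0; apply/subvP => x; rewrite memv_cap memv0 => /andP[x1 x2].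
rewrite -ip_eq0; apply/eqP.
apply: ip_span0 x1 => a; rewrite !inE /= => /andP[aP Pa].
rewrite ipC; apply: ip_span0 x2 => b; rewrite !inE /= => /andP[bP Pb].
apply/eqP/negPn/negP => h; apply: none; exists a, b; split=> //.
by rewrite ipC.
Qed.

(** * A frame spanning the whole space *)

Section FrameC2.
Variables (u w : E).
Hypothesis fr : frame u w.
Hypothesis span : forall g, g \in Phi -> exists s t, g = s *: u + t *: w.

Let c1 : 'rV[R]_2 := delta_mx 0 0.
Let c2 : 'rV[R]_2 := delta_mx 0 1.
(** Sends u and w to the short roots c1 + c2 and c2 - c1 of [root_system_C2]; both coordinates are
    divided by [ip u u], which equals [ip w w]. *)
Let f v := (ip v u / ip u u) *: (c1 + c2) + (ip v w / ip u u) *: (c2 - c1).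

Let f_linear : linear f.
Proof. by move=> k x y; rewrite /f !ipE; lincomb R ltac:(ring). Qed.

Let fL : {linear E -> 'rV[R]_2} := HB.pack f (GRing.isLinear.Build R E 'rV[R]_2 *:%R f f_linear).

Let fE s t : f (s *: u + t *: w) = s *: (c1 + c2) + t *: (c2 - c1).
Proof.
have [uP wP _ _ [e1 e2]] := fr; have u0 := root_gt0 uP.
rewrite /f !ipE (ipC w u) e2 e1 !mulr0 addr0 add0r !mulfK //; by rewrite gt_eqF.
Qed.

Let f_inj v : f v = 0 -> v = 0.
Proof.
have [uP wP _ _ [e1 e2]] := fr; have u0 := root_gt0 uP.
move=> h; have h0 := congr1 (fun x : 'rV[R]_2 => x 0 0) h; have h1 := congr1 (fun x : 'rV[R]_2 => x 0 1) h.
move: h0 h1; rewrite /f /c1 /c2 !mxE /= !(addr0, sub0r, subr0, add0r, mulr1, mulrN) => h0 h1.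
have vu : ip v u = 0 by apply: (@mulIf _ (ip u u)^-1); [rewrite invr_eq0 gt_eqF | lra].
have vw : ip v w = 0 by apply: (@mulIf _ (ip u u)^-1); [rewrite invr_eq0 gt_eqF | lra].
apply/eqP; rewrite -ip_eq0; apply/eqP.
have [_ sp _ _] := PhiR.
have : v \in <<enum_fset Phi>>%VS by rewrite sp memvf.
apply: ip_span0 => a /span[s [t ->]].
by rewrite !ipE !(ipC _ v) vu vw !mulr0 addr0.
Qed.

Lemma frame_C2 : root_system_iso Phi (root_system_C2 R).
Proof.
have [uP wP pP mP [e1 e2]] := fr.
have lfE v : linfun fL v = f v by rewrite lfunE.
exists (linfun fL); split.
- apply/eqP/lker0P => x y; rewrite !lfE => h; apply/eqP; rewrite -subr_eq0; apply/eqP/f_inj.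
  by rewrite -scaleN1r addrC f_linear h scaleN1r addNr.
- apply/eqP; rewrite eqEsubv subvf /=.
  apply/subvP => x _; rewrite (row_sum_delta x) big_ord_recl big_ord1.
  rewrite memvD // memvZ //.
    have -> : delta_mx 0 0 = linfun fL (2^-1 *: u + (- 2^-1) *: w).
      by rewrite lfE fE -/c1; lincomb R ltac:(lra).
    exact: memv_img (memvf _).
  have -> : delta_mx 0 (lift ord0 ord0) = linfun fL (2^-1 *: u + 2^-1 *: w).
    rewrite lfE fE (_ : delta_mx 0 (lift ord0 ord0) = c2); first by lincomb R ltac:(lra).
    by congr delta_mx; apply/val_inj.
  exact: memv_img (memvf _).
have Pst s t : s *: u + t *: w \in Phi -> s *: (c1 + c2) + t *: (c2 - c1) \in
   [fset linfun fL x | x in Phi]%fset.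
  by move=> h; apply/imfsetP; exists (s *: u + t *: w) => //; rewrite lfE fE.
apply/fsetP => x; apply/imfsetP/idP => [[g /= gP ->]|].
  have [s [t gE]] := span gP; rewrite lfE gE fE.
  have := frame_lattice fr (s := s) (t := t); rewrite -gE => /(_ gP).
  have : g != 0 by exact: root_neq0.
  rewrite gE !inE => nz /andP[/or3P[]/eqP s1 /or3P[]/eqP t1]; move: nz; rewrite {}s1 {}t1 => nz.
  - have -> : -1 *: (c1 + c2) + -1 *: (c2 - c1) = - (2 *: c2) by lincomb R ltac:(lra).
    by rewrite eqxx !orbT.
  - have -> : -1 *: (c1 + c2) + 0 *: (c2 - c1) = - c1 - c2 by lincomb R ltac:(lra).
    by rewrite eqxx !orbT.
  - have -> : -1 *: (c1 + c2) + 1 *: (c2 - c1) = - (2 *: c1) by lincomb R ltac:(lra).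
    by rewrite eqxx !orbT.
  - have -> : 0 *: (c1 + c2) + -1 *: (c2 - c1) = c1 - c2 by lincomb R ltac:(lra).
    by rewrite eqxx !orbT.
  - by rewrite !scale0r addr0 eqxx in nz.
  - have -> : 0 *: (c1 + c2) + 1 *: (c2 - c1) = - c1 + c2 by lincomb R ltac:(lra).
    by rewrite eqxx !orbT.
  - have -> : 1 *: (c1 + c2) + -1 *: (c2 - c1) = 2 *: c1 by lincomb R ltac:(lra).
    by rewrite eqxx !orbT.
  - have -> : 1 *: (c1 + c2) + 0 *: (c2 - c1) = c1 + c2 by lincomb R ltac:(lra).
    by rewrite eqxx.
  - have -> : 1 *: (c1 + c2) + 1 *: (c2 - c1) = 2 *: c2 by lincomb R ltac:(lra).
    by rewrite eqxx !orbT.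
have mP' : w - u \in Phi by rewrite -rootN opprB.
have pP' : - u - w \in Phi by rewrite -rootN opprD !opprK.
move=> h; suff /imfsetP : x \in [fset linfun fL x | x in Phi]%fset by [].
have mk s t v : v \in Phi -> v = s *: u + t *: w -> s *: (c1 + c2) + t *: (c2 - c1) = x ->
  x \in [fset linfun fL x | x in Phi]%fset by move=> vP vE <-; apply: Pst; rewrite -vE.
move: h; rewrite !inE -/c1 -/c2 orbF => /or4P[|||/or4P[|||/orP[]]] /eqP xE; rewrite {}xE in mk *.
- by apply: (mk 1 0 u) => //; lincomb R ltac:(lra).
- by apply: (mk 0 (-1) (- w)); rewrite ?rootN //; lincomb R ltac:(lra).
- by apply: (mk 0 1 w) => //; lincomb R ltac:(lra).
- by apply: (mk (-1) 0 (- u)); rewrite ?rootN //; lincomb R ltac:(lra).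
- by apply: (mk 1 (-1) (u - w)) => //; lincomb R ltac:(lra).
- by apply: (mk (-1) 1 (w - u)) => //; lincomb R ltac:(lra).
- by apply: (mk 1 1 (u + w)) => //; lincomb R ltac:(lra).
- by apply: (mk (-1) (-1) (- u - w)) => //; lincomb R ltac:(lra).
Qed.
End FrameC2.

Hypothesis dimE : (2 <= \dim {:E})%N.
Hypothesis notC2 : ~ root_system_iso Phi (root_system_C2 R).

(** Excluding [C_2] provides a root outside the plane of the frame, and irreducibility one that is
    not orthogonal to the plane. *)
Lemma frame_cases u w : frame u w -> (good u /\ good w) \/ (good (u + w) /\ good (u - w)).
Proof.
move=> fr; have [uP wP _ _ _] := fr.
pose P : pred E := fun g => `[< exists s t, g = s *: u + t *: w >].
have Pu : P u by apply/asboolP; exists 1, 0; rewrite scale1r scale0r addr0.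
have [g0 g0P Pg0] : exists2 g, g \in Phi & ~~ P g.
  apply/not_exists2P => none; apply: notC2; apply: (frame_C2 fr) => g gP.
  by have [//|/negP/negPn/asboolP] := none g.
have [a [b [[aP /asboolP[s [t aE]]] bP /asboolPn out ab]]] := irreducible_connected uP Pu g0P Pg0.
apply: (frame_good fr bP).
  by move=> s' t'; apply/negP => /eqP bE; apply: out; exists s', t'.
have [h1|] := eqVneq (ip b u) 0; last by left.
have [h2|] := eqVneq (ip b w) 0; last by right.
by move: ab; rewrite aE ipC !ipE h1 h2 !mulr0 addr0 eqxx.
Qed.

(** Rank at least 2 and irreducibility give a root b, neither a nor -a, not orthogonal to a. Length
    ratio 1 leads to an [A_2], ratio 2 to a frame, ratio 3 to a [G_2]. *)
Lemma root_cases a : a \in Phi ->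
  [\/ good a,
      exists u w, [/\ frame u w, a = w, good (w - u) & good (w + u)],
      exists u w, [/\ frame u w, a = u + w, good u & good w]
    | g2_sum a].
Proof.
move=> aP.
have a0 := root_gt0 aP.
have eq_norm b : b \in Phi -> ip b b = ip a a -> ip a b != 0 -> b != a -> b != - a -> good a \/ g2_sum a.
  exact: good_or_g2_sum.
pose P : pred E := [pred g | (g == a) || (g == - a)].
have [b0 b0P Pb0] : exists2 g, g \in Phi & ~~ P g.
  apply/not_exists2P => none.
  have [_ sp _ _] := PhiR.
  have : (fullv <= <[a]>)%VS.
    rewrite -sp; apply/span_subvP => g gP; have [//|/negP/negPn] := none g.
    by rewrite /P /= => /orP[]/eqP ->; rewrite ?memvN memv_line.
  by move=> /dimvS; rewrite dim_vline (root_neq0 aP) => h; have := leq_trans dimE h.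
have [a' [b [[_ Pa'] bP Pb ab']]] := irreducible_connected (P := P) aP ltac:(by rewrite /P /= eqxx) b0P Pb0.
have {a' Pa' ab'} ab : ip a b != 0.
  by case/orP: Pa' ab' => /eqP ->; rewrite ?ipE ?oppr_eq0.
move: Pb; rewrite /P /= negb_or => /andP[nba nbNa].
have b0' := root_gt0 bP.
(* The angle is 30 or 150 degrees, so a and its reflection in b have equal length and angle 120
   degrees. *)
have triple : 4 * ip a b ^+ 2 = 3 * ip a a * ip b b -> good a \/ g2_sum a.
  move=> h; apply: (eq_norm (reflect a b)); first exact: reflect_root.
  - exact: reflect_ip.
  - suff -> : ip a (reflect a b) = - ip a a / 2 by rewrite mulf_eq0 oppr_eq0 (gt_eqF a0) invr_eq0 pnatr_eq0.
    rewrite /reflect !ipE; apply: (@mulIf _ (2 * ip b b)); first by rewrite mulf_eq0 pnatr_eq0 (gt_eqF b0').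
    rewrite mulrBl (_ : _ / _ * _ * _ = 4 * ip a b ^+ 2); last by field; rewrite gt_eqF.
    by rewrite h; field.
  - apply/eqP => h'; have : ip a (reflect a b) = ip a a by rewrite h'.
    rewrite /reflect !ipE => /eqP; rewrite -subr_eq0 addrAC subrr sub0r oppr_eq0 !mulf_eq0.
    by rewrite (negPf ab) invr_eq0 (gt_eqF b0') pnatr_eq0.
  - apply/eqP => h'; have : ip a (reflect a b) = - ip a a by rewrite h' !ipE.
    rewrite /reflect !ipE => h2; have : ip a a = 0; last by move/eqP; rewrite (gt_eqF a0).
    apply: (@mulIf _ (2 * ip b b)); first by rewrite mulf_eq0 pnatr_eq0 (gt_eqF b0').
    have : (ip a a - 2 * ip a b / ip b b * ip a b) * ip b b = - ip a a * ip b b by rewrite h2.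
    rewrite mulrBl (_ : _ / _ * _ * _ = 2 * ip a b ^+ 2); last by field; rewrite gt_eqF.
    by lra.
(* Here a is long and [b'] a short root at 135 degrees to it, so b' + a is the short root orthogonal
   to b'. *)
have mk b' : b' = b \/ b' = - b -> 2 * ip a b' = - ip a a -> ip a a = 2 * ip b b ->
  frame b' (b' + a) /\ ip b' b' = ip b b.
  move=> hb h1 h2; have b'P : b' \in Phi by case: hb => ->; rewrite ?rootN.
  have b'b : ip b' b' = ip b b by case: hb => ->; rewrite ?ipE ?opprK.
  split=> //.
  have sP : b' + a \in Phi.
    by have := root_reflect (c := -1) b'P aP; rewrite scaleN1r opprK; apply; rewrite ipC; lra.
  split=> //.
  - have -> : b' + (b' + a) = a - (-2) *: b' by lincomb R ltac:(lra).
    by apply: root_reflect => //; lra.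
  - by rewrite opprD addNKr ?rootN //.
  - by rewrite !ipE !(ipC b' a) b'b; split; lra.
have gg : good a \/ g2_sum a -> [\/ good a, exists u w, [/\ frame u w, a = w, good (w - u) & good (w + u)],
      exists u w, [/\ frame u w, a = u + w, good u & good w] | g2_sum a].
  by case=> ?; [constructor 1|constructor 4].
have nab : a != - b by rewrite -eqr_oppLR eq_sym.
have [[e|e|e]|[e|e]] := norm_ratios aP bP ab nba nbNa.
- by apply/gg/(eq_norm b).
- have [k hk [ke h]] := norm_ratio aP bP ab nba nbNa ltac:(lra).
  have [b' [[hb h'] fr]] : exists b', (( b' = b \/ b' = - b) /\ 2 * ip a b' = - ip a a) /\ frame b' (b' + a).
    have [h1|h1] := h.
      exists (- b); have h2 : 2 * ip a (- b) = - ip a a by rewrite !ipE; lra.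
      by split; [split; [right|] | have [] := mk (- b) (or_intror erefl) h2 e].
    by exists b; split; [split; [left|] | have [] := mk b (or_introl erefl) h1 e].
  have [[g1 g2]|[g1 g2]] := frame_cases fr.
    constructor 3; exists (- b'), (b' + a); split=> //; [exact: frame_opp|by rewrite addKr|exact: good_opp].
  by constructor 1; rewrite (_ : a = - (b' - (b' + a))); [exact: good_opp|lincomb R ltac:(lra)].
- have [k hk [ke h]] := norm_ratio aP bP ab nba nbNa ltac:(lra).
  apply/gg/triple.
  have -> : 4 * ip a b ^+ 2 = (2 * ip a b) ^+ 2 by ring.
  by rewrite (_ : (2 * ip a b) ^+ 2 = ip a a ^+ 2); [rewrite expr2 {2}e; ring | case: h => ->; ring].
- have [k hk [ke h]] := norm_ratio bP aP ltac:(by rewrite ipC) ltac:(by rewrite eq_sym) nab ltac:(lra).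
  have [L [hL LP h' eL]] : exists L, [/\ L = b \/ L = - b, L \in Phi, 2 * ip a L = - ip L L & ip L L = 2 * ip a a].
    have [h1|h1] := h.
      exists (- b); split; [by right | by rewrite rootN | |]; rewrite !ipE ?(ipC a b); lra.
    by exists b; split=> //; [left | rewrite (ipC a b)].
  have fr : frame a (a + L).
    have sP : a + L \in Phi.
      by have := root_reflect (c := -1) aP LP; rewrite scaleN1r opprK; apply; lra.
    split=> //.
    + have -> : a + (a + L) = L - (-2) *: a by lincomb R ltac:(lra).
      by apply: root_reflect => //; rewrite ipC; lra.
    + by rewrite opprD addNKr ?rootN //.
    + by rewrite !ipE !(ipC L a); split; lra.
  have [[g1 g2]|[g1 g2]] := frame_cases fr; first by constructor 1.
  constructor 2; exists (a + L), a; split=> //; first exact: frame_sym.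
- have [k hk [ke h]] := norm_ratio bP aP ltac:(by rewrite ipC) ltac:(by rewrite eq_sym) nab ltac:(lra).
  apply/gg/triple; rewrite (ipC a b).
  have -> : 4 * ip b a ^+ 2 = (2 * ip b a) ^+ 2 by ring.
  by rewrite (_ : (2 * ip b a) ^+ 2 = ip b b ^+ 2); [rewrite expr2 {1}e; ring | case: h => ->; ring].
Qed.
End RootGeometry.

(** * Steinberg groups *)

Section SteinbergRelations.
Variables (R : realType) (E : vectType R) (Phi : {fset E}).
Variables (C : E -> E -> nat -> nat -> int) (A : comPzRingType).

(** Indexed by all vectors, with value 1 off [Phi], so that vector identities can be rewritten in
    the index. *)
Definition root_elt (a : E) (p : A) : steinberg Phi C A :=
  if insub a is Some alpha then steinberg_x C alpha p else 1%g.

Lemma root_elt_val (alpha : Phi) p : root_elt (val alpha) p = steinberg_x C alpha p.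
Proof. by rewrite /root_elt valK. Qed.

Lemma root_eltD a p q : root_elt a (p + q) = (root_elt a p * root_elt a q)%g.
Proof.
rewrite /root_elt; case: insub => [alpha|]; last by rewrite mulg1.
apply/esym; rewrite -[LHS]/(presented_mul _ _) presented_mulE.
exact/presented_classP/Word_rel/Steinberg_add.
Qed.

Lemma root_elt_comm a b s p q : a \in Phi -> b \in Phi -> b != - a -> commutator_pairs Phi a b s ->
  (root_elt a p * root_elt b q = root_elt b q * root_elt a p *
    \prod_(ij <- s) root_elt (a *+ ij.1 + b *+ ij.2)
      ((p ^+ ij.1 * q ^+ ij.2) *~ C a b ij.1 ij.2)%R)%g.
Proof.
move=> aP bP nb hs.
pose alpha : Phi := FSetSub aP; pose beta : Phi := FSetSub bP.
have prodE : (\prod_(ij <- s) root_elt (a *+ ij.1 + b *+ ij.2)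
      ((p ^+ ij.1 * q ^+ ij.2) *~ C a b ij.1 ij.2)%R)%g =
    presented_class (steinberg_rel C (A := A)) (st_comm_word C alpha beta p q s).
  rewrite /st_comm_word; elim: s {hs} => [|ij s IHs]; first by rewrite big_nil.
  rewrite big_cons IHs /= /root_elt /=; case: insub => [gamma|]; last by rewrite mul1g.
  by rewrite -[LHS]/(presented_mul _ _) presented_mulE.
have rel := presented_classP (steinberg_rel C (A := A)) (word_comm (st_gen alpha p) (st_gen beta q))
  (st_comm_word C alpha beta p q s).
have {rel} : presented_class (steinberg_rel C (A := A)) (word_comm (st_gen alpha p) (st_gen beta q)) =
    presented_class (steinberg_rel C (A := A)) (st_comm_word C alpha beta p q s).
  by apply: rel.2; apply: Word_rel; apply: Steinberg_comm => //=; apply/eqP.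
rewrite prodE => <-.
rewrite /word_comm -!presented_mulE -!presented_invE.
rewrite -[a]/(val alpha) -[b]/(val beta) !root_elt_val /steinberg_x.
set x := presented_class _ (st_gen alpha p); set y := presented_class _ (st_gen beta q).
rewrite -[RHS]/(y * x * (x^-1 * (y^-1 * (x * y))))%g.
by rewrite -mulgA !mulVKg.
Qed.

End SteinbergRelations.

(** * Rank two relations and bounded displacement *)

Section BoundedRootSubgroups.
Variables (R : realType) (E : vectType R) (Phi : {fset E}) (ip : {dot E for idfun}).
Hypothesis PhiR : root_system Phi.
Hypothesis crystal : {in Phi &, forall alpha beta,
  let c := 2 * ip alpha beta / ip beta beta in
  c \is a Num.int /\ alpha - c *: beta \in Phi}.
Hypothesis red : reduced_root_system Phi.
Variable C : E -> E -> nat -> nat -> int.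
Hypothesis CP : chevalley_constants Phi C.
Variable A : comPzRingType.
Local Notation X := (root_elt Phi C (A := A)).

Let Phi0 : 0 \notin Phi. Proof. by have [_ _ ->] := PhiR. Qed.

Let PhiN a : (- a \in Phi) = (a \in Phi). Proof. exact: rootN. Qed.

Let sqr_unit (z : int) : z ^+ 2 = 1 -> z%:~R = 1 :> A \/ z%:~R = -1 :> A.
Proof. by move/eqP; rewrite sqrf_eq1 => /orP[] /eqP ->; [left|right]. Qed.

Let not_double a k : a \in Phi -> (1 < k)%N -> a *+ k \notin Phi.
Proof.
by move=> aP k1; rewrite -scaler_nat; apply: (multiple_notin PhiR red aP); rewrite ltr1n.
Qed.

Let add_neq0 a b : a \in Phi -> b \in Phi -> b != - a -> a + b *+ 2 != 0.
Proof.
move=> aP bP _; apply: contraTneq aP => h; have -> : a = - (b *+ 2) by apply/eqP; rewrite -addr_eq0 h.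
by rewrite PhiN; exact: not_double.
Qed.

(** By [good_pair_lattice] the only roots in the lattice of b and g are those of the hexagon: (1, 1)
    is the only commutator pair of b and g, and there is none with b + g. *)
Lemma good_pair_heisenberg b g : good_pair Phi ip b g -> heisenberg (X b) (X (b + g)) (X g).
Proof.
move=> h; have [h0 ns] := h; have [bP gP e1 e2] := h0.
have b0 := root_gt0 ip PhiR bP.
have lat (i j : nat) : b *+ i + g *+ j \in Phi -> (i%:Z, j%:Z) \in [:: (1, 0); (0, 1); (1, 1); (-1, 0); (0, -1); (-1, -1)].
  by move=> dP; apply: eisenstein_norm1; exact: (good_pair_lattice PhiR crystal (i := i%:Z) (j := j%:Z) h dP).
have sP := a2pair_add PhiR crystal h0.
have comm x y : x \in Phi -> y \in Phi -> y != - x -> (forall i j : nat, (0 < i)%N -> (0 < j)%N -> x *+ i + y *+ j \notin Phi) ->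
    forall p q : A, commute (X x p) (X y q).
  move=> xP yP xy none p q; rewrite /commute (root_elt_comm (s := [::]) C p q xP yP xy) ?big_nil ?mulg1 //.
  by split=> // i j; rewrite in_nil; apply/esym/negP => /and3P[i0 j0]; apply/negP; exact: none.
have bsum i j : (b + g) *+ i + b *+ j = b *+ (i + j) + g *+ i.
  by rewrite mulrnDl mulrnDr addrAC.
have gsum i j : (b + g) *+ i + g *+ j = b *+ i + g *+ (i + j).
  by rewrite mulrnDl mulrnDr addrA.
have gb : g != - b.
  by apply: contraNneq Phi0 => h1; rewrite h1 subrr in sP.
split; try exact: root_eltD.
- apply: comm => //.
    apply/negP => /eqP h1; have : b *+ 1 + (b + g) *+ 0 = 0 + b by rewrite mulr0n addr0 add0r.
    move=> _; have h2 : g = - (b *+ 2) by apply/eqP; rewrite -addr_eq0 mulr2n addrC -addrA {1}h1 addNr.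
    by move: gP; rewrite h2 PhiN; apply/negP; exact: not_double.
  move=> i j i0 j0; rewrite bsum; apply/negP => /lat; rewrite !inE !xpair_eqE; move: i0 j0; clear; lia.
- apply: comm => //.
    apply/negP => /eqP h1.
    have h2 : b = - (g *+ 2) by apply/eqP; rewrite -addr_eq0 mulr2n addrA {2}h1 subrr.
    by move: bP; rewrite h2 PhiN; apply/negP; exact: not_double.
  move=> i j i0 j0; rewrite gsum; apply/negP => /lat; rewrite !inE !xpair_eqE; move: i0 j0; clear; lia.
have hs : commutator_pairs Phi b g [:: (1, 1)%N].
  split=> // i j; rewrite !inE xpair_eqE; apply/andP/and3P => [[/eqP -> /eqP ->]|[i0 j0 /lat]].
    by rewrite !mulr1n.
  by rewrite !inE !xpair_eqE; move: i0 j0; clear; lia.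
have gbn : g - b \notin Phi by rewrite -PhiN opprB.
have g_b : g != b.
  by apply/eqP => h1; move: e2; rewrite h1; lra.
have bggn : b + g *+ 2 \notin Phi.
  by apply/negP => h1; have := lat 1%N 2%N h1.
have [C11 _] := chevalley_constants_sqr Phi0 PhiN CP bP gP sP gbn bggn g_b gb (add_neq0 bP gP gb) hs.
exists (C b g 1 1)%:~R; first exact: sqr_unit.
move=> p q; rewrite (root_elt_comm C p q bP gP gb hs) big_seq1 /= !mulr1n !expr1.
by rewrite mulrzl.
Qed.

(** u is the short simple root and w - u the long one; their sum is w and 2u + (w - u) = u + w. *)
Lemma frame_relation u w : frame Phi ip u w -> exists c1 c2 : A,
  [/\ c1 = 1 \/ c1 = -1, c2 = 1 \/ c2 = -1 & forall p q,
   (X u p * X (w - u) q = X (w - u) q * X u p *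
     (X w (c1 * (p * q)) * X (u + w) (c2 * (p ^+ 2 * q))))%g].
Proof.
move=> fr; have [uP wP pP mP [e1 e2]] := fr.
have u0 := root_gt0 ip PhiR uP.
have lP : w - u \in Phi by rewrite -PhiN opprB.
have lat s t : s *: u + t *: w \in Phi -> (s \in [:: -1; 0; 1]) && (t \in [:: -1; 0; 1]).
  exact: (frame_lattice PhiR crystal red fr).
have sumE i j : u *+ i + (w - u) *+ j = (i%:R - j%:R) *: u + j%:R *: w.
  by rewrite -(scaler_nat i u) -(scaler_nat j (w - u)); lincomb R ltac:(ring).
have ulw : u + (w - u) = w by rewrite addrC subrK.
have uulw : u *+ 2 + (w - u) = u + w by rewrite mulr2n -addrA ulw.
have lu : w - u != - u.
  by apply/negP => /eqP h1; move: (root_neq0 PhiR wP); rewrite -ulw h1 subrr eqxx.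
have hs : commutator_pairs Phi u (w - u) [:: (1, 1)%N; (2, 1)%N].
  split=> // i j; rewrite !inE !xpair_eqE; apply/idP/and3P => [|[i0 j0]].
    by case/orP => /andP[/eqP -> /eqP ->]; split=> //; rewrite mulr1n ?mulr1n ?ulw ?uulw.
  rewrite sumE => /lat; rewrite !inE.
  have eqz (x y : int) : (x%:~R == y%:~R :> R) = (x == y) by exact: eqr_int.
  rewrite (_ : i%:R - j%:R = (i%:Z - j%:Z)%:~R :> R); last by rewrite rmorphB.
  rewrite (_ : j%:R = (j%:Z)%:~R :> R) // (_ : -1 = (-1)%:~R :> R) // (_ : 1 = 1%:~R :> R) // (_ : 0 = 0%:~R :> R) //.
  rewrite !eqz; move: i0 j0; clear; lia.
have nolat s t : [|| 1 < s, s < -1, 1 < t | t < -1] -> s *: u + t *: w \notin Phi.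
  have unit_bound (r : R) : r \in [:: -1; 0; 1] -> -1 <= r <= 1.
    by rewrite !inE => /or3P[] /eqP ->; apply/andP; split; lra.
  move=> hst; apply/negP => /lat /andP[/unit_bound/andP[s1 s2] /unit_bound/andP[t1 t2]].
  by case/or4P: hst; lra.
have n1 : (w - u) - u \notin Phi.
  rewrite (_ : _ - u = -2 *: u + 1 *: w); last by lincomb R ltac:(lra).
  by apply: nolat; apply/or4P; constructor 2; lra.
have n2 : u + (w - u) *+ 2 \notin Phi.
  rewrite -(scaler_nat 2 (w - u)) (_ : u + _ = -1 *: u + 2 *: w); last by lincomb R ltac:(lra).
  by apply: nolat; apply/or4P; constructor 3; lra.
have n3 : (w - u) + u *+ 3 \notin Phi.
  rewrite -(scaler_nat 3 u) (_ : _ + _ = 2 *: u + 1 *: w); last by lincomb R ltac:(lra).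
  by apply: nolat; apply/or4P; constructor 1; lra.
have lnu : w - u != u.
  apply/eqP => h1; have h2 : w = u *+ 2 by rewrite mulr2n -{1}h1 subrK.
  by move: wP; rewrite h2; apply/negP; exact: not_double.
have wP' : u + (w - u) \in Phi by rewrite ulw.
have [C11 C21] := chevalley_constants_sqr Phi0 PhiN CP uP lP wP' n1 n2 lnu lu (add_neq0 uP lP lu) hs.
have n3' : w - u + u *+ 3 != 0.
  apply/eqP => h1; move: lP; rewrite (_ : w - u = - (u *+ 3)); last by apply/eqP; rewrite -addr_eq0 h1.
  by rewrite PhiN; apply/negP; exact: not_double.
have {}C21 := C21 2%N ltac:(by rewrite uulw) isT.
exists (C u (w - u) 1 1)%:~R, (C u (w - u) 2 1)%:~R; split.
- exact: sqr_unit.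
- apply: sqr_unit; apply: C21 => // -[|[|[|]]] // _.
  + by rewrite mulr0n addr0.
  + by rewrite mulr1n subrK.
  + by rewrite addrC uulw.
move=> p q; rewrite (root_elt_comm C p q uP lP lu hs) !big_cons big_nil mulg1 /= !mulr1n !expr1 ulw uulw.
by rewrite !mulrzl.
Qed.

Lemma g2_relation b g : a2pair Phi ip b g -> b - g \in Phi -> exists c1 c2 c3 c4 : A,
  [/\ c1 = 1 \/ c1 = -1, c2 = 1 \/ c2 = -1 & forall p q,
   (X b p * X (g - b) q = X (g - b) q * X b p *
     (X g (c1 * (p * q)) * (X (b + g) (c2 * (p ^+ 2 * q)) *
     (X (b + b + g) (c3 * (p ^+ 3 * q)) * X (g + g + b) (c4 * (p ^+ 3 * q ^+ 2))))))%g].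
Proof.
move=> h0 dP; have [bP gP e1 e2] := h0.
have b0 := root_gt0 ip PhiR bP.
have lP : g - b \in Phi by rewrite -PhiN opprB.
have sP := a2pair_add PhiR crystal h0.
have bbgP : b + b + g \in Phi by rewrite (a2pair_sub PhiR crystal h0).
have ggbP : g + g + b \in Phi by rewrite (a2pair_sub PhiR crystal (a2pair_sym h0)).
have lat (i j : int) : b *~ i + g *~ j \in Phi ->
    (i, j) \in [:: (1, 0); (0, 1); (1, 1); (-1, 0); (0, -1); (-1, -1)] ++ [:: (1, 2); (2, 1); (1, -1); (-1, -2); (-2, -1); (-1, 1)].
  move=> hP; rewrite mem_cat; apply/orP.
  case/orP: (a2pair_lattice PhiR crystal h0 hP) => /eqP; [left; exact: eisenstein_norm1 | right; exact: eisenstein_norm3].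
have sumE i j : b *+ i + (g - b) *+ j = b *~ (i%:Z - j%:Z) + g *~ j.
  by rewrite mulrnBl mulrzBr addrA [RHS]addrAC.
have blg : b + (g - b) = g by rewrite addrC subrK.
have bblg : b *+ 2 + (g - b) = b + g by rewrite mulr2n -addrA blg.
have b3lg : b *+ 3 + (g - b) = b + b + g by rewrite mulrSr -addrA blg mulr2n.
have b3llg : b *+ 3 + (g - b) *+ 2 = g + g + b.
  by rewrite -(scaler_nat 3 b) -(scaler_nat 2 (g - b)); lincomb R ltac:(lra).
have lb : g - b != - b.
  by apply/negP => /eqP h1; move: (root_neq0 PhiR gP); rewrite -blg h1 subrr eqxx.
have hs : commutator_pairs Phi b (g - b) [:: (1, 1); (2, 1); (3, 1); (3, 2)]%N.
  split=> // i j; rewrite !inE !xpair_eqE; apply/idP/and3P => [|[i0 j0]].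
    by case/or4P => /andP[/eqP -> /eqP ->]; split=> //; rewrite ?(mulr1n b) ?(mulr1n (g - b)) ?blg ?bblg ?b3lg ?b3llg.
  by rewrite sumE => /lat; rewrite !inE !xpair_eqE; move: i0 j0; clear; lia.
have n1 : (g - b) - b \notin Phi.
  by apply/negP => h1; have := lat (-2) 1; rewrite mulr1z mulrNz addrC opprD addrA => /(_ h1).
have n2 : b + (g - b) *+ 2 \notin Phi.
  rewrite -{1}[b]mulr1n sumE; apply/negP => /lat; by [].
have n4 : (g - b) + b *+ 4 \notin Phi.
  by rewrite addrC -[g - b]mulr1n sumE; apply/negP => /lat.
have lnb : g - b != b.
  apply/eqP => h1; have h2 : g = b *+ 2 by rewrite mulr2n -{1}h1 subrK.
  by move: gP; rewrite h2; apply/negP; exact: not_double.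
have gP' : b + (g - b) \in Phi by rewrite blg.
have [C11 C21] := chevalley_constants_sqr Phi0 PhiN CP bP lP gP' n1 n2 lnb lb (add_neq0 bP lP lb) hs.
have n4' : g - b + b *+ 4 != 0.
  apply/eqP => h1; move: lP; rewrite (_ : g - b = - (b *+ 4)); last by apply/eqP; rewrite -addr_eq0 h1.
  by rewrite PhiN; apply/negP; exact: not_double.
have {}C21 := C21 3%N ltac:(by rewrite bblg) isT.
exists (C b (g - b) 1 1)%:~R, (C b (g - b) 2 1)%:~R, (C b (g - b) 3 1)%:~R, (C b (g - b) 3 2)%:~R; split.
- exact: sqr_unit.
- apply: sqr_unit; apply: C21 => // -[|[|[|[|]]]] // _.
  + by rewrite mulr0n addr0.
  + by rewrite mulr1n subrK.
  + by rewrite addrC bblg.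
  + by rewrite addrC b3lg.
move=> p q; rewrite (root_elt_comm C p q bP lP lb hs) !big_cons big_nil mulg1 /= !mulr1n !expr1 blg bblg b3lg b3llg.
by rewrite !mulrzl.
Qed.

Section Displacement.
Variables (EE : completeNormedModType R) (act : steinberg Phi C A -> EE -> EE).
Hypothesis ucE : uniformly_convex EE.
Hypothesis hact : affine_isometric_action act.
Variable s : seq A.
Hypothesis fg : forall S : {pred A}, subring_closed S -> {subset s <= S} -> forall a, a \in S.

Let L a p := disp act (X a p) 0.

Definition bounded_root a := exists B, forall p, L a p <= B.

Let root_elt0 a : X a 0 = 1%g.
Proof. by apply: (mulgI (X a 0)); rewrite -root_eltD addr0 mulg1. Qed.

Let root_eltN a p : X a (- p) = (X a p)^-1%g.
Proof. by apply: (mulgI (X a p)); rewrite -root_eltD subrr mulgV root_elt0. Qed.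

Let LD a p q : L a (p + q) <= L a p + L a q.
Proof. by rewrite /L root_eltD; exact: dispM. Qed.

Let LN a p : L a (- p) = L a p.
Proof. by rewrite /L root_eltN dispV. Qed.

Let L0 a : L a 0 = 0.
Proof. by rewrite /L root_elt0 disp1. Qed.

Let L_unit a (c : A) p : c = 1 \/ c = -1 -> L a (c * p) = L a p.
Proof. by case=> ->; rewrite ?mul1r // mulN1r LN. Qed.

Let dispMr g h : disp act h 0 <= disp act g 0 + disp act (g * h)%g 0.
Proof. by have := dispM hact g^-1%g (g * h)%g 0; rewrite mulKg dispV. Qed.

Let dispMl g h : disp act g 0 <= disp act (g * h)%g 0 + disp act h 0.
Proof. by have := dispM hact (g * h)%g h^-1%g 0; rewrite mulgK dispV. Qed.

Let disp_comm g h z : (g * h = h * g * z)%g -> disp act z 0 <= 2 * disp act g 0 + 2 * disp act h 0.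
Proof.
move=> e; have := dispMr (h * g)%g z; rewrite -e.
by have := dispM hact g h 0; have := dispM hact h g 0; lra.
Qed.

Lemma good_bounded a : good Phi ip a -> bounded_root a.
Proof.
move=> [b [g [h ->]]].
(* Starting from (-g, b + g) puts b + g at index 2, the index of [hexagon_bounded]. *)
pose rot (x : E * E) := (x.1 + x.2, - x.1).
pose x i := X (iter i rot (- g, b + g)).1.
have rot_good i : good_pair Phi ip (iter i rot (- g, b + g)).1 (iter i rot (- g, b + g)).2.
  elim: i => [|i IHi] /=; last exact: (good_pair_rot PhiR crystal IHi).
  have rot5 := good_pair_rot PhiR crystal (good_pair_rot PhiR crystal (good_pair_rot PhiR crystal
    (good_pair_rot PhiR crystal (good_pair_rot PhiR crystal h)))).
  have e1 : b + g - b = g by lincomb R ltac:(lra).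
  have e2 : g - (b + g) = - b by lincomb R ltac:(lra).
  have e3 : - b - g = - (b + g) by lincomb R ltac:(lra).
  have e4 : - (b + g) - - b = - g by lincomb R ltac:(lra).
  by rewrite e1 e2 e3 e4 opprK in rot5.
(* 2 is put in front of the ring generators to obtain the dyadic chains. *)
pose gen (i : 'I_(size s).+1) := nth 0 (2 :: s) i.
have gen_span p : exists l, p = signed_sum gen l.
  apply: (monomials_span fg) => t ts.
  by exists (lift ord0 (Ordinal (etrans (index_mem t s) ts))); rewrite /gen lift0 /= nth_index.
have per i : x (i + 6)%N = x i.
  rewrite /x addnC iterD; congr (X _.1); rewrite -iterD addnC iterD; congr (iter i rot _).
  by rewrite /= /rot /=; congr (_, _); lincomb R ltac:(lra).
have heis i : heisenberg (x i) (x i.+1) (x i.+2).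
  rewrite /x /=; have -> : (iter i rot (- g, b + g)).1 + (iter i rot (- g, b + g)).2 -
     (iter i rot (- g, b + g)).1 = (iter i rot (- g, b + g)).2 by rewrite addrC addKr.
  exact: good_pair_heisenberg.
have := hexagon_bounded (gen := gen) erefl gen_span ucE hact per heis 0.
rewrite /x /= (_ : - g + (b + g) - - g = b + g) //; lincomb R ltac:(lra).
Qed.

Lemma frame_sum_bounded u w : frame Phi ip u w -> bounded_root u -> bounded_root w -> bounded_root (u + w).
Proof.
move=> fr [B1 h1] [B2 h2]; have [c1 [c2 [hc1 hc2 rel]]] := frame_relation fr.
apply: (bounded_of_squares (LD (u + w)) (LN (u + w)) fg) => q.
exists (2 * B1 + 2 * L (w - u) q + B2) => p.
rewrite -(L_unit _ _ hc2).
have := disp_comm (rel p q); have := dispMr (X w (c1 * (p * q))) (X (u + w) (c2 * (p ^+ 2 * q))).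
have := h1 p; have := h2 (c1 * (p * q)).
by rewrite /L; lra.
Qed.

Lemma frame_short_bounded u w : frame Phi ip u w -> bounded_root (w - u) -> bounded_root (w + u) ->
  bounded_root w.
Proof.
move=> fr [B1 h1] [B2 h2]; have [c1 [c2 [hc1 hc2 rel]]] := frame_relation fr.
exists (2 * L u 1 + 2 * B1 + B2) => q.
have := disp_comm (rel 1 q); have := dispMl (X w (c1 * (1 * q))) (X (u + w) (c2 * (1 ^+ 2 * q))).
rewrite -[disp act (X w _) 0]/(L w _) L_unit // mul1r.
have := h1 q; have := h2 (c2 * (1 ^+ 2 * q)); rewrite (addrC w u).
by rewrite /L; lra.
Qed.

Lemma g2_short_bounded b g : a2pair Phi ip b g -> b - g \in Phi -> bounded_root (g - b) ->
  bounded_root (b + b + g) -> bounded_root (g + g + b) -> bounded_root (b + g).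
Proof.
move=> h0 dP [B1 h1] [B2 h2] [B3 h3].
have [c1 [c2 [c3 [c4 [hc1 hc2 rel]]]]] := g2_relation h0 dP.
apply: (bounded_of_idempotents (L0 (b + g)) (LD (b + g)) (LN (b + g)) fg) => p.
(* With p' fixed, the product of the two short root elements is bounded uniformly in q, since the
   long roots and the conjugating factors are. *)
have W p' q : disp act (X g (c1 * (p' * q)) * X (b + g) (c2 * (p' ^+ 2 * q)))%g 0 <=
    2 * L b p' + 2 * B1 + B2 + B3.
  have := disp_comm (rel p' q).
  set x1 := X g _; set x2 := X (b + g) _; set x3 := X (b + b + g) _; set x4 := X (g + g + b) _.
  have := dispMl (x1 * x2)%g (x3 * x4)%g; rewrite -(mulgA x1); have := dispM hact x3 x4 0.
  have := h1 q; have := h2 (c3 * (p' ^+ 3 * q)); have := h3 (c4 * (p' ^+ 3 * q ^+ 2)).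
  by rewrite /L -/x3 -/x4; lra.
exists (2 * L b 1 + 2 * L b p + 4 * B1 + 2 * B2 + 2 * B3) => q.
rewrite -(L_unit _ _ hc2).
(* The parameters (1, p q) and (p, q) give the same element of the root g. In the quotient it
   cancels, leaving (p^2 - p) q at the root b + g. *)
have := dispM hact (X g (c1 * (1 * (p * q))) * X (b + g) (c2 * (1 ^+ 2 * (p * q))))^-1%g
  (X g (c1 * (p * q)) * X (b + g) (c2 * (p ^+ 2 * q)))%g 0.
rewrite dispV // mul1r invgM -mulgA mulKg -root_eltN -root_eltD.
have -> : - (c2 * (1 ^+ 2 * (p * q))) + c2 * (p ^+ 2 * q) = c2 * ((p ^+ 2 - p) * q) by ring.
have := W p q; have := W 1 (p * q); rewrite mul1r /L.
by lra.
Qed.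

Hypothesis irr : irreducible_root_system Phi.
Hypothesis dimE : (2 <= \dim {:E})%N.
Hypothesis notC2 : ~ root_system_iso Phi (root_system_C2 R).

Lemma root_bounded a : a \in Phi -> bounded_root a.
Proof.
move=> aP; case: (root_cases PhiR crystal red irr dimE notC2 aP).
- exact: good_bounded.
- by move=> [u [w [fr -> g1 g2]]]; apply: (frame_short_bounded fr); exact: good_bounded.
- by move=> [u [w [fr -> g1 g2]]]; apply: (frame_sum_bounded fr); exact: good_bounded.
- move=> [b [g [h0 dP ->]]]; have [g1 g2 g3] := g2_long_good PhiR crystal red h0 dP.
  by apply: (g2_short_bounded h0 dP); exact: good_bounded.
Qed.

End Displacement.
End BoundedRootSubgroups.

(** * From bounded displacement to a fixed point *)

Theorem theorem1p2 (R : realType) (E : vectType R) (Phi : {fset E})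
    (C : E -> E -> nat -> nat -> int) (A : comPzRingType) :
  root_system Phi ->
  classical_root_system Phi ->
  reduced_root_system Phi ->
  irreducible_root_system Phi ->
  (2 <= \dim {:E})%N ->
  ~ root_system_iso Phi (root_system_C2 R) ->
  chevalley_constants Phi C ->
  finitely_generated_ring A ->
  forall alpha : Phi,
    relative_F_class (root_subgroup C A alpha) (@uniformly_convex R).
Proof.
move=> PhiR [ip crystal] red irr dimE notC2 CP [s fg] alpha EE ucE act hact.
have [B hB] := root_bounded PhiR crystal red CP ucE hact fg irr dimE notC2 (fsvalP alpha).
have xE p : steinberg_x C alpha p = root_elt Phi C (val alpha) p by rewrite root_elt_val.
apply: (@bounded_orbit_fixed _ _ ucE _ _ hact (root_subgroup C A alpha) _ _ 0 B).
- move=> _ _ [p _ <-] [q _ <-]; exists (- p + q) => //; rewrite !xE root_eltD; congr (_ * _)%g.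
  apply: (mulgI (root_elt Phi C (val alpha) p)); rewrite -root_eltD subrr mulgV.
  by apply: (mulgI (root_elt Phi C (val alpha) 0)); rewrite -root_eltD addr0 mulg1.
- exists 0 => //; rewrite xE.
  by apply: (mulgI (root_elt Phi C (val alpha) 0)); rewrite -root_eltD addr0 mulg1.
- by move=> _ [p _ <-]; rewrite xE; exact: hB.
Qed.
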